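(* Let $\mathcal T_h$ be a quasi-uniform triangulation of a polygonal domain $\Omega\subset\mathbb R^2$ with boundary $\Gamma$ and outward unit normal $\mathbf n$, let $V_h$, $L_h$, $M_h$ be the finite element spaces, $a[\cdot,\cdot]$ (the stabilised form), $b[\cdot,\cdot]$ the bilinear forms and $\ell$ the linear form defined in the context, with data $f\in L^2(\Omega)$ and $g_D\in H^{1/2}(\Gamma)$. Let $0<r<1$ and let $\alpha$ be such that there is $\varepsilon>0$ with $\frac1{C_I}<r\varepsilon<\varepsilon<\alpha$, where $C_I$ is the inverse-estimate constant of the context. Then the saddle point problem of finding $(u_h,\sigma_h,\varphi_h)\in V_h\times L_h\times M_h$ such that $$a[(u_h,\sigma_h),(v_h,\tau_h)]+b[(v_h,\tau_h),\varphi_h]=\ell(v_h,\tau_h)\quad\text{for all }(v_h,\tau_h)\in V_h\times L_h,$$ $$b[(u_h,\sigma_h),\psi_h]=0\quad\text{for all }\psi_h\in M_h$$ has a unique solution $(u_h,\sigma_h,\varphi_h)\in V_h\times L_h\times M_h$. The solution also satisfies, with a mesh-independent constant $C$, $$\|(u_h,\sigma_h)\|_{V_h\times L_h}+\|\varphi_h\|_{0,\Omega}\le C\,\|f\|_{0,\Omega}.$$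
   Context: Norms: $\|\cdot\|_{0,S}$ is the $L^2(S)$ norm (also for vector fields) and $\|\cdot\|_{1,\Omega}$ is the full $H^1(\Omega)$ norm. With $e$ ranging over the edges of $\mathcal T_h$ contained in $\Gamma$ and $h_e$ the length of $e$, set $$\langle u,v\rangle_{1/2,h}=\sum_e\frac1{h_e}\int_e uv\,ds,\qquad \|v\|_{1/2,h}^2=\sum_e\frac1{h_e}\|v\|_{0,e}^2,\qquad \|z\|_{-1/2,h}^2=\sum_e h_e\|z\|_{0,e}^2,$$ $$\|u\|_{1,h}=\|u\|_{1,\Omega}+\|u\|_{1/2,h},\qquad \|(u_h,\sigma_h)\|_{V_h\times L_h}^2=\|u_h\|_{1,h}^2+\|\sigma_h\|_{0,\Omega}^2 .$$ Spaces: $V_h=\{v\in C^0(\Omega): v|_T\in\mathcal P_1(T),\ T\in\mathcal T_h\}\subset H^1(\Omega)$ is the standard linear finite element space with basis $\rho_1,\dots,\rho_N$ (no boundary conditions imposed), and $L_h=[V_h]^2$. The space $Q_h$ is spanned by $\mu_1,\dots,\mu_N$ satisfying the biorthogonality condition $\int_\Omega\rho_i\mu_j\,dx=c_j\delta_{ij}$ with $c_j\ne0$, $1\le i,j\le N$. The $\mu_j$ are constructed locally on a reference element, so that the basis functions of $V_h$ and $Q_h$ have the same support, and in each element the sum of all the basis functions of $Q_h$ is one. Finally $M_h=[Q_h]^2$. Forms: $$a[(u,\sigma),(v,\tau)]=r\int_\Omega\sigma\cdot\tau\,dx+(1-r)\int_\Omega\nabla u\cdot\nabla v\,dx+\alpha\langle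 u,v\rangle_{1/2,h}-\int_\Gamma(\sigma\cdot\mathbf n)\,v\,ds-\int_\Gamma(\tau\cdot\mathbf n)\,u\,ds,$$ $$b[(u,\sigma),\psi]=\int_\Omega(\sigma-\nabla u)\cdot\psi\,dx,$$ $$\ell(v,\tau)=\int_\Omega fv\,dx-\int_\Gamma(\tau\cdot\mathbf n)\,g_D\,ds+\alpha\langle g_D,v\rangle_{1/2,h}.$$ Inverse-estimate constant: $C_I>0$ is a mesh-independent constant such that $C_I\|\tau_h\cdot\mathbf n\|_{-1/2,h}^2\le\|\tau_h\|_{0,\Omega}^2$ for all $\tau_h\in L_h$.
   Formalization: The stability bound is proved with right-hand side C(‖f‖_{0,Ω} + ‖g_D‖_{1/2,h}); the printed bound by C‖f‖_{0,Ω} alone fails for f = 0, g_D = 1, and is recovered when g_D = 0. *)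

(* Defs.v *)
From HB Require Import structures.
From mathcomp Require Export all_boot all_order all_algebra.
From mathcomp Require Export all_classical all_reals all_analysis.
Export Order.TTheory GRing.Theory Num.Theory.
Export numFieldNormedType.Exports.

Set Implicit Arguments.
Unset Strict Implicit.
Unset Printing Implicit Defensive.

#[global] Open Scope classical_set_scope.
#[global] Open Scope ring_scope.

(* Points and vectors of the plane are pairs.  The library's norm on R * R is
   the max norm, so the Euclidean one is introduced here; the topology is the
   same. *)
Definition dot (R : realType) (x y : R * R) : R := x.1 * y.1 + x.2 * y.2.
Definition enorm (R : realType) (x : R * R) : R := Num.sqrt (dot x x).

Definition leb2 (R : realType) :
    {measure set (measurableTypeR R * measurableTypeR R) -> \bar R} :=
  (@lebesgue_measure R \x @lebesgue_measure R)%E.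

Definition int2 (R : realType) (S : set (R * R)) (w : R * R -> R) : R :=
  Rintegral (leb2 R) S w.

Definition L2 (R : realType) (S : set (R * R)) (w : R * R -> R) : Prop :=
  @measurable_fun _ _ (measurableTypeR R * measurableTypeR R)%type
    (measurableTypeR R) S w /\
  (\int[leb2 R]_(x in S) ((w x) ^+ 2)%:E < +oo)%E.

Definition L2norm (R : realType) (S : set (R * R)) (w : R * R -> R) : R :=
  Num.sqrt (int2 S (fun x => w x ^+ 2)).

Definition L2vnorm (R : realType) (S : set (R * R)) (w : R * R -> R * R) : R :=
  Num.sqrt (int2 S (fun x => dot (w x) (w x))).

Definition frontier (R : realType) (S : set (R * R)) : set (R * R) :=
  closure S `\` interior S.

Definition segment (R : realType) (p q : R * R) : set (R * R) :=
  [set x | (exists t : R, 0 <= t <= 1 /\ x = p + t *: (q - p))].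

(* [Omega = interior (closure Omega)] says that the domain does not lie on both
   sides of its boundary, which excludes slits. *)
Definition polygonal_domain (R : realType) (Omega : set (R * R)) : Prop :=
  [/\ open Omega /\ connected Omega, Omega !=set0, bounded_set Omega,
      Omega = interior (closure Omega) &
      exists segs : seq ((R * R) * (R * R))%type,
        frontier Omega =
        [set x | (exists s, s \in segs /\ segment s.1 s.2 x)]].

(* [tri k] lists the vertices of the k-th triangle; their order is the local
   numbering through which the triangle is the image of the reference one. *)
Record mesh (R : realType) := Mesh {
  nv : nat;
  vtx : 'I_nv -> R * R;
  nt : nat;
  tri : 'I_nt -> 'I_3 -> 'I_nv }.

Section MeshGeometry.
Context {R : realType} (M : mesh R).

Definition hull (A : {set 'I_(nv M)}) : set (R * R) :=
  [set x | exists w : 'I_(nv M) -> R,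
     [/\ forall i, 0 <= w i, forall i, i \notin A -> w i = 0,
         \sum_i w i = 1 & x = \sum_i w i *: vtx i]].

Definition vset (k : 'I_(nt M)) : {set 'I_(nv M)} := [set tri k i | i : 'I_3].

Definition elt (k : 'I_(nt M)) : set (R * R) := hull (vset k).

Definition pt (k : 'I_(nt M)) (i : 'I_3) : R * R := vtx (tri k i).

Definition refmap (k : 'I_(nt M)) (x : R * R) : R * R :=
  pt k 0 + x.1 *: (pt k 1 - pt k 0) + x.2 *: (pt k 2%:R - pt k 0).

Definition jacobian (k : 'I_(nt M)) : R :=
  let p := pt k 1 - pt k 0 in let q := pt k 2%:R - pt k 0 in
  p.1 * q.2 - p.2 * q.1.

(* Local edge [i] of a triangle joins its local vertices [i] and [i + 1]
   (modulo 3) and is opposite to [i + 2]. *)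
Definition edge (k : 'I_(nt M)) (i : 'I_3) : set (R * R) :=
  segment (pt k i) (pt k (i + 1)).

Definition elen (k : 'I_(nt M)) (i : 'I_3) : R :=
  enorm (pt k (i + 1) - pt k i).

Definition enormal (k : 'I_(nt M)) (i : 'I_3) : R * R :=
  let d := pt k (i + 1) - pt k i in
  let m : R * R := (d.2, - d.1) in
  (- Num.sg (dot m (pt k (i + 2%:R) - pt k i)) / enorm m) *: m.

Definition epar (k : 'I_(nt M)) (i : 'I_3) (t : R) : R * R :=
  pt k i + t *: (pt k (i + 1) - pt k i).

Definition eint (k : 'I_(nt M)) (i : 'I_3) (w : R * R -> R) : R :=
  elen k i *
  \int[@lebesgue_measure R]_(t in `[0, 1]) w (epar k i t).

(* The diameter of a triangle is the length of its longest edge. *)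
Definition hmax : R :=
  \big[Num.max/0]_(k < nt M) \big[Num.max/0]_(i < 3) elen k i.

End MeshGeometry.

(* Conforming triangulation: two distinct triangles are disjoint or meet in a
   common vertex or a common edge. *)
Definition triangulation (R : realType) (Omega : set (R * R)) (M : mesh R) :
    Prop :=
  [/\ injective (@vtx R M),
      forall k : 'I_(nt M), jacobian k != 0,
      (forall j : 'I_(nv M), exists k, j \in vset k) /\ injective (@vset R M),
      closure Omega = \bigcup_(k : 'I_(nt M)) elt k &
      forall k l : 'I_(nt M), k != l ->
        elt k `&` elt l = hull (vset k :&: vset l)].

Definition quasi_uniform (R : realType) (Th : set (mesh R)) : Prop :=
  exists2 c : R, 0 < c &
    forall M, Th M -> forall k : 'I_(nt M),
      exists z, [set x | enorm (x - z) <= c * hmax M] `<=` elt k.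

Section Spaces.
Context {R : realType} (Omega : set (R * R)) (M : mesh R).

(* An edge contained in the boundary belongs to exactly one triangle, so each
   boundary edge is represented by exactly one pair [(k, i)]. *)
Definition bedge (k : 'I_(nt M)) (i : 'I_3) : bool :=
  `[< edge k i `<=` frontier Omega >].

(* Sum over the boundary edges [e]; [F] receives [h_e], the outward unit normal
   on [e] and the functional [w |-> \int_e w ds]. *)
Definition bsum (F : R -> R * R -> ((R * R -> R) -> R) -> R) : R :=
  \sum_(k < nt M) \sum_(i < 3 | bedge k i)
    F (elen k i) (enormal k i) (eint k i).

Definition ip_half (u v : R * R -> R) : R :=
  bsum (fun h _ int_e => h^-1 * int_e (fun x => u x * v x)).

Definition norm_half (v : R * R -> R) : R := Num.sqrt (ip_half v v).

Definition normal_norm_mhalf_sq (s : R * R -> R * R) : R :=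
  bsum (fun h n int_e => h * int_e (fun x => dot (s x) n ^+ 2)).

Definition bint_normal (s : R * R -> R * R) (v : R * R -> R) : R :=
  bsum (fun _ n int_e => int_e (fun x => dot (s x) n * v x)).

(* H^{1/2}(Gamma) with the Sobolev-Slobodeckij seminorm
   \int_Gamma \int_Gamma |g(x) - g(y)|^2 / |x - y|^2 ds(x) ds(y).
   Arc length is computed along the boundary edges of the mesh; the resulting
   space does not depend on how the boundary is subdivided. *)
Definition Hhalf (g : R * R -> R) : Prop :=
  (forall k i, bedge k i ->
     measurable_fun `[0 : R, 1] (g \o epar k i) /\
     (\int[@lebesgue_measure R]_(t in `[0%R, 1%R])
        ((g (epar k i t)) ^+ 2)%:E < +oo)%E) /\
  (forall k i l j, bedge k i -> bedge l j ->
     (\int[leb2 R]_(z in `[0%R, 1%R] `*` `[0%R, 1%R])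
        (elen k i * elen l j *
         ((g (epar k i z.1) - g (epar l j z.2)) /
          enorm (epar k i z.1 - epar l j z.2)) ^+ 2)%:E < +oo)%E).

Definition Vh (v : R * R -> R) : Prop :=
  {within closure Omega, continuous v} /\
  forall k : 'I_(nt M), exists (a : R * R) (b : R),
    forall x, elt k x -> v x = dot a x + b.

Definition vec (P : (R * R -> R) -> Prop) (s : R * R -> R * R) : Prop :=
  P (fun x => (s x).1) /\ P (fun x => (s x).2).

Definition Lh : (R * R -> R * R) -> Prop := vec Vh.

(* The weak gradient of a function of [Vh], which is its elementwise classical
   gradient; the representative chosen vanishes on the edges, a null set. *)
Definition grad (u : R * R -> R) (x : R * R) : R * R :=
  if `[< exists k : 'I_(nt M), interior (elt k) x >]
  then (derive1 (fun t : R => u (t, x.2)) x.1, derive1 (fun t : R => u (x.1, t)) x.2)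
  else 0.

Definition norm_H1 (u : R * R -> R) : R :=
  Num.sqrt (L2norm Omega u ^+ 2 + L2vnorm Omega (grad u) ^+ 2).

Definition norm_1h (u : R * R -> R) : R := norm_H1 u + norm_half u.

Definition norm_VL (u : R * R -> R) (s : R * R -> R * R) : R :=
  Num.sqrt (norm_1h u ^+ 2 + L2vnorm Omega s ^+ 2).

Definition nodal_basis (rho : 'I_(nv M) -> R * R -> R) : Prop :=
  forall i, Vh (rho i) /\ forall j, rho i (vtx j) = (i == j)%:R.

Definition ref_triangle : set (R * R) :=
  [set x | [/\ 0 <= x.1, 0 <= x.2 & x.1 + x.2 <= 1]].

(* [muref i] are the shape functions on the reference triangle from which the
   biorthogonal basis [mu] is built on every element. *)
Definition biorthogonal_basis (muref : 'I_3 -> R * R -> R)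
    (rho mu : 'I_(nv M) -> R * R -> R) : Prop :=
  [/\ (forall j, L2 Omega (mu j)) /\
      (exists c : 'I_(nv M) -> R, (forall j, c j != 0) /\
         forall i j, int2 Omega (fun x => rho i x * mu j x) = c j * (i == j)%:R),
      forall (k : 'I_(nt M)) (i : 'I_3) (x : R * R), interior ref_triangle x ->
        mu (tri k i) (refmap k x) = muref i x,
      forall (k : 'I_(nt M)) j (x : R * R), j \notin vset k -> interior (elt k) x -> mu j x = 0,
      forall j, closure (Omega `&` [set x | mu j x != 0]) =
                closure (Omega `&` [set x | rho j x != 0]) &
      forall (k : 'I_(nt M)) (x : R * R), interior (elt k) x -> \sum_j mu j x = 1].

Definition Qh (mu : 'I_(nv M) -> R * R -> R) (q : R * R -> R) : Prop :=
  exists c : 'I_(nv M) -> R, forall x, Omega x -> q x = \sum_j c j * mu j x.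

Definition Mh (mu : 'I_(nv M) -> R * R -> R) : (R * R -> R * R) -> Prop :=
  vec (Qh mu).

Definition inverse_estimate (CI : R) : Prop :=
  forall s, Lh s -> CI * normal_norm_mhalf_sq s <= L2vnorm Omega s ^+ 2.

Definition aform (r alpha : R) (u : R * R -> R) (s : R * R -> R * R)
    (v : R * R -> R) (t : R * R -> R * R) : R :=
  r * int2 Omega (fun x => dot (s x) (t x))
  + (1 - r) * int2 Omega (fun x => dot (grad u x) (grad v x))
  + alpha * ip_half u v - bint_normal s v - bint_normal t u.

Definition bform (u : R * R -> R) (s psi : R * R -> R * R) : R :=
  int2 Omega (fun x => dot (s x - grad u x) (psi x)).

Definition lform (alpha : R) (f gD : R * R -> R)
    (v : R * R -> R) (t : R * R -> R * R) : R :=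
  int2 Omega (fun x => f x * v x) - bint_normal t gD + alpha * ip_half gD v.

Definition solution (mu : 'I_(nv M) -> R * R -> R) (r alpha : R)
    (f gD u : R * R -> R) (s phi : R * R -> R * R) : Prop :=
  [/\ Vh u, Lh s, Mh mu phi,
      forall v t, Vh v -> Lh t ->
        aform r alpha u s v t + bform v t phi = lform alpha f gD v t &
      forall psi, Mh mu psi -> bform u s psi = 0].

End Spaces.

(* Main.v *)
(* Coercivity: by the inverse estimate and Young's inequality with parameter [eps], the
   boundary terms of [a[(v, s), (v, s)]] are absorbed by [r |s|^2] and [alpha |v|_{1/2,h}^2],
   which leaves a multiple of [|s|^2 + |grad v|^2 + |v|_{1/2,h}^2].  The [L2] norm of [v] is
   recovered from Friedrichs' inequality, proved by summing over the triangles the divergence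
   theorem for the field [(x v^2, 0)]: the edge terms are explicit cubic integrals, and those
   of an interior edge cancel because it bounds exactly one triangle on each side.

   Multiplier: for [phi = sum_j d_j mu_j], testing with [tau = sum_j d_j rho_j] gives, since
   [c_j = \int rho_j] by [sum_j mu_j = 1], a value [sum_j d_j^2 c_j] comparable, by scaling to
   the reference triangle, to both [|phi|^2] and [|tau|^2].

   Existence: biorthogonality makes [(rho_n, sigma_n)], with [sigma_n] the quasi-projection of
   [grad rho_n], a basis of the kernel of [b]; the reduced linear system is definite by
   coercivity, and the multiplier is then read off its coefficients against [rho_j]. *)
Require Import Defs.
From mathcomp Require Import measurable_realfun ring lra.

Set Implicit Arguments.
Unset Strict Implicit.
Unset Printing Implicit Defensive.

(** * Square-integrable functions *)

(** Every estimate is stated for squared norms, and every product is split by Young's inequality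
    with a free parameter. Each absorption argument then becomes linear arithmetic in a few real
    unknowns, and square roots return only at the end.

    The constants must not see the mesh. They involve [r], [alpha], [eps], [CI], the half-width [K]
    of a box containing [Omega], and the L2 norms of the shape functions on the reference triangle.
    This is possible because the weights [|jacobian k|] occur identically in all the norms to be
    compared, and because in Friedrichs' inequality only boundary edges survive, with coordinates
    and lengths controlled by [K].

    The boundary datum has to appear in the final bound: for [f = 0] and [gD = 1] the triple
    [(1, 0, 0)] solves the problem, so no multiple of the norm of [f] alone can dominate the
    solution.

    Functions are total on the plane, whereas the spaces constrain them on [closure Omega] or
    [Omega] only. Nodal expansions are therefore equalities on these sets, and the forms have to be
    shown insensitive to values elsewhere. *)

Section SquareIntegrable.
Context d (T : measurableType d) (R : realType).
Variables (mu : {measure set T -> \bar R}) (D : set T).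
Hypothesis mD : measurable D.

(** Membership in L2 with integrability of the square as the second component, the form in which
    linearity of the integral applies directly; [sqintP] converts from a finite integral. *)
Definition sqint (w : T -> R) : Prop :=
  measurable_fun D w /\ mu.-integrable D (EFin \o (fun x => w x ^+ 2)).

Lemma sqintP (w : T -> R) : sqint w <->
  measurable_fun D w /\ (\int[mu]_(x in D) ((w x) ^+ 2)%:E < +oo)%E.
Proof.
split=> [[mw /integrableP[_ iw]]|[mw iw]]; split => //.
  apply: le_lt_trans iw; apply: ge0_le_integral => //=.
  - by move=> x _; rewrite lee_fin sqr_ge0.
  - by apply/measurable_EFinP; apply: measurable_funX.
  - by apply/measurable_EFinP; apply: measurableT_comp => //; apply: measurable_funX.
  - by move=> x _; rewrite lee_fin ler_norm.
apply/integrableP; split.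
  by apply/measurable_EFinP; apply: measurable_funX.
rewrite (eq_integral (fun x => ((w x) ^+ 2)%:E)) //= => x _.
by rewrite ger0_norm // sqr_ge0.
Qed.

(** The product is dominated by [v ^+ 2 + w ^+ 2]. *)
Lemma sqint_mul (v w : T -> R) : sqint v -> sqint w ->
  mu.-integrable D (EFin \o (fun x => v x * w x)).
Proof.
move=> [mv iv] [mw iw].
apply: (@le_integrable _ _ _ mu D mD _
  ((EFin \o (fun x => v x ^+ 2)%R) \+ (EFin \o (fun x => w x ^+ 2)%R))%E).
- by apply/measurable_EFinP; apply: measurable_funM.
- move=> x _ /=; rewrite lee_fin [leRHS]ger0_norm; last by rewrite addr_ge0 ?sqr_ge0.
  rewrite normrM; have := sqr_ge0 (`|v x| - `|w x|).
  rewrite -(real_normK (num_real (v x))) -(real_normK (num_real (w x))).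
  have := normr_ge0 (v x); have := normr_ge0 (w x); nra.
- exact: integrableD.
Qed.

Lemma eq_sqint (v w : T -> R) : {in D, v =1 w} -> sqint v -> sqint w.
Proof.
move=> vw [mv iv]; split; first exact: eq_measurable_fun mv.
by apply: (eq_integrable mD) iv => // x xD /=; rewrite vw.
Qed.

Lemma sqintD (v w : T -> R) : sqint v -> sqint w -> sqint (fun x => v x + w x).
Proof.
move=> hv hw; case: (hv) (hw) => [mv iv] [mw iw]; split.
  exact: measurable_funD.
have := integrableD mD (integrableD mD iv iw)
  (integrableZl mD 2 (sqint_mul hv hw)).
apply: (eq_integrable mD) => // x _ /=.
by rewrite -EFinM -!EFinD; congr EFin; ring.
Qed.

Lemma sqintZ (a : R) (v : T -> R) : sqint v -> sqint (fun x => a * v x).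
Proof.
move=> [mv iv]; split; first exact: measurable_funM.
apply: (eq_integrable mD) (integrableZl mD (a ^+ 2) iv) => // x _ /=.
by rewrite -EFinM exprMn.
Qed.

Lemma sqint0 : sqint (fun=> 0).
Proof.
split; first exact: measurable_cst.
apply: (eq_integrable mD (cst 0%E)); last exact: integrable0.
by move=> x _ /=; rewrite expr0n.
Qed.

Lemma sqintB (v w : T -> R) : sqint v -> sqint w -> sqint (fun x => v x - w x).
Proof.
move=> hv hw; have := sqintD hv (sqintZ (-1) hw).
by apply: eq_sqint => x _; rewrite mulN1r.
Qed.

Lemma sqint_sum (I : Type) (s : seq I) (P : pred I) (F : I -> T -> R) :
  (forall i, P i -> sqint (F i)) -> sqint (fun x => \sum_(i <- s | P i) F i x).
Proof.
move=> hF; elim: s => [|i s IH].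
  by apply: eq_sqint sqint0 => x _; rewrite big_nil.
have [Pi|Pi] := boolP (P i).
  by apply: eq_sqint (sqintD (hF i Pi) IH) => x _; rewrite big_cons Pi.
by apply: eq_sqint IH => x _; rewrite big_cons (negbTE Pi).
Qed.

Lemma bounded_sqint (v : T -> R) (K : R) : (mu D < +oo)%E ->
  measurable_fun D v -> (forall x, D x -> `|v x| <= K) -> sqint v.
Proof.
move=> fD mv bv; split => //.
apply: measurable_bounded_integrable => //; first exact: measurable_funX.
exists (K ^+ 2); split; first exact: num_real.
move=> M KM x Dx /=; apply: le_trans (ltW KM).
by rewrite normrX lerXn2r // ?nnegrE ?(le_trans _ (bv x Dx)) ?bv.
Qed.

Definition pair_int (v w : T -> R) : R := \int[mu]_(x in D) (v x * w x).

Lemma pair_intC v w : pair_int v w = pair_int w v.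
Proof. by apply: eq_Rintegral => x _; rewrite mulrC. Qed.

Lemma pair_intDl v1 v2 w : sqint v1 -> sqint v2 -> sqint w ->
  pair_int (fun x => v1 x + v2 x) w = pair_int v1 w + pair_int v2 w.
Proof.
move=> h1 h2 h; rewrite /pair_int -RintegralD //; try exact: sqint_mul.
by apply: eq_Rintegral => x _; rewrite mulrDl.
Qed.

Lemma pair_intZl a v w : sqint v -> sqint w ->
  pair_int (fun x => a * v x) w = a * pair_int v w.
Proof.
move=> h1 h2; rewrite /pair_int -RintegralZl //; last exact: sqint_mul.
by apply: eq_Rintegral => x _; rewrite mulrA.
Qed.

Lemma eq_pair_int v1 v2 w1 w2 : {in D, v1 =1 v2} -> {in D, w1 =1 w2} ->
  pair_int v1 w1 = pair_int v2 w2.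
Proof. by move=> h1 h2; apply: eq_Rintegral => x xD; rewrite h1 ?h2. Qed.

Lemma pair_int0l w : pair_int (fun=> 0) w = 0.
Proof.
rewrite /pair_int (@eq_Rintegral _ _ _ _ _ (fun=> 0)) ?Rintegral_cst ?mul0r //.
by move=> x _; rewrite mul0r.
Qed.

Lemma pair_int_suml (I : Type) (s : seq I) (P : pred I) (F : I -> T -> R) w :
  (forall i, P i -> sqint (F i)) -> sqint w ->
  pair_int (fun x => \sum_(i <- s | P i) F i x) w =
  \sum_(i <- s | P i) pair_int (F i) w.
Proof.
move=> hF hw; elim: s => [|i s IH].
  rewrite big_nil -[RHS](pair_int0l w); apply: eq_pair_int => // x _.
  by rewrite big_nil.
rewrite big_cons; case: ifP => Pi.
  have hFi := hF i Pi; have hFs := sqint_sum s hF.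
  rewrite -IH -pair_intDl //.
  by apply: eq_pair_int => // x _; rewrite big_cons Pi.
by rewrite -IH; apply: eq_pair_int => // x _; rewrite big_cons Pi.
Qed.

Lemma pair_int_sqr_ge0 v : 0 <= pair_int v v.
Proof. by apply: Rintegral_ge0 => x _; rewrite -expr2 sqr_ge0. Qed.

(** Expand the integral of [(v - e * w) ^+ 2], which is nonnegative, and divide by [e]. *)
Lemma pair_int_young (e : R) v w : 0 < e -> sqint v -> sqint w ->
  2 * pair_int v w <= e^-1 * pair_int v v + e * pair_int w w.
Proof.
move=> e0 hv hw.
have hz := sqintB hv (sqintZ e hw).
have := pair_int_sqr_ge0 (fun x => v x + (- e) * w x).
have hew := sqintZ (- e) hw.
rewrite pair_intDl //; last exact: sqintD.
rewrite pair_intC pair_intDl // [X in _ + X]pair_intC pair_intDl //.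
rewrite !pair_intZl // !(pair_intC _ (fun x => - e * w x)) !pair_intZl //.
rewrite (pair_intC w v) => h.
rewrite -(ler_pM2l e0) mulrDr mulVKf ?gt_eqF //.
set a := pair_int v v in h *; set b := pair_int v w in h *; set c := pair_int w w in h *.
nra.
Qed.

Lemma pair_int_sqr v : pair_int v v = \int[mu]_(x in D) (v x ^+ 2).
Proof. by apply: eq_Rintegral => x _; rewrite expr2. Qed.

Lemma sqint_bounded_mul (f w : T -> R) (K : R) : measurable_fun D f ->
  (forall x, D x -> `|f x| <= K) -> sqint w ->
  sqint (fun x => f x * w x) /\
  pair_int (fun x => f x * w x) (fun x => f x * w x) <= K ^+ 2 * pair_int w w.
Proof.
move=> mf fK hw; case: (hw) => mw iw.
have le x : D x -> (f x * w x) ^+ 2 <= K ^+ 2 * w x ^+ 2.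
  move=> Dx; rewrite exprMn ler_wpM2r ?sqr_ge0 // -[f x ^+ 2]real_normK ?num_real //.
  by rewrite lerXn2r ?nnegrE ?(le_trans _ (fK x Dx)) ?fK.
have iK : mu.-integrable D (EFin \o (fun x => K ^+ 2 * w x ^+ 2)) :=
  integrableZl mD (K ^+ 2) iw.
have mfw : measurable_fun D (fun x => f x * w x) by exact: measurable_funM.
have ifw : mu.-integrable D (EFin \o (fun x => (f x * w x) ^+ 2)).
  apply: (le_integrable mD) iK.
    by apply/measurable_EFinP; exact: measurable_funX.
  move=> x Dx /=; rewrite lee_fin ger0_norm ?sqr_ge0 // ger0_norm ?le //.
  by rewrite mulr_ge0 // sqr_ge0.
split => //; rewrite !pair_int_sqr -RintegralZl //.
exact: le_Rintegral.
Qed.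

End SquareIntegrable.

Section PairInt.
Context d (T : measurableType d) (R : realType).
Variables (mu : {measure set T -> \bar R}) (D : set T).
Hypothesis mD : measurable D.

Lemma pair_int_young_norm (e : R) v w : 0 < e -> sqint mu D v -> sqint mu D w ->
  2 * `|pair_int mu D v w| <= e^-1 * pair_int mu D v v + e * pair_int mu D w w.
Proof.
move=> e0 hv hw; have h1 := pair_int_young mD e0 hv hw.
have hw' := sqintZ mD (-1) hw.
have := pair_int_young mD e0 hv hw'.
rewrite (pair_intC _ _ v (fun x => _ * w x)) !(pair_intZl mD) //.
rewrite (pair_intC _ _ w (fun x => _ * w x)) (pair_intZl mD) // (pair_intC _ _ w v).
rewrite !mulN1r opprK => h2.
by have [h|h] := ger0P (pair_int mu D v w); lra.
Qed.

Lemma pair_int_eq0 v w : sqint mu D v -> sqint mu D w ->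
  pair_int mu D v v = 0 -> pair_int mu D v w = 0.
Proof.
move=> hv hw v0; apply/eqP/negPn/negP => n0.
set p := pair_int mu D v w in n0.
have p0 : 0 < `|p| by rewrite normr_gt0.
have ww := pair_int_sqr_ge0 mu D w.
(* With this parameter Young's inequality bounds [2 * |p|] by at most [|p|], a contradiction; the
   [+ 1] avoids a zero denominator. *)
have e0 : 0 < `|p| / (pair_int mu D w w + 1) by rewrite divr_gt0 //; lra.
have := pair_int_young_norm e0 hv hw; rewrite v0 mulr0 add0r -/p => h.
have : `|p| / (pair_int mu D w w + 1) * pair_int mu D w w <= `|p|.
  by rewrite mulrAC ler_pdivrMr ?ltr_wpDl // ler_wpM2l // lerDl.
lra.
Qed.

End PairInt.

(** * Affine changes of variables *)

Section Affine1.
Context {R : realType}.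
Local Notation leb := (@lebesgue_measure R).

Lemma measurable_affine (a b : R) :
  measurable_fun setT ((fun x => a * x + b) : measurableTypeR R -> measurableTypeR R).
Proof. by apply: measurable_funD => //; apply: measurable_funM. Qed.

(** Both sides are measures, so by uniqueness of Lebesgue measure it suffices to compare them on
    half-open intervals. A negative [a] turns the preimage into an interval closed on the left
    instead, of the same length. *)
Lemma lebesgue_measure_affine (a b : R) : a != 0 ->
  forall A, measurable A ->
  leb A = (`|a|%:E * pushforward leb ((fun x => a * x + b)%R :
             measurableTypeR R -> measurableTypeR R) A)%E.
Proof.
move=> a0 A mA.
pose f := (fun x => a * x + b)%R : measurableTypeR R -> measurableTypeR R.
have mf : measurable_fun setT f := measurable_affine a b.
pose m : {measure set (measurableTypeR R) -> \bar R} :=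
  mscale (NngNum (normr_ge0 a)) (measure_function_pushforward__canonical__measure_function_Measure leb mf).
rewrite (@lebesgue_measure_unique R m) //= => _ [[p q]] _ <-.
rewrite /m /mscale /= /pushforward.
have [a0'|a0'] := ltP 0 a.
  have -> : f @^-1` (`]p, q]%classic) = `](p - b) / a, (q - b) / a]%classic.
    by apply/seteqP; split => x /=; rewrite !in_itv /= /f
      ltr_pdivrMr // ler_pdivlMr // ltrBlDr lerBrDr (mulrC a).
  rewrite !lebesgue_measure_itv /= !lte_fin ltr_pM2r ?invr_gt0 // ltrD2r.
  case: ifP => pq; last by rewrite mule0.
  by rewrite -!EFinB -EFinM gtr0_norm //; congr EFin; field.
have {a0'}an : a < 0 by rewrite lt_neqAle a0.
have -> : f @^-1` (`]p, q]%classic) = `[(q - b) / a, (p - b) / a[%classic.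
  by apply/seteqP; split => x /=; rewrite !in_itv /= /f
    ltr_ndivlMr // ler_ndivrMr // ltrBlDr lerBrDr (mulrC a) andbC.
rewrite !lebesgue_measure_itv /= !lte_fin ltr_nM2r ?invr_lt0 // ltrD2r.
case: ifP => pq; last by rewrite mule0.
by rewrite -!EFinB -EFinM ltr0_norm //; congr EFin; field.
Qed.

Lemma ge0_integral_affine (a b : R) (f : R -> \bar R) : a != 0 ->
  measurable_fun setT f -> (forall x, 0 <= f x)%E ->
  (\int[leb]_x f x = `|a|%:E * \int[leb]_x f (a * x + b)%R)%E.
Proof.
move=> a0 mf f0.
pose g := (fun x => a * x + b)%R : measurableTypeR R -> measurableTypeR R.
have mg : measurable_fun setT g := measurable_affine a b.
pose m : {measure set (measurableTypeR R) -> \bar R} :=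
  mscale (NngNum (normr_ge0 a)) (measure_function_pushforward__canonical__measure_function_Measure leb mg).
transitivity (\int[m]_x f x)%E.
  by apply: eq_measure_integral => A mA _; exact: lebesgue_measure_affine.
transitivity (`|a|%:E * \int[pushforward leb g]_x f x)%E.
  exact: (ge0_integral_mscale (measure_function_pushforward__canonical__measure_function_Measure leb mg)).
congr (_ * _)%E.
exact: (ge0_integral_pushforward mg leb (D := setT)).
Qed.

End Affine1.

Section Affine2.
Context {R : realType}.
Local Notation leb := (@lebesgue_measure R).
Local Notation mR := (measurableTypeR R).
Local Notation mR2 := (measurableTypeR R * measurableTypeR R)%type.

Definition affine2 (p q e s t f : R) : mR2 -> mR2 :=
  fun z => (p * z.1 + q * z.2 + e, s * z.1 + t * z.2 + f).

Lemma measurable_linear2 (p q e : R) :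
  measurable_fun setT ((fun z => p * z.1 + q * z.2 + e) : mR2 -> mR).
Proof.
apply: measurable_funD => //.
by apply: measurable_funD; apply: measurable_funM.
Qed.

Lemma measurable_affine2 (p q e s t f : R) :
  measurable_fun setT (affine2 p q e s t f).
Proof. by apply: measurable_fun_pair; exact: measurable_linear2. Qed.

(** The map is split into two substitutions that each change one variable while the other is frozen;
    the one-dimensional formula applies to each under Tonelli. When [p = 0] the two variables
    exchange roles, which is why this case is separate. *)
Lemma ge0_integral_affine2 (p q e s t f : R) (G : mR2 -> \bar R) :
  p * t - q * s != 0 ->
  measurable_fun setT G -> (forall z, 0 <= G z)%E ->
  (\int[leb2 R]_z G z =
   `|p * t - q * s|%:E * \int[leb2 R]_z G (affine2 p q e s t f z))%E.
Proof.
move=> D0 mG G0.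
have mGA a b c a' b' c' :
    measurable_fun setT (fun z : mR2 => G (affine2 a b c a' b' c' z)).
  exact: measurableT_comp mG (measurable_affine2 _ _ _ _ _ _).
have [p0|p0] := eqVneq p 0.
  have /andP[q0 s0] : (q != 0) && (s != 0).
    by move: D0; rewrite p0 mul0r sub0r oppr_eq0 mulf_eq0 negb_or.
  rewrite (fubini_tonelli1 (m1 := leb) (m2 := leb) G) //.
  rewrite (ge0_integral_affine e q0); last 2 first.
  - exact: (measurable_fun_fubini_tonelli_F (m2 := leb) G).
  - by move=> x; apply: integral_ge0.
  have -> : `|p * t - q * s| = `|q| * `|s| by rewrite -normrM p0 mul0r sub0r normrN.
  rewrite EFinM -muleA; congr (_ * _)%E.
  rewrite (fubini_tonelli2 (m1 := leb) (m2 := leb)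
    (fun z => G (affine2 p q e s t f z))) //.
  rewrite -ge0_integralZl //; last 2 first.
  - exact: (measurable_fun_fubini_tonelli_G (m1 := leb)
      (fun z => G (affine2 p q e s t f z))).
  - by move=> y _; apply: integral_ge0.
  apply: eq_integral => y _; rewrite /fubini_F /fubini_G.
  rewrite (ge0_integral_affine (t * y + f) s0) //; last first.
    exact: (measurable_fun_pair2 (f := G)).
  congr (_ * _)%E; apply: eq_integral => x _; congr G.
  by rewrite /affine2 /= p0; congr pair; ring.
have Dp0 : (p * t - q * s) / p != 0 by rewrite mulf_neq0 ?invr_neq0.
rewrite (fubini_tonelli1 (m1 := leb) (m2 := leb) G) //.
(* First [y] is replaced by [s / p * x + k * y + c], then [x] by [p * x + q * y + e]. The constants
   [k] and [c] make the composite equal to the given map, and the factors [|k|] and [|p|] multiply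
   to the determinant. *)
pose k := (p * t - q * s) / p; pose c := f - s * e / p.
pose H := fun z : mR2 => G (affine2 1 0 0 (s / p) k c z).
have mH : measurable_fun setT H := mGA _ _ _ _ _ _.
have H0 z : (0 <= H z)%E by exact: G0.
transitivity (`|k|%:E * \int[leb]_x fubini_F leb H x)%E.
  rewrite -ge0_integralZl //; last 2 first.
  - exact: (measurable_fun_fubini_tonelli_F (m2 := leb) H).
  - by move=> x _; apply: integral_ge0.
  apply: eq_integral => x _; rewrite /fubini_F.
  rewrite (ge0_integral_affine (s / p * x + c) Dp0) //; last first.
    exact: (measurable_fun_pair2 (f := G)).
  congr (_ * _)%E; apply: eq_integral => y _; congr G.
  by rewrite /affine2 /k /=; congr pair; ring.
have -> : `|p * t - q * s| = `|k| * `|p|.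
  by rewrite -normrM /k mulfVK.
rewrite EFinM -muleA; congr (_ * _)%E.
rewrite -(fubini_tonelli1 (m1 := leb) (m2 := leb) H) //.
rewrite (fubini_tonelli2 (m1 := leb) (m2 := leb) H) //.
rewrite (fubini_tonelli2 (m1 := leb) (m2 := leb)
    (fun z => G (affine2 p q e s t f z))) //.
rewrite -ge0_integralZl //; last 2 first.
- exact: (measurable_fun_fubini_tonelli_G (m1 := leb)
      (fun z => G (affine2 p q e s t f z))).
- by move=> y _; apply: integral_ge0.
apply: eq_integral => y _; rewrite /fubini_G.
rewrite (ge0_integral_affine (q * y + e) p0) //; last first.
  exact: (measurable_fun_pair1 (f := H) y mH).
congr (_ * _)%E; apply: eq_integral => x _; congr G.
by rewrite /affine2 /k /c /=; congr pair; field.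
Qed.

Lemma ge0_integral_affine2_in (p q e s t f : R) (S : set mR2) (G : mR2 -> \bar R) :
  p * t - q * s != 0 -> measurable S ->
  measurable_fun S G -> (forall z, S z -> 0 <= G z)%E ->
  (\int[leb2 R]_(z in S) G z =
   `|p * t - q * s|%:E *
   \int[leb2 R]_(z in affine2 p q e s t f @^-1` S) G (affine2 p q e s t f z))%E.
Proof.
move=> D0 mS mG G0; rewrite integral_mkcond (ge0_integral_affine2 e f D0).
- by rewrite [in RHS]integral_mkcond; congr (_ * _)%E.
- exact: (measurable_restrictT G mS).1 mG.
- by move=> z; rewrite /patch; case: ifPn => // /set_mem /G0.
Qed.

Lemma Rintegral_affine2 (p q e s t f : R) (S : set mR2) (w : mR2 -> R) :
  p * t - q * s != 0 -> measurable S ->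
  (leb2 R).-integrable S (EFin \o w) ->
  int2 S w = `|p * t - q * s| *
    int2 (affine2 p q e s t f @^-1` S) (w \o affine2 p q e s t f).
Proof.
move=> D0 mS iw; have mw := measurable_int _ iw.
have mp := measurable_funepos mw; have mn := measurable_funeneg mw.
have := integrable_pos_fin_num mS iw; have := integrable_neg_fin_num mS iw.
have -> : int2 S w = fine (\int[leb2 R]_(z in S) (EFin \o w)^\+ z -
    \int[leb2 R]_(z in S) (EFin \o w)^\- z)%E.
  by rewrite /int2 /Rintegral -integralE.
set A := affine2 p q e s t f.
have -> : int2 (A @^-1` S) (w \o A) =
    fine (\int[leb2 R]_(z in A @^-1` S) (EFin \o w)^\+ (A z) -
    \int[leb2 R]_(z in A @^-1` S) (EFin \o w)^\- (A z))%E.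
  rewrite /int2 /Rintegral integralE; congr (fine (_ - _)).
  - by apply: eq_integral => z _; rewrite !unlock.
  - by apply: eq_integral => z _; rewrite !unlock.
rewrite (ge0_integral_affine2_in e f D0 mS mp); last by move=> z _; exact: funepos_ge0.
rewrite (ge0_integral_affine2_in e f D0 mS mn); last by move=> z _; exact: funeneg_ge0.
rewrite -/A.
set a := (\int[_]_(z in _) (EFin \o w)^\- (A z))%E.
set b := (\int[_]_(z in _) (EFin \o w)^\+ (A z))%E.
have a0 : (0 <= a)%E by apply: integral_ge0 => z _; exact: funeneg_ge0.
have b0 : (0 <= b)%E by apply: integral_ge0 => z _; exact: funepos_ge0.
(* The scaled integrals are finite by integrability and the factor is positive, which excludes the
   infinite cases. *)
move: a0 b0; case: a => [a| |]; case: b => [b| |] //= _ _;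
  rewrite ?gt0_muley ?lte_fin ?normr_gt0 // => _ _.
by rewrite mulrBr.
Qed.

End Affine2.

(** * Null lines and integration over the reference triangle *)

Section RefTriangle.
Context {R : realType}.
Local Notation leb := (@lebesgue_measure R).
Local Notation mR := (measurableTypeR R).
Local Notation mR2 := (measurableTypeR R * measurableTypeR R)%type.

Lemma leb2_setX (A B : set mR) : measurable A -> measurable B ->
  leb2 R (A `*` B) = (leb A * leb B)%E.
Proof. by move=> mA mB; rewrite /leb2 /= product_measure1E. Qed.

Lemma measurable_line (a b c : R) :
  measurable ([set z | a * z.1 + b * z.2 + c = 0] : set mR2).
Proof.
rewrite (_ : [set _ | _] =
    (fun z : mR2 => a * z.1 + b * z.2 + c : mR) @^-1` [set 0]); last first.
  by apply/seteqP; split => z.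
by rewrite -[X in measurable X]setTI; apply: measurable_linear2.
Qed.

(** The line is the preimage of the vertical axis under an affine map of determinant
    [a ^+ 2 + b ^+ 2], and the axis is a product with a null factor. *)
Lemma leb2_line (a b c : R) : a ^+ 2 + b ^+ 2 != 0 ->
  leb2 R [set z | a * z.1 + b * z.2 + c = 0] = 0%E.
Proof.
move=> ab0; have mL := measurable_line a b c.
have D0 : a * a - b * (- b) != 0 by rewrite mulrN opprK -!expr2.
have mZ : measurable ([set 0] `*` setT : set mR2) by exact: measurableX.
have := ge0_integral_affine2_in c 0 D0 mZ
  (measurable_cst (D := [set 0] `*` setT : set mR2) (1%:E : \bar R)) (fun _ _ => lee01).
rewrite integral_cst // leb2_setX // lebesgue_measure_set1 mul0e mule0.
rewrite (_ : affine2 a b c (- b) a 0 @^-1` _ = [set z | a * z.1 + b * z.2 + c = 0]); last first.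
  by apply/seteqP; split => z //= [].
rewrite integral_cst // mul1e => /esym/eqP; rewrite mule_eq0 => /orP[|/eqP //].
by rewrite eqe normr_eq0 (negbTE D0).
Qed.

(** Open, because gradients and the functions [mu] are prescribed only in the interior of the
    elements. *)
Definition oref : set mR2 := [set z | [/\ 0 < z.1, 0 < z.2 & z.1 + z.2 < 1]].

Lemma measurable_pos_half (a b c : R) :
  measurable ([set z | 0 < a * z.1 + b * z.2 + c] : set mR2).
Proof.
rewrite (_ : [set _ | _] =
    (fun z : mR2 => a * z.1 + b * z.2 + c : mR) @^-1` `]0, +oo[%classic); last first.
  by apply/seteqP; split => z /=; rewrite in_itv /= andbT.
by rewrite -[X in measurable X]setTI; apply: measurable_linear2.
Qed.

Lemma measurable_oref : measurable oref.
Proof.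
rewrite (_ : oref = [set z : mR2 | 0 < 1 * z.1 + 0 * z.2 + 0] `&`
   [set z | 0 < 0 * z.1 + 1 * z.2 + 0] `&` [set z | 0 < (-1) * z.1 + (-1) * z.2 + 1]).
  by apply: measurableI; [apply: measurableI|]; exact: measurable_pos_half.
apply/seteqP; split => z /=.
  by move=> [h1 h2 h3]; split; [split|]; lra.
by move=> [[h1 h2] h3]; split; lra.
Qed.

Lemma oref_sub_square : oref `<=` `[0, 1]%classic `*` `[0, 1]%classic.
Proof. by move=> z [h1 h2 h3] /=; rewrite !in_itv /=; split; apply/andP; split; lra. Qed.

Lemma leb2_oref_lty : (leb2 R oref < +oo)%E.
Proof.
apply: (@le_lt_trans _ _ (leb2 R (`[0, 1]%classic `*` `[0, 1]%classic))).
  apply: le_measure; rewrite ?inE; [exact: measurable_oref|exact: measurableX|].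
  exact: oref_sub_square.
by rewrite leb2_setX //= !lebesgue_measure_itv /= lte_fin ltr01 -EFinB -EFinM ltry.
Qed.

Lemma swap_oref : affine2 0 1 0 1 0 0 @^-1` oref = oref.
Proof.
by apply/seteqP; split => z /=; rewrite /affine2 /oref /= => -[h1 h2 h3]; split; lra.
Qed.

(** Fubini with the first variable inside, then the fundamental theorem of calculus on the slice
    from [0] to [1 - y]. *)
Lemma int_oref_dx (g G : mR2 -> R) :
  (leb2 R).-integrable oref (EFin \o g) ->
  (forall y, continuous (fun x : R => g (x, y))) ->
  measurable_fun setT (fun y : mR => G (1 - y, y) - G (0, y) : mR) ->
  (forall x y : R, is_derive x 1 (fun x => G (x, y)) (g (x, y))) ->
  int2 oref g = \int[leb]_(y in `[0, 1]) (G (1 - y, y) - G (0, y)).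
Proof.
move=> ig cg mG dG; rewrite /int2 /Rintegral; congr fine.
have mO := measurable_oref.
rewrite integral_mkcond -(integral21_prod_meas1 (m1 := leb) (m2 := leb)); last first.
  exact: (@integrable_mkcond _ _ _ (leb2 R) oref (EFin \o g) mO).1 ig.
rewrite integral_itv_bndoo; last first.
  by apply/measurable_EFinP; apply: measurable_funS mG.
rewrite [in RHS]integral_mkcond; apply: eq_integral => y _.
rewrite /fubini_G /patch mem_setE in_itv /=; case: ifPn => hy; last first.
  apply: integral0_eq => x _; case: ifPn => // /set_mem [/= h1 h2 h3].
  have y1 : (y : R) < 1 by have := (h1, h2, h3); lra.
  by move: hy; rewrite h2 y1.
move/andP : hy => [y0 y1].
transitivity (\int[leb]_(x in `]0%R, (1 - y)%R[) (g (x, y))%:E)%E.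
  rewrite [RHS]integral_mkcond; apply: eq_integral => x _.
  rewrite /patch !mem_setE in_itv /=; congr (if _ then _ else _).
  apply/idP/idP => [/set_mem[/= h1 h2 h3]|/andP[h1 h2]]; first by apply/andP; split; lra.
  by apply/mem_set; split => /=; lra.
have cGy : continuous (fun x : R => G (x, y)).
  move=> x; apply: differentiable_continuous; apply/derivable1_diffP.
  exact: (@ex_derive _ _ _ _ _ _ _ (dG x y)).
rewrite -(integral_itv_bndoo (x := 0) (y := 1 - y) true false); last first.
  apply/measurable_EFinP; apply: (@measurable_funS _ _ _ _ setT) => //.
  exact: continuous_measurable_fun.
rewrite (@continuous_FTC2 _ (fun x => g (x, y)) (fun x => G (x, y))) //; first last.
- by move=> x _; rewrite derive1E; apply: derive_val.
- split.
  + by move=> x _; exact: (@ex_derive _ _ _ _ _ _ _ (dG x y)).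
  + exact: cvg_at_right_filter (cGy _).
  + exact: cvg_at_left_filter (cGy _).
- exact: continuous_subspaceT.
- lra.
Qed.

End RefTriangle.

Section Index3.

Lemma ord3P (i : 'I_3) : [\/ i = 0, i = 1 | i = 2%:R].
Proof.
by case: i => [[|[|[|//]]] p]; [apply: Or31|apply: Or32|apply: Or33]; exact/val_inj.
Qed.

Lemma ord3E : (((0 : 'I_3) + 1)%R = 1%R) * (((1 : 'I_3) + 1)%R = 2%:R) *
  (((2%:R : 'I_3) + 1)%R = 0%R) * (((0 : 'I_3) + 2%:R)%R = 2%:R) *
  (((1 : 'I_3) + 2%:R)%R = 0%R) * (((2%:R : 'I_3) + 2%:R)%R = 1%R).
Proof. by do !split; apply/val_inj. Qed.

Lemma sum_ord3 (V : nmodType) (F : 'I_3 -> V) :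
  \sum_(i < 3) F i = F 0 + F 1 + F 2%:R.
Proof.
rewrite !big_ord_recl big_ord0 addr0 addrA; congr (F _ + F _ + F _); exact/val_inj.
Qed.

Lemma ord3_cases (P : 'I_3 -> Prop) : P 0 -> P 1 -> P 2%:R -> forall i, P i.
Proof. by move=> h0 h1 h2 i; case: (ord3P i) => ->. Qed.

End Index3.

(** * Triangles and barycentric coordinates *)

Section Barycentric.
Context {R : realType} (M : mesh R).
Implicit Types (k l : 'I_(nt M)) (i j : 'I_3) (x y : R * R).

Definition cross (p q : R * R) : R := p.1 * q.2 - p.2 * q.1.

(** Barycentric coordinate as a quotient of signed areas: the triangle spanned by [x] and the edge
    opposite to local vertex [i], over the whole element. The cyclic order gives both areas the same
    orientation, so no absolute value is involved. *)
Definition lam k i x : R :=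
  cross (pt k (i + 1) - x) (pt k (i + 2%:R) - x) / jacobian k.

Lemma pairE (p q : R * R) : p.1 = q.1 -> p.2 = q.2 -> p = q.
Proof. by case: p q => [a b] [c d] /= -> ->. Qed.

Lemma sum_fst (I : Type) (s : seq I) (P : pred I) (F : I -> R * R) :
  (\sum_(i <- s | P i) F i).1 = \sum_(i <- s | P i) (F i).1.
Proof. exact: (big_morph (fun p : R * R => p.1) (fun _ _ => erefl) erefl). Qed.

Lemma sum_snd (I : Type) (s : seq I) (P : pred I) (F : I -> R * R) :
  (\sum_(i <- s | P i) F i).2 = \sum_(i <- s | P i) (F i).2.
Proof. exact: (big_morph (fun p : R * R => p.2) (fun _ _ => erefl) erefl). Qed.

Lemma jacobianE k : jacobian k = ((pt k 1).1 - (pt k 0).1) * ((pt k 2%:R).2 - (pt k 0).2)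
  - ((pt k 1).2 - (pt k 0).2) * ((pt k 2%:R).1 - (pt k 0).1).
Proof. by []. Qed.

Lemma lam_sum k x : jacobian k != 0 -> \sum_i lam k i x = 1.
Proof.
move=> J0; rewrite sum_ord3 /lam /cross !ord3E /=.
by move: J0; rewrite jacobianE => J0; field.
Qed.

Lemma lam_combination k x : jacobian k != 0 -> x = \sum_i lam k i x *: pt k i.
Proof.
move=> J0; rewrite sum_ord3; apply: pairE; rewrite /= /lam /cross !ord3E /=;
by move: J0; rewrite jacobianE => J0; rewrite /GRing.scale /=; field.
Qed.

Lemma lam_affine k i x y (s t : R) : s + t = 1 ->
  lam k i (s *: x + t *: y) = s * lam k i x + t * lam k i y.
Proof.
move=> st; have -> : t = 1 - s by lra.
elim/ord3_cases: i; rewrite /lam /cross !ord3E /= /GRing.scale /=; ring.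
Qed.

Lemma lam_unique k (w : 'I_3 -> R) : jacobian k != 0 -> \sum_i w i = 1 ->
  forall i, lam k i (\sum_j w j *: pt k j) = w i.
Proof.
move=> J0; rewrite sum_ord3 => w1; have w0 : w 0 = 1 - w 1 - w 2%:R by lra.
move: J0; rewrite jacobianE => J0; rewrite sum_ord3.
elim/ord3_cases; rewrite /lam /cross !ord3E jacobianE /= /GRing.scale /= w0; field => //.
Qed.

(** A repeated vertex would make the Jacobian vanish. *)
Lemma tri_inj k : jacobian k != 0 -> injective (tri k).
Proof.
move=> J0; have D i j : tri k i = tri k j -> pt k i = pt k j by rewrite /pt => ->.
have h i j : (i == j) || (tri k i != tri k j).
  have [//|ij] := eqVneq i j; apply/eqP => /D; move: ij J0; rewrite jacobianE.
  elim/ord3_cases: i; elim/ord3_cases: j => //= _ J0 E; case/negP: J0; rewrite ?E //;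
    apply/eqP; rewrite -?E; ring.
by move=> i j /eqP tij; apply/eqP; have := h i j; rewrite tij orbF.
Qed.

Lemma sum_vset (V : nmodType) k (A : {set 'I_(nv M)}) (F : 'I_(nv M) -> V) :
  jacobian k != 0 -> A \subset vset k -> (forall n, n \notin A -> F n = 0) ->
  \sum_n F n = \sum_i F (tri k i).
Proof.
move=> J0 sA F0.
rewrite (bigID (fun n => n \in vset k)) /= [X in _ + X]big1 ?addr0; last first.
  by move=> n nk; apply: F0; apply: contraNN nk => /(fintype.subsetP sA).
rewrite /vset big_imset /=; last by move=> i j _ _; exact: tri_inj.
by apply: eq_bigl => i; rewrite inE.
Qed.

Lemma hull_lam k (A : {set 'I_(nv M)}) x : jacobian k != 0 -> A \subset vset k ->
  hull A x -> forall i, 0 <= lam k i x /\ (tri k i \notin A -> lam k i x = 0).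
Proof.
move=> J0 sA [w [w0 wA w1 ->]] i.
rewrite (sum_vset (k := k) J0 sA); last by move=> n /wA ->; rewrite scale0r.
rewrite (lam_unique (w := fun i => w (tri k i))) //; last first.
  by rewrite -w1 (sum_vset (k := k) J0 sA).
by split => // /wA.
Qed.

Lemma eltP k x : jacobian k != 0 -> elt k x <-> forall i, 0 <= lam k i x.
Proof.
move=> J0; split=> [hx i|lx]; first by case: (hull_lam J0 (subxx _) hx i).
(* [hull] asks for weights on all vertices of the mesh, so the three local coordinates are extended
   by zero. *)
pose w n := \sum_i lam k i x * (tri k i == n)%:R.
have wtri i : w (tri k i) = lam k i x.
  rewrite /w (bigD1 i) //= eqxx mulr1 big1 ?addr0 // => j ji.
  by rewrite (inj_eq (tri_inj J0)) (negbTE ji) mulr0.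
have wA n : n \notin vset k -> w n = 0.
  move=> nk; rewrite /w big1 // => i _; case: eqP => [E|_]; last by rewrite mulr0.
  by case/negP: nk; rewrite -E; exact: imset_f.
exists w; split => //.
- by move=> n; apply: sumr_ge0 => i _; rewrite mulr_ge0.
- rewrite (sum_vset (k := k) J0 (subxx _)) // -(lam_sum x J0).
  by apply: eq_bigr => i _; rewrite wtri.
- rewrite (sum_vset (k := k) J0 (subxx _)); last by move=> n /wA ->; rewrite scale0r.
  rewrite {1}(lam_combination x J0).
  by apply: eq_bigr => i _; rewrite wtri.
Qed.

Definition otri k : set (R * R) := [set x | forall i, 0 < lam k i x].

Lemma lam_continuous k i : continuous (lam k i).
Proof.
move=> x; rewrite /lam /cross.
apply: cvgM; last exact: cvg_cst.
have c1 (a : R) : (a - y.1) @[y --> x] --> a - x.1.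
  by apply: cvgB; [exact: cvg_cst|exact: cvg_fst].
have c2 (a : R) : (a - y.2) @[y --> x] --> a - x.2.
  by apply: cvgB; [exact: cvg_cst|exact: cvg_snd].
by apply: cvgB; apply: cvgM => //=; (exact: c1 || exact: c2).
Qed.

Lemma otri_open k : open (otri k).
Proof.
rewrite (_ : otri k = lam k 0 @^-1` [set y | 0 < y] `&`
    lam k 1 @^-1` [set y | 0 < y] `&` lam k 2%:R @^-1` [set y | 0 < y]).
  by do 2?[apply: openI]; (apply: open_comp; [move=> ? _; exact: lam_continuous|exact: open_gt]).
apply/seteqP; split => x /= h; first by split; [split|]; exact: h.
by case: h => -[h0 h1 h2]; elim/ord3_cases.
Qed.

Lemma otri_sub_elt k : jacobian k != 0 -> otri k `<=` elt k.
Proof. by move=> J0 x h; apply/eltP => // i; exact/ltW. Qed.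

Lemma elt_closed_lt k i x : lam k i x < 0 -> \forall y \near x, lam k i y < 0.
Proof.
move=> h; have := @lam_continuous k i x.
by move=> /(_ [set y | y < 0]); apply; exact: lt_nbhsl.
Qed.

(* Moving away from the opposite edge along [x + s (x - P_i)] scales [1 - lam k i]. *)
Lemma interior_elt k : jacobian k != 0 -> interior (elt k) = otri k.
Proof.
move=> J0; apply/seteqP; split=> x; last first.
  move=> ox; apply: (filterS (otri_sub_elt J0)); apply: open_nbhs_nbhs.
  by split => //; exact: otri_open.
move=> nx i; rewrite lt_neqAle eq_sym.
have /(eltP x J0) -> : elt k x by exact: nbhs_singleton.
rewrite andbT; apply/eqP => l0.
have : \forall s \near (0 : R), elt k ((1 + s) *: x + (- s) *: pt k i).
  have cc : ((1 + s) *: x + (- s) *: pt k i) @[s --> (0 : R)] --> x.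
    rewrite -[X in _ --> X](_ : (1 + 0) *: x + (- 0) *: pt k i = x); last first.
      by rewrite addr0 oppr0 scale1r scale0r addr0.
    apply: cvgD; apply: cvgZl => //.
      by apply: cvgD; [exact: cvg_cst|exact: cvg_id].
    by apply: cvgN; exact: cvg_id.
  exact: cc nx.
move=> /nbhs_ballP[e /= e0 he].
have /(eltP _ J0) /(_ i) : elt k ((1 + e / 2) *: x + (- (e / 2)) *: pt k i).
  apply: he; rewrite /ball /= sub0r normrN gtr0_norm; lra.
rewrite lam_affine; last by ring.
rewrite l0 mulr0 add0r (_ : lam k i (pt k i) = 1); first by lra.
have -> : pt k i = \sum_j (i == j)%:R *: pt k j.
  rewrite (bigD1 i) //= eqxx scale1r big1 ?addr0 // => j /negbTE; rewrite eq_sym => ->.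
  by rewrite scale0r.
rewrite lam_unique ?eqxx // (bigD1 i) //= eqxx big1 ?addr0 // => j /negbTE.
by rewrite eq_sym => ->.
Qed.

End Barycentric.

Lemma measurable_fun_finite_cover d d' (T : measurableType d) (U : measurableType d')
    (I : finType) (F : I -> set T) (D : set T) (f : T -> U) :
  (forall i, measurable (F i)) -> D `<=` \bigcup_(i in [set: I]) F i ->
  (forall i, measurable_fun (D `&` F i) f) -> measurable_fun D f.
Proof.
move=> mF DF mf mD Y mY.
have -> : D `&` f @^-1` Y = \bigcup_(i in [set: I]) ((D `&` F i) `&` f @^-1` Y).
  apply/seteqP; split => [x [Dx fx]|x [i _ [[Dx Fx] fx]]]; last by [].
  by have [i _ Fx] := DF x Dx; exists i.
apply: fin_bigcup_measurable => [|i _]; first exact: finite_finset.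
by apply: mf => //; exact: measurableI.
Qed.

(** * Triangulations *)

Section MeasurableSets.
Context {R : realType}.
Local Notation mR := (measurableTypeR R).
Local Notation mR2 := (measurableTypeR R * measurableTypeR R)%type.

Lemma measurable_le0 (f : mR2 -> mR) : measurable_fun setT f ->
  measurable [set x | 0 <= f x].
Proof.
move=> mf; rewrite (_ : [set _ | _] = f @^-1` `[0, +oo[%classic); last first.
  by apply/seteqP; split => z /=; rewrite in_itv /= andbT.
by rewrite -[X in measurable X]setTI; apply: mf.
Qed.

(** Polynomial conditions, from which measurability is immediate. The last one covers the degenerate
    case [p = q], where it forces [x = p]. *)
Lemma segmentP (p q x : R * R) : segment p q x <->
  [/\ cross (q - p) (x - p) = 0, 0 <= dot (q - p) (x - p),
      0 <= dot (q - p) (q - p) - dot (q - p) (x - p) &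
      0 <= dot (q - p) (q - p) - dot (x - p) (x - p)].
Proof.
split=> [[t [/andP[t0 t1] ->]]|].
  rewrite (addrC p) addrK /cross /dot /= /GRing.scale /=.
  have h1 := sqr_ge0 (q.1 - p.1); have h2 := sqr_ge0 (q.2 - p.2).
  set a := (q.1 - p.1) in h1 *; set b := (q.2 - p.2) in h2 *.
  have h : 0 <= a * a + b * b by rewrite -!expr2 addr_ge0.
  split; [ring| | |].
  - by rewrite (_ : _ + _ = t * (a * a + b * b)); [rewrite mulr_ge0|ring].
  - by rewrite (_ : _ - _ = (1 - t) * (a * a + b * b)); [rewrite mulr_ge0 // subr_ge0|ring].
  - rewrite (_ : _ - _ = (1 - t) * (1 + t) * (a * a + b * b)); last by ring.
    by rewrite !mulr_ge0 // ?subr_ge0 // addr_ge0.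
rewrite /cross /dot /= => -[h1 h2 h3 h4].
set a := (q.1 - p.1) in h1 h2 h3 h4; set b := (q.2 - p.2) in h1 h2 h3 h4.
set c := (x.1 - p.1) in h1 h2 h3 h4; set d := (x.2 - p.2) in h1 h2 h3 h4.
have [n0|n0] := eqVneq (a * a + b * b) 0.
  have cd0 : c ^+ 2 + d ^+ 2 <= 0 by move: h4; rewrite n0 !expr2; lra.
  have c0 : c ^+ 2 = 0 by apply/eqP; rewrite eq_le sqr_ge0 andbT; have := sqr_ge0 d; lra.
  have d0 : d ^+ 2 = 0 by apply/eqP; rewrite eq_le sqr_ge0 andbT; have := sqr_ge0 c; lra.
  move/eqP: c0; rewrite sqrf_eq0 subr_eq0 => /eqP c0.
  move/eqP: d0; rewrite sqrf_eq0 subr_eq0 => /eqP d0.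
  exists 0; split; first by rewrite lexx ler01.
  by rewrite scale0r addr0; exact: pairE.
have np : 0 < a * a + b * b.
  by rewrite lt_neqAle eq_sym n0 -!expr2 addr_ge0 ?sqr_ge0.
exists ((a * c + b * d) / (a * a + b * b)); split.
  apply/andP; split; first by rewrite divr_ge0 // ltW.
  by rewrite ler_pdivrMr // mul1r; lra.
apply: pairE; rewrite /= /GRing.scale /= -/a -/b.
- have -> : (a * c + b * d) / (a * a + b * b) * a =
    c + b * (a * d - b * c) / (a * a + b * b) by field.
  by rewrite h1 mulr0 mul0r addr0 /c; ring.
- have -> : (a * c + b * d) / (a * a + b * b) * b =
    d + (a * (b * c - a * d)) / (a * a + b * b) by field.
  have -> : b * c - a * d = - (a * d - b * c) by ring.
  by rewrite h1 oppr0 mulr0 mul0r addr0 /d; ring.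
Qed.

Lemma measurable_segment (p q : R * R) : measurable (segment p q : set mR2).
Proof.
rewrite (_ : segment p q = [set x | cross (q - p) (x - p) = 0] `&`
  [set x | 0 <= dot (q - p) (x - p)] `&`
  [set x | 0 <= dot (q - p) (q - p) - dot (q - p) (x - p)] `&`
  [set x | 0 <= dot (q - p) (q - p) - dot (x - p) (x - p)]); last first.
  apply/seteqP; split => [x /segmentP[h1 h2 h3 h4]|x [[[h1 h2] h3] h4]] //.
  exact/segmentP.
have m1 : measurable_fun setT (fun x : mR2 => x.1 - p.1 : mR) by apply: measurable_funB.
have m2 : measurable_fun setT (fun x : mR2 => x.2 - p.2 : mR) by apply: measurable_funB.
have ml (a b : R) : measurable_fun setT (fun x : mR2 => a * (x.1 - p.1) + b * (x.2 - p.2) : mR).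
  by apply: measurable_funD; apply: measurable_funM.
apply: measurableI; [apply: measurableI; [apply: measurableI|]|].
- rewrite (_ : [set _ | _] = (fun x : mR2 => cross (q - p) (x - p)) @^-1` [set 0]) //.
  rewrite -[X in measurable X]setTI.
  have mc : measurable_fun setT (fun x : mR2 => cross (q - p) (x - p) : mR).
    by apply: measurable_funB; apply: measurable_funM.
  exact: mc.
- by apply: measurable_le0; exact: ml.
- by apply: measurable_le0; apply: measurable_funB => //; exact: ml.
- apply: measurable_le0; apply: measurable_funB => //.
  by apply: measurable_funD; apply: measurable_funM.
Qed.

End MeasurableSets.

Section Triangulation.
Context {R : realType} (Omega : set (R * R)) (M : mesh R).
Hypothesis hO : polygonal_domain Omega.
Hypothesis hT : triangulation Omega M.
Local Notation mR2 := (measurableTypeR R * measurableTypeR R)%type.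
Implicit Types (k l : 'I_(nt M)) (i j : 'I_3) (x y : R * R).

Lemma jac0 k : jacobian k != 0.
Proof. by case: hT. Qed.

Lemma card_vset k : #|vset k| = 3.
Proof. by rewrite card_imset ?card_ord //; exact: tri_inj (jac0 k). Qed.

Lemma vset_subset k l : vset k \subset vset l -> k = l.
Proof.
move=> s; case: hT => _ _ [_ inj] _ _; apply: inj; apply/eqP.
by rewrite eqEcard s !card_vset.
Qed.

(** This is how conformity enters: a common point is a convex combination of the common vertices,
    and barycentric coordinates are unique. *)
Lemma common_lam k l i x : k != l -> elt k x -> elt l x ->
  tri k i \notin vset l -> lam k i x = 0.
Proof.
case: hT => _ _ _ _ hc kl kx lx il.
have : (elt k `&` elt l) x by [].
rewrite (hc _ _ kl) => hx.
have [_] := hull_lam (jac0 k) (finset.subsetIl _ _) hx i; apply.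
by rewrite inE negb_and il orbT.
Qed.

(** By cardinality [k] has a vertex outside [l]; its coordinate would vanish at a common point, yet
    it is positive on [otri k]. *)
Lemma otri_elt_disjoint k l x : k != l -> otri k x -> elt l x -> False.
Proof.
move=> kl ox lx; have kx := otri_sub_elt (jac0 k) ox.
have : ~~ (vset k \subset vset l) by apply: contraNN kl => /vset_subset ->.
case/fintype.subsetPn => n /imsetP[i _ ->] il.
by have := ox i; rewrite (common_lam kl kx lx il) ltxx.
Qed.

Lemma elt_sub_closure k : elt k `<=` closure Omega.
Proof. by case: hT => _ _ _ -> _ x h; exists k. Qed.

Lemma closure_elt x : closure Omega x -> exists k, elt k x.
Proof. by case: hT => _ _ _ -> _ [k _ h]; exists k. Qed.

Lemma Omega_open : open Omega.
Proof. by case: hO => -[]. Qed.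

(** Elements lie only in [closure Omega]; the condition [Omega = interior (closure Omega)] brings
    their interiors back into [Omega]. *)
Lemma otri_sub_Omega k : otri k `<=` Omega.
Proof.
case: hO => _ _ _ -> _ x ox.
have : interior (elt k) x by rewrite interior_elt //; exact: jac0.
by apply: filterS => y; exact: elt_sub_closure.
Qed.

Lemma lam_coordE k i : exists a b c : R, a ^+ 2 + b ^+ 2 != 0 /\
  forall x, lam k i x = a * x.1 + b * x.2 + c.
Proof.
pose a := ((pt k (i + 1)).2 - (pt k (i + 2%:R)).2) / jacobian k.
pose b := ((pt k (i + 2%:R)).1 - (pt k (i + 1)).1) / jacobian k.
pose c := cross (pt k (i + 1)) (pt k (i + 2%:R)) / jacobian k.
exists a, b, c; split; last first.
  by move=> x; rewrite /lam /a /b /c /cross /=; ring.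
have J0 := jac0 k; apply/negP => /eqP ab0.
have /eqP : a ^+ 2 = 0 by apply/eqP; rewrite eq_le sqr_ge0 andbT; have := sqr_ge0 b; lra.
have /eqP : b ^+ 2 = 0 by apply/eqP; rewrite eq_le sqr_ge0 andbT; have := sqr_ge0 a; lra.
rewrite !sqrf_eq0 /a /b !mulf_eq0 !invr_eq0 (negbTE J0) !orbF !subr_eq0.
move=> /eqP e1 /eqP e2; case/negP: J0; apply/eqP; rewrite jacobianE.
by move: e1 e2; elim/ord3_cases: i {a b c ab0}; rewrite !ord3E => e1 e2; rewrite ?e1 ?e2; ring.
Qed.

Lemma measurable_otri k : measurable (otri k : set mR2).
Proof.
have h i : measurable ([set x | 0 < lam k i x] : set mR2).
  have [a [b [c [_ E]]]] := lam_coordE k i.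
  rewrite (_ : [set _ | _] = [set z : mR2 | 0 < a * z.1 + b * z.2 + c]).
    exact: measurable_pos_half.
  by apply/seteqP; split => x /=; rewrite E.
rewrite (_ : otri k = [set x | 0 < lam k 0 x] `&` [set x | 0 < lam k 1 x]
    `&` [set x | 0 < lam k 2%:R x]).
  by apply: measurableI => //; exact: measurableI.
apply/seteqP; split => x /= hx; first by split; [split|]; exact: hx.
by case: hx => -[h0 h1 h2]; elim/ord3_cases.
Qed.

Lemma measurable_elt k : measurable (elt k : set mR2).
Proof.
have h i : measurable ([set x | 0 <= lam k i x] : set mR2).
  have [a [b [c [_ E]]]] := lam_coordE k i.
  rewrite (_ : [set _ | _] = [set z : mR2 | 0 <= a * z.1 + b * z.2 + c]).
    by apply: measurable_le0; exact: measurable_linear2.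
  by apply/seteqP; split => x /=; rewrite E.
rewrite (_ : elt k = [set x | 0 <= lam k 0 x] `&` [set x | 0 <= lam k 1 x]
    `&` [set x | 0 <= lam k 2%:R x]).
  by apply: measurableI => //; exact: measurableI.
have J0 := jac0 k.
apply/seteqP; split => x /=; first by move=> /(eltP x J0) hx; split; [split|]; exact: hx.
by move=> -[[h0 h1 h2]]; apply/(eltP x J0); elim/ord3_cases.
Qed.

(** [Omega] is its closure, a finite union of elements, minus its frontier, a finite union of
    segments; all these sets are measurable for the product structure. *)
Lemma measurable_Omega : measurable (Omega : set mR2).
Proof.
have -> : Omega = closure Omega `\` frontier Omega.
  rewrite /frontier ((interior_id Omega).1 Omega_open) setDD.
  by rewrite setIC; apply/esym/setIidPl; exact: subset_closure.
apply: measurableD.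
  case: hT => _ _ _ -> _; apply: fin_bigcup_measurable => [|k _].
    exact: finite_finset.
  exact: measurable_elt.
case: hO => _ _ _ _ [segs ->].
rewrite (_ : [set _ | _] = \big[setU/set0]_(s <- segs) segment s.1 s.2).
  by apply: bigsetU_measurable => s _; exact: measurable_segment.
apply/seteqP; split => x.
  case=> s [ss hx]; elim: segs ss => [//|s' segs IH]; rewrite in_cons big_cons.
  by case/orP => [/eqP <-|/IH]; [left|right].
elim: segs => [|s' segs IH]; first by rewrite big_nil.
rewrite big_cons => -[hx|/IH[s [ss hx]]].
  by exists s'; rewrite in_cons eqxx.
by exists s; rewrite in_cons ss orbT.
Qed.

Lemma closure_bounded : exists2 K : R, 0 < K &
  forall x, closure Omega x -> `|x.1| <= K /\ `|x.2| <= K.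
Proof.
case: hO => _ _ [K [_ hK]] _ _; exists (`|K| + 1); first by rewrite ltr_wpDl.
have K1 : K < `|K| + 1 by rewrite (le_lt_trans (ler_norm _)) // ltrDl.
pose B : set (R * R) := [set x | `|x| <= `|K| + 1].
have cB : closed B.
  rewrite (_ : B = (fun x => `|x|) @^-1` [set y | y <= `|K| + 1]) //.
  by apply: closed_comp; [move=> x _; exact: norm_continuous|exact: closed_le].
have sub : closure Omega `<=` B.
  rewrite [X in _ `<=` X]((closure_id B).1 cB); apply: closure_subset => x Ox.
  exact: (hK _ K1).
move=> x /sub; rewrite /B /= prod_normE /= ge_max => /andP[].
by [].
Qed.

Lemma Omega_finite : (leb2 R Omega < +oo)%E.
Proof.
have [K K0 hK] := closure_bounded.
apply: (@le_lt_trans _ _ (leb2 R (`[- K, K]%classic `*` `[- K, K]%classic))).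
  apply: le_measure; rewrite ?inE; [exact: measurable_Omega|exact: measurableX|].
  move=> x /subset_closure/hK; rewrite !ler_norml => -[h1 h2].
  by split; rewrite /= in_itv.
by rewrite leb2_setX //= !lebesgue_measure_itv /=; case: ifP => _; rewrite -?EFinB -?EFinM ?mule0 ltry.
Qed.

(** A point of [Omega] in no open triangle lies on one of the finitely many lines where some
    [lam k i] vanishes. *)
Lemma Omega_decomposition : exists N : set mR2, [/\ measurable N, leb2 R N = 0%E &
  Omega `\` N = \big[setU/set0]_(k <- index_enum 'I_(nt M)) otri k].
Proof.
set U := \big[setU/set0]_(k <- _) _.
have UP x : U x <-> exists k, otri k x.
  rewrite /U -bigcup_seq; split=> [[k _ h]|[k h]]; first by exists k.
  by exists k => //=; rewrite mem_index_enum.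
have mU : measurable (U : set mR2).
  by apply: bigsetU_measurable => k _; exact: measurable_otri.
exists (Omega `\` U); split.
- by apply: measurableD => //; exact: measurable_Omega.
- pose F (p : 'I_(nt M) * 'I_3) := [set x : mR2 | lam p.1 p.2 x = 0].
  pose L := \big[setU/set0]_(p <- index_enum ('I_(nt M) * 'I_3)%type) F p.
  have mF p : measurable (F p) /\ leb2 R (F p) = 0%E.
    have [a [b [c [ab E]]]] := lam_coordE p.1 p.2.
    rewrite (_ : F p = [set z | a * z.1 + b * z.2 + c = 0]).
      by split; [exact: measurable_line|exact: leb2_line].
    by apply/seteqP; split => z /=; rewrite /F /= E.
  have [mL L0] : measurable L /\ leb2 R L = 0%E.
    rewrite /L; elim: (index_enum _) => [|p s [mL L0]].
      by rewrite big_nil measure0.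
    have [mp p0] := mF p; rewrite big_cons; split; first exact: measurableU.
    by rewrite measureU0.
  apply: (@subset_measure0 _ _ _ (leb2 R) _ L) => //.
  + by apply: measurableD => //; exact: measurable_Omega.
  + move=> x [Ox nU]; have [k /(eltP x (jac0 k)) hx] := closure_elt (subset_closure Ox).
    have : ~ otri k x by move=> h; apply: nU; apply/UP; exists k.
    move=> /existsNP[i /negP]; rewrite -leNgt => li.
    rewrite /L -bigcup_seq; exists (k, i); first by rewrite /= mem_index_enum.
    by rewrite /F /=; apply/eqP; rewrite eq_le li hx.
- rewrite setDD setIC; apply/setIidPl => x /UP[k]; exact: otri_sub_Omega.
Qed.

End Triangulation.

(** * Pull-back of integrals to the reference triangle *)

Section Pullback.
Context {R : realType} (Omega : set (R * R)) (M : mesh R).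
Hypothesis hO : polygonal_domain Omega.
Hypothesis hT : triangulation Omega M.
Implicit Types (k l : 'I_(nt M)) (i j : 'I_3) (x y : R * R).

(** Barycentric coordinates of the reference triangle with vertices [(0, 0)], [(1, 0)], [(0, 1)]. *)
Definition shp (i : 'I_3) (z : R * R) : R :=
  if i == 0 then 1 - z.1 - z.2 else if i == 1 then z.1 else z.2.

Lemma shp_sum z : \sum_i shp i z = 1.
Proof. by rewrite sum_ord3 /shp /=; ring. Qed.

Lemma refmapE k z : refmap k z = \sum_i shp i z *: pt k i.
Proof.
rewrite sum_ord3 /shp /= /refmap; apply: pairE; rewrite /= /GRing.scale /=; ring.
Qed.

Lemma lam_refmap k i z : lam k i (refmap k z) = shp i z.
Proof. by rewrite refmapE lam_unique ?(jac0 hT) ?shp_sum. Qed.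

Lemma refmap_affine2 k : refmap k = affine2
  ((pt k 1).1 - (pt k 0).1) ((pt k 2%:R).1 - (pt k 0).1) (pt k 0).1
  ((pt k 1).2 - (pt k 0).2) ((pt k 2%:R).2 - (pt k 0).2) (pt k 0).2.
Proof.
by apply/funext => z; rewrite /refmap /affine2; apply: pairE; rewrite /= /GRing.scale /=; ring.
Qed.

Lemma orefP z : oref z <-> forall i, 0 < shp i z.
Proof.
rewrite /oref /shp /=; split=> [[h1 h2 h3]|h].
  by elim/ord3_cases => /=; lra.
by have := (h 0, h 1, h 2%:R) => /= -[[h0 h1] h2]; split; lra.
Qed.

Lemma preimage_refmap k : refmap k @^-1` otri k = oref.
Proof.
apply/seteqP; split => z /=; rewrite orefP /otri /= => h i; have := h i;
  by rewrite lam_refmap.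
Qed.

Lemma refmap_det k : ((pt k 1).1 - (pt k 0).1) * ((pt k 2%:R).2 - (pt k 0).2) -
  ((pt k 2%:R).1 - (pt k 0).1) * ((pt k 1).2 - (pt k 0).2) = jacobian k.
Proof. by rewrite jacobianE; ring. Qed.

Lemma int2_otri k w : (leb2 R).-integrable (otri k) (EFin \o w) ->
  int2 (otri k) w = `|jacobian k| * int2 oref (w \o refmap k).
Proof.
move=> hw; rewrite -(preimage_refmap k) refmap_affine2 -refmap_det.
by apply: Rintegral_affine2 => //; [rewrite refmap_det (jac0 hT)|exact: (measurable_otri hT k)].
Qed.

Lemma integrable_otri k w : (leb2 R).-integrable Omega (EFin \o w) ->
  (leb2 R).-integrable (otri k) (EFin \o w).
Proof.
apply: integrableS; [exact: (measurable_Omega hO hT)|exact: (measurable_otri hT k)|].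
exact: (otri_sub_Omega hO hT).
Qed.

Lemma trivIset_otri : trivIset [set` index_enum 'I_(nt M)] (@otri R M).
Proof.
move=> k l _ _ [x [kx lx]]; apply/eqP; apply/negPn/negP => kl.
exact: (otri_elt_disjoint hT kl kx (otri_sub_elt (jac0 hT l) lx)).
Qed.

Lemma int2_Omega w : (leb2 R).-integrable Omega (EFin \o w) ->
  int2 Omega w = \sum_(k < nt M) `|jacobian k| * int2 oref (w \o refmap k).
Proof.
move=> iw; have [N [mN N0 EN]] := Omega_decomposition hO hT.
have mO := measurable_Omega hO hT.
transitivity (\sum_(k < nt M) int2 (otri k) w); last first.
  by apply: eq_bigr => k _; apply: int2_otri; exact: integrable_otri.
rewrite /int2 /Rintegral (negligible_integral mN mO iw N0) EN.
rewrite integral_bigsetU_EFin; last 4 first.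
- by move=> k; exact: (measurable_otri hT k).
- exact: index_enum_uniq.
- exact: trivIset_otri.
- rewrite -EN; apply: (measurable_funS mO) (measurable_int _ iw).
  by move=> x [].
rewrite -sum_fine // => k _.
exact: (integrable_fin_num (measurable_otri hT k) (integrable_otri k iw)).
Qed.

End Pullback.

Lemma is_derive_affine (R : realType) (a c t : R) :
  is_derive t 1 (fun s : R => a * s + c) a.
Proof. by apply: is_derive_eq; rewrite /GRing.scale /=; ring. Qed.

(** * Piecewise linear functions *)

Section FiniteElements.
Context {R : realType} (Omega : set (R * R)) (M : mesh R).
Hypothesis hO : polygonal_domain Omega.
Hypothesis hT : triangulation Omega M.
Local Notation mR := (measurableTypeR R).
Local Notation mR2 := (measurableTypeR R * measurableTypeR R)%type.
Implicit Types (k l : 'I_(nt M)) (i j : 'I_3) (x y : R * R) (u v w : R * R -> R).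

Lemma lam_pt k i j : lam k i (pt k j) = (i == j)%:R.
Proof.
have -> : pt k j = \sum_j' (j' == j)%:R *: pt k j'.
  rewrite (bigD1 j) //= eqxx scale1r big1 ?addr0 // => j' /negbTE ->.
  by rewrite scale0r.
rewrite (lam_unique (w := fun i => (i == j)%:R)) ?(jac0 hT) //.
by rewrite (bigD1 j) //= eqxx big1 ?addr0 // => j' /negbTE ->.
Qed.

Lemma elt_pt k j : elt k (pt k j).
Proof. by apply/(eltP _ (jac0 hT k)) => i; rewrite lam_pt. Qed.

Lemma Vh_elt v k x : Vh Omega M v -> elt k x ->
  v x = \sum_i lam k i x * v (pt k i).
Proof.
move=> [_ /(_ k)[a [b vE]]] kx; rewrite vE //.
under eq_bigr do rewrite (vE _ (elt_pt _ _)).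
have xE := lam_combination x (jac0 hT k); have l1 := lam_sum x (jac0 hT k).
rewrite [in LHS]xE; move: l1; rewrite !sum_ord3 /dot /= /GRing.scale /= => l1.
have -> : lam k 0 x = 1 - lam k 1 x - lam k 2%:R x by rewrite -l1; ring.
ring.
Qed.

Lemma VhD v w : Vh Omega M v -> Vh Omega M w -> Vh Omega M (fun x => v x + w x).
Proof.
move=> [cv av] [cw aw]; split.
  by move=> x; apply: cvgD; [exact: cv|exact: cw].
move=> k; have [a [b vE]] := av k; have [a' [b' wE]] := aw k.
exists (a + a'), (b + b') => x kx; rewrite vE // wE // /dot /=; ring.
Qed.

Lemma VhZ c v : Vh Omega M v -> Vh Omega M (fun x => c * v x).
Proof.
move=> [cv av]; split.
  by move=> x; apply: cvgM; [exact: cvg_cst|exact: cv].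
move=> k; have [a [b vE]] := av k.
exists (c *: a), (c * b) => x kx; rewrite vE // /dot /= /GRing.scale /=; ring.
Qed.

Lemma Vh0 : Vh Omega M (fun=> 0).
Proof.
split; first by move=> x; exact: cvg_cst.
by move=> k; exists 0, 0 => x _; rewrite /dot /= !mul0r !addr0.
Qed.

Lemma Vh_sum (I : Type) (s : seq I) (F : I -> R * R -> R) :
  (forall n, Vh Omega M (F n)) -> Vh Omega M (fun x => \sum_(n <- s) F n x).
Proof.
move=> hF; elim: s => [|n s IH].
  by rewrite (_ : (fun x => _) = fun=> 0); [exact: Vh0|apply/funext => x; rewrite big_nil].
rewrite (_ : (fun x => _) = fun x => F n x + \sum_(n <- s) F n x).
  exact: VhD.
by apply/funext => x; rewrite big_cons.
Qed.

Section Basis.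
Variable rho : 'I_(nv M) -> R * R -> R.
Hypothesis hrho : nodal_basis Omega rho.

Lemma rho_elt n k x : elt k x -> rho n x = \sum_i lam k i x * (n == tri k i)%:R.
Proof.
move=> kx; have [hV hn] := hrho n; rewrite (Vh_elt hV kx).
by apply: eq_bigr => i _; rewrite /pt hn.
Qed.

Lemma Vh_expand v : Vh Omega M v ->
  forall x, closure Omega x -> v x = \sum_n v (vtx n) * rho n x.
Proof.
move=> hv x /(closure_elt hT)[k kx]; rewrite (Vh_elt hv kx).
under [RHS]eq_bigr do rewrite (rho_elt _ kx) mulr_sumr.
rewrite exchange_big /=; apply: eq_bigr => i _.
rewrite (bigD1 (tri k i)) //= eqxx mulr1 big1 ?addr0 1?mulrC // => n /negbTE ->.
by rewrite !mulr0.
Qed.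

End Basis.

Lemma grad_otri v k (a : R * R) (b : R) x :
  (forall y, elt k y -> v y = dot a y + b) -> otri k x -> grad M v x = a.
Proof.
move=> vE ox; rewrite /grad asboolT; last by exists k; rewrite interior_elt ?(jac0 hT).
have nx : nbhs x (otri k) by apply: open_nbhs_nbhs; split => //; exact: otri_open.
apply: pairE => /=.
- rewrite derive1E -(@near_eq_derive _ _ _ (fun t : R => a.1 * t + (a.2 * x.2 + b))).
    by rewrite (@derive_val _ _ _ _ _ _ _ (is_derive_affine _ _ _)).
  have c1 : (t, x.2) @[t --> x.1] --> (x.1, x.2).
    by apply: (cvg_pair cvg_id (cvg_cst _)).
  have n1 : \forall t \near x.1, otri k (t, x.2).
    by apply: c1; rewrite -surjective_pairing.
  apply: filterS n1 => t ot.
  have ky : elt k (t, x.2) := otri_sub_elt (jac0 hT k) ot.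
  by rewrite (vE _ ky) /dot /= addrA.
- rewrite derive1E -(@near_eq_derive _ _ _ (fun t : R => a.2 * t + (a.1 * x.1 + b))).
    by rewrite (@derive_val _ _ _ _ _ _ _ (is_derive_affine _ _ _)).
  have c1 : (x.1, t) @[t --> x.2] --> (x.1, x.2).
    by apply: (cvg_pair (cvg_cst _) cvg_id).
  have n1 : \forall t \near x.2, otri k (x.1, t).
    by apply: c1; rewrite -surjective_pairing.
  apply: filterS n1 => t ot.
  have ky : elt k (x.1, t) := otri_sub_elt (jac0 hT k) ot.
  by rewrite (vE _ ky) /dot /= addrA (addrC (a.2 * t)).
Qed.

Lemma grad_off v x : (forall k, ~ otri k x) -> grad M v x = 0.
Proof.
move=> h; rewrite /grad asboolF // => -[k].
by rewrite interior_elt ?(jac0 hT) //; exact: h.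
Qed.

Lemma otri_dec x : (exists k, otri k x) \/ (forall k, ~ otri k x).
Proof.
by have [h|h] := pselect (exists k, otri k x); [left|right => k hk; apply: h; exists k].
Qed.

Lemma grad_lin v w c x : Vh Omega M v -> Vh Omega M w ->
  grad M (fun y => v y + c * w y) x = grad M v x + c *: grad M w x.
Proof.
move=> [_ hv] [_ hw]; have [[k ox]|off] := otri_dec x; last first.
  by rewrite !grad_off // scaler0 addr0.
have [a [b vE]] := hv k; have [a' [b' wE]] := hw k.
rewrite (grad_otri vE ox) (grad_otri wE ox).
apply: (@grad_otri _ k _ (b + c * b')) => // y ky.
by rewrite vE // wE // /dot /= /GRing.scale /=; ring.
Qed.

Lemma grad_ext v w : Vh Omega M v -> Vh Omega M w ->
  (forall x, closure Omega x -> v x = w x) -> grad M v = grad M w.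
Proof.
move=> [_ hv] [_ hw] vw; apply/funext => x; have [[k ox]|off] := otri_dec x; last first.
  by rewrite !grad_off.
have [a [b vE]] := hv k; rewrite (grad_otri vE ox).
apply/esym/(@grad_otri _ k _ b) => // y ky.
by rewrite -vw ?vE //; exact: (elt_sub_closure hT ky).
Qed.

Lemma grad0 x : grad M (fun=> 0) x = 0.
Proof.
have [[k ox]|off] := otri_dec x; last by rewrite grad_off.
by apply: (@grad_otri _ k 0 0) => // y _; rewrite /dot /= !mul0r !addr0.
Qed.

Lemma sqint_Vh v : Vh Omega M v -> sqint (leb2 R) Omega v.
Proof.
move=> hv; have mO := measurable_Omega hO hT.
(* On an element the values are convex combinations of three nodal values, so the sum of the moduli
   of all local nodal values is a bound. *)
apply: (@bounded_sqint _ _ _ _ _ mO _ (\sum_k \sum_i `|v (@pt R M k i)|)).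
- exact: (Omega_finite hO hT).
- apply: (measurable_fun_finite_cover (measurable_elt hT)).
    by move=> x /subset_closure/(closure_elt hT)[k kx]; exists k.
  move=> k; have [a [b vE]] := hv.2 k.
  apply: (eq_measurable_fun (fun x : mR2 => a.1 * x.1 + a.2 * x.2 + b : mR)).
    by move=> x /set_mem[_ kx]; rewrite vE.
  apply: (@measurable_funS _ _ _ _ setT) => //; exact: measurable_linear2.
- move=> x /subset_closure/(closure_elt hT)[k kx]; rewrite (Vh_elt hv kx).
  apply: (le_trans (ler_norm_sum _ _ _)).
  rewrite (bigD1 k) //= -[leLHS]addr0 lerD //; last first.
    by apply: sumr_ge0 => l _; apply: sumr_ge0 => i _.
  apply: ler_sum => i _; rewrite normrM -[leRHS]mul1r ler_wpM2r //.
  have h := (eltP x (jac0 hT k)).1 kx; rewrite ger0_norm //.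
  rewrite -(lam_sum x (jac0 hT k)) (bigD1 i) //= lerDl.
  exact: sumr_ge0.
Qed.

Lemma grad_const v : Vh Omega M v -> exists a : 'I_(nt M) -> R * R,
  forall k, (forall x, otri k x -> grad M v x = a k) /\
    exists b, forall x, elt k x -> v x = dot (a k) x + b.
Proof.
move=> [_ hv]; have /choice[a ha] : forall k, exists ak : R * R,
    (forall x, otri k x -> grad M v x = ak) /\
    exists b, forall x, elt k x -> v x = dot ak x + b.
  move=> k; have [a [b vE]] := hv k; exists a; split; last by exists b.
  by move=> x ox; exact: grad_otri vE ox.
by exists a.
Qed.

(** [p] stands for either coordinate projection. [grad] is zero off the open triangles, so [p 0 = 0]
    makes the composite a step function on the open triangles and zero elsewhere. *)
Lemma sqint_grad v (p : R * R -> R) : p 0 = 0 ->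
  Vh Omega M v -> sqint (leb2 R) Omega (fun x => p (grad M v x)).
Proof.
move=> p0 hv; have mO := measurable_Omega hO hT; have [a ha] := grad_const hv.
apply: (@bounded_sqint _ _ _ _ _ mO _ (\sum_k `|p (a k)|)).
- exact: (Omega_finite hO hT).
- pose F (o : option 'I_(nt M)) : set mR2 :=
    if o is Some k then otri k else ~` (\big[setU/set0]_(k < nt M) otri k).
  have mF o : measurable (F o).
    case: o => [k|]; first exact: (measurable_otri hT k).
    by apply: measurableC; apply: bigsetU_measurable => k _; exact: (measurable_otri hT k).
  apply: (measurable_fun_finite_cover mF).
    move=> x Ox; have [[k ox]|off] := otri_dec x; first by exists (Some k).
    exists None => //=; rewrite -bigcup_seq => -[k _]; exact: off.
  case=> [k|] /=.
    apply: (eq_measurable_fun (cst (p (a k)))) => //.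
    by move=> x /set_mem[_ ox]; rewrite (ha k).1.
  apply: (eq_measurable_fun (cst 0 : mR2 -> R)) => [|]; last exact: measurable_cst.
  move=> x /set_mem[_ off]; rewrite grad_off ?p0 // => k ox; apply: off.
  by rewrite -bigcup_seq; exists k => //=; rewrite mem_index_enum.
- move=> x Ox; have [[k ox]|off] := otri_dec x.
    rewrite (ha k).1 // (bigD1 k) //= lerDl; exact: sumr_ge0.
  by rewrite grad_off // p0 normr0; exact: sumr_ge0.
Qed.

End FiniteElements.

(** * Cubic integrals along edges *)

Section Cubic.
Context {R : realType}.
Local Notation leb := (@lebesgue_measure R).
Local Notation mR := (measurableTypeR R).
Local Notation mR2 := (measurableTypeR R * measurableTypeR R)%type.

Lemma is_derive_cubic (p q u a t : R) :
  is_derive t 1 (fun s : R => (p + s * q) * (u + s * a) ^+ 2)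
    (q * (u + t * a) ^+ 2 + 2 * (p + t * q) * (u + t * a) * a).
Proof. by apply: is_derive_eq; rewrite /GRing.scale /=; ring. Qed.

Lemma is_derive_continuous (f df : R -> R) :
  (forall t : R, is_derive t 1 f (df t)) -> continuous f.
Proof.
move=> h x; apply: differentiable_continuous; apply/derivable1_diffP.
exact: (@ex_derive _ _ _ _ _ _ _ (h x)).
Qed.

Lemma cubic_continuous (p q u a : R) :
  continuous (fun s : R => (p + s * q) * (u + s * a) ^+ 2).
Proof. exact: is_derive_continuous (is_derive_cubic p q u a). Qed.

Lemma continuous_integrable01 (f : R -> R) : continuous f ->
  leb.-integrable `[0, 1] (EFin \o f).
Proof.
move=> cf; apply: continuous_compact_integrable; first exact: segment_compact.
exact: continuous_subspaceT.
Qed.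

(* Integral over an edge of the abscissa times the square of a function affine along it,
   in terms of the values [x0, x1] of the abscissa and [u0, u1] of the function at the ends. *)
Definition cubI (x0 x1 u0 u1 : R) : R :=
  \int[leb]_(t in `[0, 1]) ((x0 + t * (x1 - x0)) * (u0 + t * (u1 - u0)) ^+ 2).

Lemma cubI_sym x0 x1 u0 u1 : cubI x0 x1 u0 u1 = cubI x1 x0 u1 u0.
Proof.
rewrite /cubI.
rewrite Rintegration_by_substitution_onem ?lexx ?ler01 //; last first.
  by apply: continuous_subspaceT; exact: cubic_continuous.
rewrite unstable.onem1; apply: eq_Rintegral => t _; rewrite /unstable.onem; ring.
Qed.

(** The field component [x v ^ 2] in reference coordinates, both the abscissa and [v] being affine
    there. *)
Definition pcub (X0 p q u a b : R) (z : mR2) : R :=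
  (X0 + z.1 * p + z.2 * q) * (u + z.1 * a + z.2 * b) ^+ 2.

(** Derivative of [pcub] along a direction in which the abscissa has slope [pd] and the function
    slope [ad]: [(p, a)] gives the first partial derivative and [(q, b)] the second. *)
Definition pcub_d (X0 p q u a b pd ad : R) (z : mR2) : R :=
  pd * (u + z.1 * a + z.2 * b) ^+ 2
  + 2 * (X0 + z.1 * p + z.2 * q) * (u + z.1 * a + z.2 * b) * ad.

Lemma measurable_lin (p q e : R) :
  measurable_fun setT ((fun z => e + z.1 * p + z.2 * q) : mR2 -> mR).
Proof.
rewrite (_ : (fun _ => _) = fun z : mR2 => p * z.1 + q * z.2 + e).
  exact: measurable_linear2.
by apply/funext => z; ring.
Qed.

Lemma bound_lin (p q e : R) (z : R * R) : oref z ->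
  `|e + z.1 * p + z.2 * q| <= `|e| + `|p| + `|q|.
Proof.
case=> h1 h2 h3; apply: (le_trans (ler_normD _ _)); apply: lerD.
  apply: (le_trans (ler_normD _ _)); rewrite lerD2l normrM ler_piMl // ger0_norm; lra.
by rewrite normrM ler_piMl // ger0_norm; lra.
Qed.

Lemma integrable_pcub_d X0 p q u a b pd ad :
  (leb2 R).-integrable oref (EFin \o pcub_d X0 p q u a b pd ad).
Proof.
apply: measurable_bounded_integrable.
- exact: measurable_oref.
- exact: leb2_oref_lty.
- apply: (@measurable_funS _ _ _ _ setT) => //.
  apply: measurable_funD.
    by apply: measurable_funM => //; apply: measurable_funX; exact: measurable_lin.
  apply: measurable_funM => //; apply: measurable_funM; last exact: measurable_lin.
  by apply: measurable_funM => //; exact: measurable_lin.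
set L := `|u| + `|a| + `|b|; set K := `|X0| + `|p| + `|q|.
exists (`|pd| * L ^+ 2 + 2 * K * L * `|ad|); split; first exact: num_real.
move=> B hB z oz; apply: le_trans (ltW hB).
have hV := bound_lin a b u oz; have hX := bound_lin p q X0 oz.
apply: (le_trans (ler_normD _ _)); rewrite (normrM pd) normrX !normrM (ger0_norm (ler0n _ 2)).
by apply: lerD; rewrite ?ler_wpM2l ?ler_wpM2r ?lerXn2r ?nnegrE ?ler_pM // ?mulr_ge0 ?addr_ge0.
Qed.

Lemma int_pcub_dx X0 p q u a b : int2 oref (pcub_d X0 p q u a b p a) =
  cubI (X0 + p) (X0 + q) (u + a) (u + b) - cubI X0 (X0 + q) u (u + b).
Proof.
have dG x y : is_derive (x : R) 1 (fun x => pcub X0 p q u a b (x, y))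
    (pcub_d X0 p q u a b p a (x, y)).
  rewrite /pcub /pcub_d /=.
  by apply: is_derive_eq; rewrite /GRing.scale /=; ring.
rewrite (int_oref_dx _ _ _ dG); last 3 first.
- exact: integrable_pcub_d.
- move=> y; apply: (@is_derive_continuous _ (fun x : R =>
    2 * p * (u + y * b + x * a) * a + 2 * p * (u + y * b + x * a) * a +
    2 * (X0 + y * q + x * p) * a * a)) => t.
  rewrite /pcub_d /=.
  by apply: is_derive_eq; rewrite /GRing.scale /=; ring.
- apply: measurable_funB; apply: continuous_measurable_fun.
  + rewrite (_ : (fun _ => _) = fun y : R => ((X0 + p) + y * (q - p)) * ((u + a) + y * (b - a)) ^+ 2).
      exact: cubic_continuous.
    by apply/funext => y; rewrite /pcub /=; ring.
  + rewrite (_ : (fun _ => _) = fun y : R => (X0 + y * q) * (u + y * b) ^+ 2).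
      exact: cubic_continuous.
    by apply/funext => y; rewrite /pcub /=; ring.
rewrite /cubI -RintegralB //; try by apply: continuous_integrable01; exact: cubic_continuous.
by apply: eq_Rintegral => t _; rewrite /pcub /=; ring.
Qed.

(** Reduced to the other partial derivative by exchanging the two coordinates, a symmetry of the
    reference triangle. *)
Lemma int_pcub_dy X0 p q u a b : int2 oref (pcub_d X0 p q u a b q b) =
  cubI (X0 + p) (X0 + q) (u + a) (u + b) - cubI X0 (X0 + p) u (u + a).
Proof.
rewrite cubI_sym -int_pcub_dx.
rewrite (@Rintegral_affine2 R 0 1 0 1 0 0 oref); last 3 first.
- by rewrite mul0r sub0r mulr1 oppr_eq0 oner_eq0.
- exact: measurable_oref.
- exact: integrable_pcub_d.
rewrite swap_oref mul0r sub0r mulr1 normrN1 mul1r; apply: eq_Rintegral => z _.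
by rewrite /pcub_d /affine2 /=; ring.
Qed.

End Cubic.

Section ElementIdentity.
Context {R : realType} (Omega : set (R * R)) (M : mesh R).
Hypothesis hO : polygonal_domain Omega.
Hypothesis hT : triangulation Omega M.
Local Notation mR2 := (measurableTypeR R * measurableTypeR R)%type.
Implicit Types (k l : 'I_(nt M)) (i j : 'I_3) (x y : R * R) (u v w : R * R -> R).

Definition edge_cub v (a b : 'I_(nv M)) : R :=
  cubI (vtx a).1 (vtx b).1 (v (vtx a)) (v (vtx b)).

Lemma edge_cub_sym v a b : edge_cub v a b = edge_cub v b a.
Proof. exact: cubI_sym. Qed.

(* The divergence theorem on a triangle for the field [(x v ^ 2, 0)]. *)
Lemma element_identity v k : Vh Omega M v ->
  `|jacobian k| * int2 oref ((fun x => v x ^+ 2 + 2 * (v x * (x.1 * (grad M v x).1))) \o refmap k) =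
  Num.sg (jacobian k) * \sum_i ((pt k (i + 1)).2 - (pt k i).2) *
    edge_cub v (tri k i) (tri k (i + 1)).
Proof.
move=> hv; have J0 := jac0 hT k.
have [a [b vE]] := hv.2 k.
pose u i := v (pt k i).
have uE i : u i = dot a (pt k i) + b by rewrite /u vE //; exact: elt_pt hT k i.
set p1 := (pt k 1).1 - (pt k 0).1; set q1 := (pt k 2%:R).1 - (pt k 0).1.
set p2 := (pt k 1).2 - (pt k 0).2; set q2 := (pt k 2%:R).2 - (pt k 0).2.
pose D pd ad := pcub_d (pt k 0).1 p1 q1 (u 0) (u 1 - u 0) (u 2%:R - u 0) pd ad.
have iD pd ad : (leb2 R).-integrable oref (EFin \o D pd ad) := integrable_pcub_d _ _ _ _ _ _ _ _.
rewrite normrEsg -mulrA; congr (_ * _).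
have mO : measurable (oref : set mR2) := measurable_oref.
(* The integrand is the derivative of [x v ^ 2] in [x]. By the chain rule the Jacobian times this
   derivative is [q2] times the first minus [p2] times the second reference derivative. *)
have fE z : oref z -> jacobian k *
    (v (refmap k z) ^+ 2 + 2 * (v (refmap k z) * ((refmap k z).1 * (grad M v (refmap k z)).1))) =
    q2 * D p1 (u 1 - u 0) z + (- p2) * D q1 (u 2%:R - u 0) z.
  move=> oz; have ox : otri k (refmap k z) by rewrite -(preimage_refmap hT k) in oz.
  rewrite (grad_otri hT vE ox) (vE _ (otri_sub_elt J0 ox)) /D /pcub_d !uE /refmap /dot /=
    /GRing.scale /= jacobianE /p1 /p2 /q1 /q2; ring.
have iw : (leb2 R).-integrable oref (EFin \o (fun z => q2 * D p1 (u 1 - u 0) z + (- p2) * D q1 (u 2%:R - u 0) z)).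
  exact: integrableD (integrableZl mO q2 (iD _ _)) (integrableZl mO (- p2) (iD _ _)).
have if_ : (leb2 R).-integrable oref (EFin \o (fun z => v (refmap k z) ^+ 2 +
    2 * (v (refmap k z) * ((refmap k z).1 * (grad M v (refmap k z)).1)))).
  apply: (eq_integrable mO) (integrableZl mO (jacobian k)^-1 iw) => z /set_mem oz.
  by rewrite /= -EFinM -fE // mulKf.
rewrite /int2 -RintegralZl //.
rewrite (@eq_Rintegral _ _ _ _ _ (fun z => q2 * D p1 (u 1 - u 0) z + (- p2) * D q1 (u 2%:R - u 0) z)); last first.
  by move=> z /set_mem oz; rewrite -fE.
have iZ c pd ad : (leb2 R).-integrable oref (EFin \o (fun z => c * D pd ad z)) :=
  integrableZl mO c (iD pd ad).
rewrite RintegralD //.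
rewrite !RintegralZl // -!/(int2 _ _) int_pcub_dx int_pcub_dy.
rewrite sum_ord3 !ord3E /edge_cub -!/(pt _ _) -!/(u _) /p1 /p2 /q1 /q2 !(addrC _ (_ - _)) !subrK.
(* The slice formulas run through the edge between local vertices 0 and 2 from 0 to 2, against the
   cyclic order. *)
rewrite (cubI_sym (pt k 2%:R).1); ring.
Qed.

End ElementIdentity.

(** * Cancellation over interior edges *)

Section EdgeCancellation.
Context {R : realType} (Omega : set (R * R)) (M : mesh R).
Hypothesis hO : polygonal_domain Omega.
Hypothesis hT : triangulation Omega M.
Implicit Types (k l : 'I_(nt M)) (i j : 'I_3) (x y : R * R) (a b : 'I_(nv M)).

Lemma ord3_cyc i j : [\/ j = i, j = i + 1 | j = i + 2%:R].
Proof.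
by move: i j; do 2 elim/ord3_cases; rewrite !ord3E;
  do ?[by apply: Or31|by apply: Or32|by apply: Or33].
Qed.

(* Positive when [x] lies to the left of the oriented line from [a] to [b]. *)
Definition ori a b x : R := cross (vtx b - vtx a) (x - vtx a).

(* The sign of the Jacobian is the orientation of the triangle, so the value is [1] (resp.
   [-1]) when the triangle lies to the left (resp. to the right) of its edge [a b]. *)
Definition side a b k i : R :=
  if (tri k i == a) && (tri k (i + 1) == b) then Num.sg (jacobian k)
  else if (tri k i == b) && (tri k (i + 1) == a) then - Num.sg (jacobian k) else 0.

Lemma cross_segment x y (t : R) : cross (y - x) ((1 - t) *: x + t *: y - x) = 0.
Proof. rewrite /cross /= /GRing.scale /=; ring. Qed.

Lemma tri_succ k i : tri k i != tri k (i + 1).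
Proof.
rewrite (inj_eq (tri_inj (jac0 hT k))).
by elim/ord3_cases: i; rewrite ord3E.
Qed.

Lemma side_swap a b k i : side b a k i = - side a b k i.
Proof.
rewrite /side; have n := tri_succ k i.
case: (eqVneq (tri k i) a) => [ea|_]; case: (eqVneq (tri k i) b) => [eb|_];
  case: (eqVneq (tri k (i + 1)) a) => [ea'|_]; case: (eqVneq (tri k (i + 1)) b) => [eb'|_] //=;
  rewrite ?opprK ?oppr0 //; by case/negP: n; apply/eqP; congruence.
Qed.

(** [V] is [jacobian k] or its opposite, according to the direction in which [k] runs along the
    edge. Thus the sign of [side] tells on which side of the line the apex lies, and [ori] is a
    multiple of the apex coordinate. *)
Lemma sideP a b k i : side a b k i != 0 ->
  [/\ a \in vset k, b \in vset k,
      forall j, j != i + 2%:R -> tri k j = a \/ tri k j = b &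
      exists V, 0 < side a b k i * V /\ forall x, ori a b x = V * lam k (i + 2%:R) x].
Proof.
have J0 := jac0 hT k; have JJ : 0 < Num.sg (jacobian k) * jacobian k.
  by rewrite -normrEsg normr_gt0.
have E x : cross (pt k (i + 1) - pt k i) (x - pt k i) = jacobian k * lam k (i + 2%:R) x.
  rewrite /lam mulrC mulfVK //; elim/ord3_cases: i {J0 JJ}; rewrite !ord3E /cross /=; ring.
have mem j : tri k j \in vset k by exact: imset_f.
have cyc j : j != i + 2%:R -> j = i \/ j = i + 1.
  by case: (ord3_cyc i j) => ->; rewrite ?eqxx //; [left|right].
rewrite /side; case: ifP => [/andP[/eqP ea /eqP eb] _|_].
  split; rewrite -?ea -?eb //; first by move=> j /cyc [->|->]; [left|right].
  by exists (jacobian k); split => // x; rewrite /ori -E /pt.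
case: ifP => [/andP[/eqP eb /eqP ea] _|_]; last by rewrite eqxx.
split; rewrite -?ea -?eb //; first by move=> j /cyc [->|->]; [right|left].
exists (- jacobian k); split; first by rewrite mulrNN.
by move=> x; rewrite mulNr -E /ori -!/(pt k _) /cross /=; ring.
Qed.

(** Otherwise all three vertices of [k] would belong to [l]. *)
Lemma side_apex a b k i : side a b k i != 0 -> forall l, k != l ->
  a \in vset l -> b \in vset l -> tri k (i + 2%:R) \notin vset l.
Proof.
move=> /sideP[_ _ hj _] l kl al bl; apply: contraNN kl => cl.
apply/eqP; apply: (vset_subset hT); apply/fintype.subsetP => n /imsetP[j _ ->].
by have [->//|/hj[->|->]] := eqVneq j (i + 2%:R).
Qed.

Lemma lam_ends a b k i j : side a b k i != 0 -> j != i + 2%:R ->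
  lam k j (vtx a) + lam k j (vtx b) = 1.
Proof.
rewrite /side => s ji.
have h : lam k j (pt k i) + lam k j (pt k (i + 1)) = 1.
  rewrite !(lam_pt hT); case: (ord3_cyc i j) => jE; rewrite jE ?eqxx; last by rewrite jE eqxx in ji.
    by rewrite (_ : (i == i + 1) = false) ?addr0 //; elim/ord3_cases: i {s ji jE}.
  by rewrite (_ : (i + 1 == i) = false) ?add0r //; elim/ord3_cases: i {s ji jE}.
move: s; case: ifP => [/andP[/eqP <- /eqP <-] _|_]; first exact: h.
by case: ifP => [/andP[/eqP <- /eqP <-] _|_]; [rewrite addrC; exact: h|rewrite eqxx].
Qed.

Lemma vtx_elt a k : a \in vset k -> elt k (vtx a).
Proof. by move=> /imsetP[i _ ->]; exact: (elt_pt hT). Qed.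

(** If two distinct triangles lay to the left of the same edge, a point moved slightly from its
    midpoint towards the apex of [k] would lie in both, while conformity forces its apex coordinate
    in [k] to vanish. *)
Lemma left_unique a b k i l j : 0 < side a b k i -> 0 < side a b l j ->
  k = l /\ i = j.
Proof.
move=> sk sl; have sk0 := lt0r_neq0 sk; have sl0 := lt0r_neq0 sl.
have [kl|kl] := eqVneq k l.
  subst l; split => //; apply: (tri_inj (jac0 hT k)).
  move: sk sl; rewrite /side.
  case: ifP => [/andP[/eqP <- _] h|_].
    case: ifP => [/andP[/eqP -> _] //|_].
    by case: ifP => [_ h'|]; [exfalso; lra|rewrite ltxx].
  case: ifP => [/andP[/eqP <- _] h|_]; last by rewrite ltxx.
  case: ifP => [_ h'|_]; first by exfalso; lra.
  by case: ifP => [/andP[/eqP -> _] //|]; rewrite ltxx.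
exfalso.
have [ak bk _ [V [V0 oV]]] := sideP sk0.
have [al bl _ [W [W0 oW]]] := sideP sl0.
have apex := side_apex sk0 kl al bl.
rewrite pmulr_rgt0 // in V0; rewrite pmulr_rgt0 // in W0.
pose c := pt k (i + 2%:R); pose m := 2^-1 *: vtx a + 2^-1 *: vtx b.
have h2 : 2^-1 + 2^-1 = 1 :> R by lra.
have lc : lam k (i + 2%:R) c = 1 by rewrite (lam_pt hT) eqxx.
(* The step [s^-1] from the midpoint to [c] is so short that the coordinates in [l] of the two ends
   of the edge, equal to one half at the midpoint when added over both ends with weight one half,
   stay nonnegative. *)
pose s : R := 2 + 2 * \sum_j' `|lam l j' c|.
have s2 : 2 <= s by rewrite lerDl mulr_ge0 // sumr_ge0.
have s0 : 0 < s by lra.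
pose x := (1 - s^-1) *: m + s^-1 *: c.
have st : (1 - s^-1) + s^-1 = 1 by rewrite subrK.
have is0 : 0 < s^-1 by rewrite invr_gt0.
have is1 : s^-1 <= 1 by rewrite invf_le1 //; lra.
have i2 : 0 <= 2^-1 :> R by lra.
have xk : elt k x.
  apply/(eltP _ (jac0 hT k)) => j'; rewrite /x lam_affine // /m lam_affine //.
  have hc := (eltP _ (jac0 hT k)).1 (elt_pt hT k (i + 2%:R)) j'.
  have ha := (eltP _ (jac0 hT k)).1 (vtx_elt ak) j'.
  have hb := (eltP _ (jac0 hT k)).1 (vtx_elt bk) j'.
  apply: addr_ge0; apply: mulr_ge0; [lra| |lra|exact: hc].
  by apply: addr_ge0; apply: mulr_ge0.
have lx : lam k (i + 2%:R) x = (1 - s^-1) * lam k (i + 2%:R) m + s^-1.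
  by rewrite /x lam_affine // lc mulr1.
have lx0 : 0 < lam k (i + 2%:R) x.
  have ha := (eltP _ (jac0 hT k)).1 (vtx_elt ak) (i + 2%:R).
  have hb := (eltP _ (jac0 hT k)).1 (vtx_elt bk) (i + 2%:R).
  rewrite lx; apply: ltr_wpDl => //; apply: mulr_ge0; first by lra.
  by rewrite /m lam_affine //; apply: addr_ge0; apply: mulr_ge0.
have xl : elt l x.
  (* For the apex of [l], [ori] is a positive multiple of the apex coordinate in either triangle, so
     positivity passes from [k] to [l]; the other two coordinates are handled by the choice of
     [s]. *)
  apply/(eltP _ (jac0 hT l)) => j'; have [->|nj] := eqVneq j' (j + 2%:R).
    have : 0 < W * lam l (j + 2%:R) x by rewrite -oW oV mulr_gt0.
    by rewrite pmulr_rgt0 // => /ltW.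
  rewrite /x lam_affine // /m lam_affine // -mulrDr (lam_ends sl0 nj) mulr1.
  have hs : `|lam l j' c| <= \sum_j' `|lam l j' c|.
    by rewrite (bigD1 j') //= lerDl sumr_ge0.
  have : - `|lam l j' c| <= lam l j' c by rewrite lerNl -normrN ler_norm.
  move=> h3; have E : s^-1 * (2 + 2 * \sum_j' `|lam l j' c|) = 1 by rewrite mulVf // gt_eqF.
  move: hs h3 E is0 is1; move: (s^-1) (\sum_j' _) (`|_|) => d Sg N hs h3 E is0 is1.
  have : 0 <= d * (Sg + lam l j' c) by apply: mulr_ge0; lra.
  move: (lam l j' c) h3 => L h3; nra.
by move: lx0; rewrite (common_lam hT kl xk xl apex) ltxx.
Qed.

Lemma frontier_closure x : frontier Omega x <-> closure Omega x /\ ~ Omega x.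
Proof.
by rewrite /frontier ((interior_id Omega).1 (Omega_open hO)).
Qed.

Lemma adjacent k a b : a \in vset k -> b \in vset k -> a != b ->
  exists i, side a b k i != 0.
Proof.
move=> /imsetP[i _ aE] /imsetP[j _ bE] ab.
have ij : j != i by apply: contraNN ab => /eqP ji; rewrite aE bE ji.
have sJ : Num.sg (jacobian k) != 0 by rewrite sgr_eq0 (jac0 hT).
case: (ord3_cyc i j) => jE; first by rewrite jE eqxx in ij.
  by exists i; rewrite /side -aE bE jE !eqxx.
exists j; rewrite /side -bE.
have -> : tri k (j + 1) = a by rewrite aE jE -addrA (_ : 2%:R + 1 = 0) ?addr0 //; exact/val_inj.
rewrite (eq_sym b a) (negbTE ab) /= !eqxx /=.
by rewrite oppr_eq0.
Qed.

(** The edge has a point in [Omega], which may be taken strictly between its ends. Stepping from it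
    slightly away from the apex of [k] stays in [Omega], hence in some triangle [l]; this [l]
    contains the edge and lies on the other side. *)
Lemma right_exists a b k i :
  ~ (segment (vtx a) (vtx b) `<=` frontier Omega) -> side a b k i != 0 ->
  exists l j, side a b l j * side a b k i < 0.
Proof.
move=> /existsNP[x0 /not_implyP[[t0 [/andP[t00 t01] ->]] nf]] sk0.
have [ak bk hj [V [V0 oV]]] := sideP sk0.
pose pnt (t : R) := (1 - t) *: vtx a + t *: vtx b.
have pntE t : vtx a + t *: (vtx b - vtx a) = pnt t.
  by rewrite /pnt scalerBl scale1r scalerBr addrA addrAC.
rewrite pntE in nf.
have lamp t j : lam k j (pnt t) = (1 - t) * lam k j (vtx a) + t * lam k j (vtx b).
  by rewrite /pnt lam_affine // subrK.
have ha j := (eltP _ (jac0 hT k)).1 (vtx_elt ak) j.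
have hb j := (eltP _ (jac0 hT k)).1 (vtx_elt bk) j.
have kp (t : R) : 0 <= t <= 1 -> elt k (pnt t).
  move=> /andP[t1 t2]; apply/(eltP _ (jac0 hT k)) => j; rewrite lamp.
  by rewrite addr_ge0 // mulr_ge0 // subr_ge0.
have Ot0 : Omega (pnt t0).
  apply: contrapT => nO; apply: nf; apply/frontier_closure; split => //.
  by apply: (elt_sub_closure hT (k := k)); apply: kp; rewrite t00.
have cp : continuous pnt.
  move=> t; apply: cvgD; apply: cvgZl => //.
    by apply: cvgB; [exact: cvg_cst|exact: cvg_id].
have [t [t_0 t_1 Ot]] : exists t : R, [/\ 0 < t, t < 1 & Omega (pnt t)].
  have : nbhs t0 (pnt @^-1` Omega).
    by apply: cp; apply: open_nbhs_nbhs; split => //; exact: (Omega_open hO).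
  move=> /nbhs_ballP[e /= e0 he].
  pose d := Num.min e 1 / 2.
  have me : Num.min e 1 <= e by rewrite ge_min lexx.
  have m1 : Num.min e 1 <= 1 by rewrite ge_min lexx orbT.
  have m0 : 0 < Num.min e 1 by rewrite lt_min e0 ltr01.
  have d0 : 0 < d by rewrite /d; lra.
  have de : d < e by rewrite /d; lra.
  have d1 : d < 1 by rewrite /d; lra.
  exists (t0 + d * (2^-1 - t0)); split; [nra|nra|].
  apply: (he (t0 + d * (2^-1 - t0))); rewrite /ball /= opprD addNKr normrN normrM gtr0_norm //.
  apply: le_lt_trans de; apply: ler_piMr; first exact: ltW.
  by rewrite ler_norml; apply/andP; split; lra.
set p := pnt t in Ot.
have pk : elt k p by apply: kp; rewrite !ltW.
pose c := pt k (i + 2%:R).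
pose q (s : R) := (1 + s) *: p + (- s) *: c.
have cq : q s @[s --> (0 : R)] --> p.
  rewrite -[X in _ --> X](_ : q 0 = p); last by rewrite /q addr0 oppr0 scale1r scale0r addr0.
  apply: cvgD; apply: cvgZl => //.
    by apply: cvgD; [exact: cvg_cst|exact: cvg_id].
  by apply: cvgN; exact: cvg_id.
have n1 : \forall s \near (0 : R), Omega (q s).
  by apply: cq; apply: open_nbhs_nbhs; split => //; exact: (Omega_open hO).
(* There are finitely many triangles and they are closed: for small [s], any triangle that contains
   [q s] already contains [p]. *)
have n2l l : \forall s \near (0 : R), ~ elt l p -> ~ elt l (q s).
  have [lp|nlp] := pselect (elt l p); first by near=> s.
  have [j lj] : exists j, lam l j p < 0.
    apply: contrapT => h; apply: nlp; apply/(eltP _ (jac0 hT l)) => j.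
    by rewrite leNgt; apply/negP => hlt; apply: h; exists j.
  have c1 : \forall s \near (0 : R), lam l j (q s) < 0.
    exact: (cq [set y | lam l j y < 0] (elt_closed_lt lj)).
  apply: filterS c1 => s hs _.
  by move=> /(eltP _ (jac0 hT l)) /(_ j); rewrite leNgt => /negP; exact.
have n2 : \forall s \near (0 : R), forall l, ~ elt l p -> ~ elt l (q s).
  exact: (@filter_forall _ _ _ (nbhs (0 : R)) _ n2l).
have [s [s0 Oq hl]] : exists s : R, [/\ 0 < s, Omega (q s) &
    forall l : 'I_(nt M), ~ elt l p -> ~ elt l (q s)].
  have n12 : nbhs (0 : R) [set s | Omega (q s) /\ forall l, ~ elt l p -> ~ elt l (q s)].
    by apply: filterS2 n1 n2 => s'.
  have /nbhs_ballP[e /= e0 he] := n12.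
  have [] : (fun s : R => Omega (q s)) (e / 2) /\
    (forall l : 'I_(nt M), ~ elt l p -> ~ elt l (q (e / 2))).
    by apply: he; rewrite /ball /= sub0r normrN gtr0_norm; lra.
  by move=> h1 h2; exists (e / 2); split => //; lra.
have [l lq] := closure_elt hT (subset_closure Oq).
have lp : elt l p by apply: contrapT => /hl.
have V0' : V != 0 by apply: contraTneq V0 => ->; rewrite mulr0 ltxx.
have lp2 : lam k (i + 2%:R) p = 0.
  apply: (mulfI V0'); rewrite mulr0 -oV.
  exact: cross_segment.
have lq2 : lam k (i + 2%:R) (q s) = - s.
  by rewrite /q lam_affine; [rewrite lp2 (lam_pt hT) eqxx mulr0 add0r mulr1|ring].
have kl : k != l.
  apply/eqP => kl; subst l; have := (eltP _ (jac0 hT k)).1 lq (i + 2%:R).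
  by rewrite lq2; lra.
have inl n : n = a \/ n = b -> n \in vset l.
  move=> hn; have : n \in vset k by case: hn => ->.
  case/imsetP => j _ nE; apply/negPn/negP; rewrite nE => /(common_lam hT kl pk lp) /eqP.
  apply/negP/lt0r_neq0; rewrite lamp.
  case: hn => nE'; have E : lam k j (vtx n) = 1 by rewrite nE (lam_pt hT) eqxx.
    by rewrite -nE' E mulr1 ltr_pwDl ?subr_gt0 // mulr_ge0 // ltW.
  by rewrite -nE' E mulr1 ltr_wpDl // mulr_ge0 // subr_ge0 ltW.
have ab : a != b.
  move: sk0; rewrite /side; have n := tri_succ k i.
  case: ifP => [/andP[/eqP <- /eqP <-] _|_]; first exact: n.
  by case: ifP => [/andP[/eqP <- /eqP <-] _|]; [rewrite eq_sym|rewrite eqxx].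
have [j sl0] := adjacent (inl a (or_introl erefl)) (inl b (or_intror erefl)) ab.
exists l, j; have [_ _ _ [W [W0 oW]]] := sideP sl0.
(* Computing [ori] at [q s] through both triangles gives [- V * s = W * mu] with [s > 0] and
   [mu >= 0]. Hence [V] and [W], and with them the two sides, have opposite signs. *)
have hq := oW (q s); rewrite oV lq2 in hq.
have lq0 := (eltP _ (jac0 hT l)).1 lq (j + 2%:R).
set mu := lam l _ _ in hq lq0; set A := side a b l j in W0 sl0 *.
set B := side a b k i in V0 sk0 *.
rewrite ltNge; apply/negP => AB.
have AB0 : 0 < A * B by rewrite lt_neqAle AB andbT eq_sym mulf_neq0.
have WV : 0 < W * V.
  by rewrite -(pmulr_rgt0 _ AB0) mulrACA mulr_gt0.
have : 0 <= W * V * mu by rewrite mulr_ge0 // ltW.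
have V2 : 0 < V * V * s by rewrite mulr_gt0 // -expr2 exprn_even_gt0.
have -> : W * V * mu = - (V * V * s) by rewrite mulrAC -hq; ring.
lra.
Unshelve. all: by end_near.
Qed.

End EdgeCancellation.

Section InteriorEdges.
Context {R : realType} (Omega : set (R * R)) (M : mesh R).
Hypothesis hO : polygonal_domain Omega.
Hypothesis hT : triangulation Omega M.
Implicit Types (k l : 'I_(nt M)) (i j : 'I_3) (x y : R * R) (a b : 'I_(nv M)).

(** Either no triangle has this edge, or exactly one summand is [1] and one is [-1]: [right_exists]
    supplies the partner, and [left_unique], also with [a] and [b] exchanged, excludes a third. *)
Lemma side_sum0 a b : ~ (segment (vtx a) (vtx b) `<=` frontier Omega) ->
  \sum_(p : 'I_(nt M) * 'I_3) side a b p.1 p.2 = 0.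
Proof.
move=> nf.
have vals p : side a b p.1 p.2 = 0 \/ side a b p.1 p.2 = 1 \/ side a b p.1 p.2 = -1.
  rewrite /side; have J0 := jac0 hT p.1.
  have : Num.sg (jacobian p.1) = 1 \/ Num.sg (jacobian p.1) = -1.
    have [h|h|h] := ltgtP (jacobian p.1) 0; first by right; rewrite ltr0_sg.
      by left; rewrite gtr0_sg.
    by rewrite h eqxx in J0.
  by case=> ->; case: ifP => _; [|case: ifP => _| |case: ifP => _]; rewrite ?opprK; auto.
have [[p sp]|none] := pselect (exists p, side a b p.1 p.2 != 0); last first.
  rewrite big1 // => p _; apply/eqP/negPn/negP => sp; apply: none; by exists p.
have [l [j sq]] := right_exists hO hT nf sp.
have pq : (l, j) != p by apply: contraTneq sq => <-; rewrite /= -leNgt -expr2 sqr_ge0.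
rewrite (bigD1 p) //= (bigD1 (l, j)) //= big1 ?addr0; last first.
  move=> p' /andP[p'p p'q]; apply/eqP/negPn/negP => sp'.
  have uniq1 c d : 0 < side a b c.1 c.2 -> 0 < side a b d.1 d.2 -> c = d.
    by case: c d => [? ?] [? ?] /= h1 h2; have [-> ->] := left_unique hT h1 h2.
  have uniq2 c d : side a b c.1 c.2 < 0 -> side a b d.1 d.2 < 0 -> c = d.
    case: c d => [? ?] [? ?] /= h1 h2.
    by rewrite -oppr_gt0 -(side_swap hT) in h1; rewrite -oppr_gt0 -(side_swap hT) in h2;
      have [-> ->] := left_unique hT h1 h2.
  move: sq sp sp'; have [->|[E|E]] := vals p; rewrite ?eqxx // E => sq _ sp'.
  - have sq' : side a b l j < 0 by move: sq; rewrite mulr1.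
    have [E'|[E'|E']] := vals p'; first by rewrite E' eqxx in sp'.
      by case/eqP: p'p; apply: uniq1; rewrite ?E ?E'.
    by case/eqP: p'q; apply: uniq2; rewrite //= E' ltrN10.
  - have sq' : 0 < side a b l j by move: sq; rewrite mulrN1 oppr_lt0.
    have [E'|[E'|E']] := vals p'; first by rewrite E' eqxx in sp'.
      by case/eqP: p'q; apply: uniq1; rewrite //= E'.
    by case/eqP: p'p; apply: uniq2; rewrite ?E ?E' ltrN10.
move: sq; have := vals (l, j) => /=; have := vals p.
case=> [E|[E|E]]; [by rewrite E eqxx in sp| |]; case=> [->|[->|->]]; rewrite E; lra.
Qed.

(* Every interior edge is shared by one triangle on each of its sides. *)
Lemma interior_edges_cancel (h : 'I_(nv M) -> 'I_(nv M) -> R) :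
  (forall a b, h b a = - h a b) ->
  \sum_k \sum_(i < 3 | ~~ bedge Omega k i)
    Num.sg (jacobian k) * h (tri k i) (tri k (i + 1)) = 0.
Proof.
move=> hh.
pose T := \sum_(p : 'I_(nt M) * 'I_3 | ~~ bedge Omega p.1 p.2)
    Num.sg (jacobian p.1) * h (tri p.1 p.2) (tri p.1 (p.2 + 1)).
have -> : (\sum_k \sum_(i < 3 | ~~ bedge Omega k i)
    Num.sg (jacobian k) * h (tri k i) (tri k (i + 1))) = T.
  by rewrite pair_big_dep.
(* Passing to ordered pairs of vertices allows summation over triangles first. Each local edge is
   seen as [(A, B)] and as [(B, A)]; both [side] and [h] change sign, so the contributions agree,
   whence the factor 2. *)
have E k i : \sum_a \sum_b side a b k i * h a b =
    2 * (Num.sg (jacobian k) * h (tri k i) (tri k (i + 1))).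
  have nn := tri_succ hT k i; set A := tri k i in nn *; set B := tri k (i + 1) in nn *.
  have sE a b : side a b k i * h a b =
      (A == a)%:R * ((B == b)%:R * (Num.sg (jacobian k) * h a b)) +
      (B == a)%:R * ((A == b)%:R * (- Num.sg (jacobian k) * h a b)).
    rewrite /side -/A -/B; case: (eqVneq A a) => [<-|_]; case: (eqVneq B b) => [<-|_];
      rewrite ?(negbTE nn) ?eqxx /= 1?(eq_sym B A) ?(negbTE nn) /= ?mul1r ?mul0r ?mulr0 ?addr0 ?add0r //;
    case: (eqVneq A b) => _; case: (eqVneq B a) => _ /=; rewrite ?mul1r ?mul0r ?mulr0 ?addr0 ?add0r //.
  under eq_bigr do (under eq_bigr do rewrite sE; rewrite big_split /=).
  have pick (c : 'I_(nv M)) (f : 'I_(nv M) -> R) : \sum_a (c == a)%:R * f a = f c.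
    rewrite (bigD1 c) //= eqxx mul1r big1 ?addr0 // => a; rewrite eq_sym => /negbTE ->.
    by rewrite mul0r.
  rewrite big_split /=.
  under eq_bigr do rewrite -mulr_sumr.
  rewrite pick pick.
  under eq_bigr do rewrite -mulr_sumr.
  by rewrite pick pick (hh A B); ring.
suff : 2 * T = 0 by move/eqP; rewrite mulf_eq0 pnatr_eq0 /= => /eqP.
rewrite /T mulr_sumr; under eq_bigr do rewrite -E.
rewrite exchange_big big1 //= => a _; rewrite exchange_big big1 //= => b _.
(* A pair inside the frontier gives only boundary edges, which the filter removes. For any other
   pair the filter discards only zero terms, and [side_sum0] applies to the full sum. *)
rewrite -mulr_suml; have [F|F] := pselect (segment (vtx a) (vtx b) `<=` frontier Omega).
  rewrite big1 ?mul0r // => -[k i] /= nb; apply: contraNeq nb.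
  rewrite /side /bedge => s; apply/asboolP.
  move: s; case: ifP => [/andP[/eqP ea /eqP eb] _|_]; first by rewrite /edge /pt ea eb.
  case: ifP => [/andP[/eqP eb /eqP ea] _|_]; last by rewrite eqxx.
  move=> x; rewrite /edge /pt ea eb => -[t [/andP[t0 t1] ->]]; apply: F.
  exists (1 - t); split; first by apply/andP; split; lra.
  by rewrite scalerBl scale1r !scalerBr; apply: pairE; rewrite /= /GRing.scale /=; ring.
have -> : \sum_(i | ~~ bedge Omega i.1 i.2) side a b i.1 i.2 =
    \sum_(p : 'I_(nt M) * 'I_3) side a b p.1 p.2.
  rewrite [RHS](bigID (fun p => bedge Omega p.1 p.2)) /= [X in _ = X + _]big1 ?add0r //.
  move=> [k i] /= be; apply/eqP/negPn/negP => s; apply: F; move: be => /asboolP.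
  rewrite /edge /pt; move: s; rewrite /side.
  case: ifP => [/andP[/eqP -> /eqP ->] _ //|_].
  case: ifP => [/andP[/eqP -> /eqP ->] _|_]; last by rewrite eqxx.
  move=> sub x [t [/andP[t0 t1] ->]]; apply: sub.
  exists (1 - t); split; first by apply/andP; split; lra.
  by rewrite scalerBl scale1r !scalerBr; apply: pairE; rewrite /= /GRing.scale /=; ring.
by rewrite side_sum0 ?mul0r.
Qed.

End InteriorEdges.

(** * Friedrichs' inequality *)

Section Friedrichs.
Context {R : realType} (Omega : set (R * R)) (M : mesh R).
Hypothesis hO : polygonal_domain Omega.
Hypothesis hT : triangulation Omega M.
Local Notation leb := (@lebesgue_measure R).
Local Notation mR := (measurableTypeR R).
Local Notation mR2 := (measurableTypeR R * measurableTypeR R)%type.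
Local Notation ip := (pair_int (leb2 R) Omega).
Local Notation I01 := (`[0, 1]%classic : set mR).
Implicit Types (k l : 'I_(nt M)) (i j : 'I_3) (x y : R * R) (u v w : R * R -> R).

(** Integral in the parameter, without the arc-length factor: exactly the summand of [ip_half],
    where [h_e] cancels. *)
Definition epair k i u v : R := pair_int leb I01 (u \o epar k i) (v \o epar k i).

Lemma eint_epair k i u v : eint k i (fun x => u x * v x) = elen k i * epair k i u v.
Proof. by []. Qed.

Lemma pt_neq k i : pt k (i + 1) - pt k i != 0.
Proof.
rewrite subr_eq0 /pt; apply: contraNneq (tri_succ hT k i) => e.
by case: hT => inj _ _ _ _; rewrite -(inj _ _ e).
Qed.

Lemma dot_ge0 x : 0 <= dot x x.
Proof. by rewrite /dot -!expr2 addr_ge0 ?sqr_ge0. Qed.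

Lemma dot_gt0 x : x != 0 -> 0 < dot x x.
Proof.
move=> x0; rewrite lt_neqAle dot_ge0 andbT eq_sym; apply: contraNneq x0 => d0.
have h1 := sqr_ge0 x.1; have h2 := sqr_ge0 x.2; rewrite /dot -!expr2 in d0.
have /eqP e1 : x.1 ^+ 2 = 0 by lra.
have /eqP e2 : x.2 ^+ 2 = 0 by lra.
by rewrite !sqrf_eq0 in e1 e2; apply/eqP/pairE; apply/eqP.
Qed.

Lemma elen_gt0 k i : 0 < elen k i.
Proof. by rewrite /elen /enorm sqrtr_gt0 dot_gt0 // pt_neq. Qed.

Lemma epar_elt k i t : 0 <= t <= 1 -> elt k (epar k i t).
Proof.
move=> /andP[t0 t1].
have -> : epar k i t = (1 - t) *: pt k i + t *: pt k (i + 1).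
  by rewrite /epar scalerBl scale1r scalerBr addrA addrAC.
apply/(eltP _ (jac0 hT k)) => j; rewrite lam_affine ?subrK // !(lam_pt hT).
by rewrite addr_ge0 // mulr_ge0 // subr_ge0.
Qed.

Lemma Vh_epar v k i t : Vh Omega M v -> 0 <= t <= 1 ->
  v (epar k i t) = v (pt k i) + t * (v (pt k (i + 1)) - v (pt k i)).
Proof.
move=> hv t01; have [a [b vE]] := hv.2 k.
rewrite !vE; [|exact: (elt_pt hT)|exact: (elt_pt hT)|exact: epar_elt].
by rewrite /epar /dot /= /GRing.scale /=; ring.
Qed.

Lemma sqint_continuous01 (f : R -> R) : continuous f -> sqint leb I01 f.
Proof.
move=> cf; split.
  by apply: (@measurable_funS _ _ _ _ setT) => //; exact: continuous_measurable_fun.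
have c2 : continuous (fun x : R => f x ^+ 2) by move=> x; apply: cvgM; exact: cf.
exact: (continuous_integrable01 c2).
Qed.

Lemma affine_continuous (a c : R) : continuous (fun t : R => a + t * c).
Proof.
move=> x; apply: cvgD; first exact: cvg_cst.
by apply: cvgM; [exact: cvg_id|exact: cvg_cst].
Qed.

Lemma sqint_epar v k i : Vh Omega M v -> sqint leb I01 (v \o epar k i).
Proof.
move=> hv; have m01 : measurable I01 by exact: measurable_itv.
apply: (eq_sqint m01 _
  (sqint_continuous01 (@affine_continuous (v (pt k i)) (v (pt k (i + 1)) - v (pt k i))))) => t.
by move/set_mem; rewrite /= in_itv /= => t01; rewrite Vh_epar.
Qed.

Lemma ip_halfE u v : ip_half Omega M u v =
  \sum_(k < nt M) \sum_(i < 3 | bedge Omega k i) epair k i u v.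
Proof.
apply: eq_bigr => k _; apply: eq_bigr => i _.
by rewrite eint_epair mulKf // gt_eqF // elen_gt0.
Qed.

Lemma edge_cub_bound v k i (K : R) : Vh Omega M v ->
  (forall x, closure Omega x -> `|x.1| <= K /\ `|x.2| <= K) ->
  `|edge_cub v (tri k i) (tri k (i + 1))| <= K * epair k i v v.
Proof.
move=> hv hK.
pose X t := (pt k i).1 + t * ((pt k (i + 1)).1 - (pt k i).1).
pose u t := v (pt k i) + t * (v (pt k (i + 1)) - v (pt k i)).
have -> : epair k i v v = \int[leb]_(t in `[0, 1]) (u t ^+ 2).
  apply: eq_Rintegral => t /set_mem; rewrite /= in_itv /= => t01.
  by rewrite Vh_epar // expr2.
have iu : leb.-integrable I01 (EFin \o (fun t => u t ^+ 2)).
  by case: (sqint_continuous01 (@affine_continuous (v (pt k i)) (v (pt k (i + 1)) - v (pt k i)))).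
have iX : leb.-integrable I01 (EFin \o (fun t => X t * u t ^+ 2)).
  by apply: continuous_integrable01; exact: cubic_continuous.
have m01 : measurable I01 by exact: measurable_itv.
rewrite -RintegralZl //; apply: le_trans (le_normr_Rintegral m01 iX) _.
apply: le_Rintegral => //.
- exact: integrable_norm.
- exact: (integrableZl m01 K iu).
move=> t; rewrite /= in_itv /= => t01.
rewrite normrM (ger0_norm (sqr_ge0 _)) ler_wpM2r ?sqr_ge0 //.
have [h _] := hK _ (elt_sub_closure hT (epar_elt k i t01)).
by move: h; rewrite /X /epar /= /GRing.scale /= .
Qed.

Lemma edge_y_bound k i : `|(pt k (i + 1)).2 - (pt k i).2| <= elen k i.
Proof.
rewrite -sqrtr_sqr /elen /enorm ler_sqrt ?dot_ge0 // /dot /= -!expr2.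
by rewrite lerDr sqr_ge0.
Qed.

(** Each coordinate changes by at most [2 * K], so the squared length is at most [8 * K ^+ 2]; the
    rounder bound [4 * K] avoids a square root. *)
Lemma elen_bound k i (K : R) :
  (forall x, closure Omega x -> `|x.1| <= K /\ `|x.2| <= K) -> elen k i <= 4 * K.
Proof.
move=> hK.
have [h1 h2] := hK _ (elt_sub_closure hT (elt_pt hT k i)).
have [h3 h4] := hK _ (elt_sub_closure hT (elt_pt hT k (i + 1))).
have K0 : 0 <= K := le_trans (normr_ge0 _) h1.
rewrite -[4 * K]ger0_norm ?mulr_ge0 // -sqrtr_sqr /elen /enorm ler_sqrt ?sqr_ge0 //.
move: h1 h2 h3 h4; rewrite /dot /= !ler_norml => /andP[a1 b1] /andP[a2 b2] /andP[a3 b3] /andP[a4 b4].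
have sq (d : R) : - (2 * K) <= d <= 2 * K -> d * d <= 4 * K ^+ 2.
  by move=> /andP[d1 d2]; nra.
have e1 : ((pt k (i + 1)).1 - (pt k i).1) * ((pt k (i + 1)).1 - (pt k i).1) <= 4 * K ^+ 2.
  by apply: sq; apply/andP; split; lra.
have e2 : ((pt k (i + 1)).2 - (pt k i).2) * ((pt k (i + 1)).2 - (pt k i).2) <= 4 * K ^+ 2.
  by apply: sq; apply/andP; split; lra.
have : 0 <= K ^+ 2 := sqr_ge0 K.
rewrite exprMn (_ : 4 ^+ 2 = 16 :> R); [lra|ring].
Qed.

Lemma friedrichs v (K : R) : Vh Omega M v ->
  (forall x, closure Omega x -> `|x.1| <= K /\ `|x.2| <= K) ->
  ip v v <= 8 * K ^+ 2 * ip_half Omega M v v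
    + 4 * K ^+ 2 * ip (fun x => (grad M v x).1) (fun x => (grad M v x).1).
Proof.
move=> hv hK; pose g x := (grad M v x).1.
have mO := measurable_Omega hO hT.
have sv := sqint_Vh hO hT hv.
have sg : sqint (leb2 R) Omega g by exact: (sqint_grad hO hT (p := fst)).
have mf : measurable_fun Omega (fun x : mR2 => x.1 : mR).
  by apply: (@measurable_funS _ _ _ _ setT) => //; exact: measurable_fst.
have [sxg xgK] := sqint_bounded_mul mO mf (fun x Ox => (hK x (subset_closure Ox)).1) sg.
have i1 := sqint_mul mO sv sv; have i2 := sqint_mul mO sv sxg.
pose W x := v x ^+ 2 + 2 * (v x * (x.1 * g x)).
have iW : (leb2 R).-integrable Omega (EFin \o W).
  have := integrableD mO i1 (integrableZl mO 2 i2).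
  by apply: (eq_integrable mO) => x _ /=; rewrite /W expr2.
have EW : int2 Omega W = ip v v + 2 * ip v (fun x => x.1 * g x).
  rewrite /pair_int -RintegralZl // -RintegralD //; last exact: (integrableZl mO 2 i2).
pose h (a b : 'I_(nv M)) := ((vtx b).2 - (vtx a).2) * edge_cub v a b.
have hh a b : h b a = - h a b by rewrite /h edge_cub_sym -opprB mulNr.
have EB : int2 Omega W = \sum_(k < nt M) \sum_(i < 3 | bedge Omega k i)
    Num.sg (jacobian k) * h (tri k i) (tri k (i + 1)).
  rewrite (int2_Omega hO hT iW).
  transitivity (\sum_(k < nt M) \sum_(i < 3 | bedge Omega k i)
      Num.sg (jacobian k) * h (tri k i) (tri k (i + 1)) +
    \sum_(k < nt M) \sum_(i < 3 | ~~ bedge Omega k i)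
      Num.sg (jacobian k) * h (tri k i) (tri k (i + 1))).
    rewrite -big_split /=; apply: eq_bigr => k _; rewrite (element_identity hT) //.
    by rewrite mulr_sumr [LHS](bigID (bedge Omega k)).
  by rewrite (interior_edges_cancel hO hT hh) addr0.
have K0 : 0 <= K.
  case: hO => _ [x /subset_closure /hK [h1 _]] _ _ _; exact: le_trans (normr_ge0 _) h1.
have EH : int2 Omega W <= 4 * K ^+ 2 * ip_half Omega M v v.
  rewrite EB ip_halfE mulr_sumr; apply: ler_sum => k _; rewrite mulr_sumr.
  apply: ler_sum => i _; apply: le_trans (ler_norm _) _.
  rewrite normrM normr_sg (jac0 hT) mul1r /h normrM.
  have h1 : `|(vtx (tri k (i + 1))).2 - (vtx (tri k i)).2| <= 4 * K :=
    le_trans (edge_y_bound k i) (elen_bound k i hK).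
  have h2 := edge_cub_bound k i hv hK.
  rewrite (_ : 4 * K ^+ 2 * epair k i v v = 4 * K * (K * epair k i v v)); last by ring.
  exact: ler_pM.
(* Young's parameter is 2, so the mixed term costs half of [ip v v]; moving it to the left doubles
   the constants to [8 * K ^+ 2] and [4 * K ^+ 2]. *)
have := pair_int_young_norm mO (ltr0Sn R 1) sv sxg.
move: EH xgK; rewrite EW -/g -/(g _).
set A := ip v v; set B := ip v _; set H := ip_half _ _ _ _; set G := ip g g; set X := ip _ _.
by move=> e1 e2 e3; have := ler_norm (- B); rewrite normrN => e4; lra.
Qed.

End Friedrichs.

Lemma pair_int_sum3 d (T : measurableType d) (R : realType)
    (mu : {measure set T -> \bar R}) (D : set T) (mD : measurable D)
    (f : 'I_3 -> T -> R) : (forall i, sqint mu D (f i)) ->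
  pair_int mu D (fun x => \sum_i f i x) (fun x => \sum_i f i x) <=
  3 * \sum_i pair_int mu D (f i) (f i).
Proof.
move=> hf; have hs : sqint mu D (fun x => \sum_i f i x) by exact: sqint_sum.
rewrite pair_int_suml // sum_ord3; do 3 rewrite pair_intC pair_int_suml //.
rewrite !sum_ord3.
have y i j := pair_int_young mD ltr01 (hf i) (hf j).
have := (y 0 1, y 0 2%:R, y 1 2%:R); rewrite invr1 !mul1r => -[[y1 y2] y3].
rewrite (pair_intC _ _ (f 1) (f 0)) (pair_intC _ _ (f 2%:R) (f 0)) (pair_intC _ _ (f 2%:R) (f 1)).
lra.
Qed.

(** * Scaling to the reference triangle *)

Section Scaling.
Context {R : realType} (Omega : set (R * R)) (M : mesh R).
Hypothesis hO : polygonal_domain Omega.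
Hypothesis hT : triangulation Omega M.
Local Notation leb := (@lebesgue_measure R).
Local Notation mR := (measurableTypeR R).
Local Notation mR2 := (measurableTypeR R * measurableTypeR R)%type.
Local Notation ip := (pair_int (leb2 R) Omega).
Implicit Types (k l : 'I_(nt M)) (i j : 'I_3) (x y : R * R) (u v w : R * R -> R).

Lemma refmap_otri k z : oref z -> otri k (refmap k z).
Proof. by rewrite -(preimage_refmap hT k). Qed.

(* The squared norm of a finite element function with nodal values [d], up to constants
   which depend on the shape functions only. *)
Definition nodal_norm_sq (d : 'I_(nv M) -> R) : R :=
  \sum_(k < nt M) `|jacobian k| * \sum_i d (tri k i) ^+ 2.

(** On each element only three shape functions survive, and after pull-back the element enters
    through [|jacobian k|] alone. The family is abstract because the bound serves both [rho] and
    [mu]. *)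
Lemma shape_bound (W : 'I_(nv M) -> R * R -> R) (w : 'I_3 -> R * R -> R) (K : R) d :
  (forall n, sqint (leb2 R) Omega (W n)) ->
  (forall k i z, oref z -> W (tri k i) (refmap k z) = w i z) ->
  (forall k n x, n \notin vset k -> otri k x -> W n x = 0) ->
  (forall i, sqint (leb2 R) oref (w i)) ->
  (forall i, pair_int (leb2 R) oref (w i) (w i) <= K) ->
  ip (fun x => \sum_n d n * W n x) (fun x => \sum_n d n * W n x) <=
    3 * K * nodal_norm_sq d.
Proof.
move=> sW Ww W0 sw wK; have mO := measurable_Omega hO hT.
have mo : measurable (oref : set mR2) := measurable_oref.
pose V x := \sum_n d n * W n x.
have sV : sqint (leb2 R) Omega V.
  by apply: (sqint_sum mO) => n _; apply: (sqintZ mO).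
have -> : ip V V = int2 Omega (fun x => V x * V x) by [].
rewrite (int2_Omega hO hT (sqint_mul mO sV sV)) /nodal_norm_sq mulr_sumr.
apply: ler_sum => k _; rewrite mulrCA ler_wpM2l //.
pose f i z := d (tri k i) * w i z.
have sf i : sqint (leb2 R) oref (f i) by apply: (sqintZ mo).
have -> : int2 oref ((fun x => V x * V x) \o refmap k) =
    pair_int (leb2 R) oref (fun z => \sum_i f i z) (fun z => \sum_i f i z).
  apply: eq_Rintegral => z /set_mem oz /=.
  suff -> : V (refmap k z) = \sum_i f i z by [].
  rewrite /V (sum_vset (jac0 hT k) (subxx _)); last first.
    by move=> n nk; rewrite (W0 k) ?mulr0 //; exact: refmap_otri.
  by apply: eq_bigr => i _; rewrite Ww.
apply: le_trans (pair_int_sum3 mo sf) _; rewrite -mulrA ler_pM2l // mulr_sumr.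
apply: ler_sum => i _; rewrite (pair_intZl mo _ (sw i) (sf i)).
rewrite pair_intC (pair_intZl mo _ (sw i) (sw i)) mulrA -expr2 mulrC.
by rewrite ler_wpM2r // sqr_ge0.
Qed.

Lemma measurable_shp i : measurable_fun setT ((@shp R i) : mR2 -> mR).
Proof.
move: i; apply: ord3_cases; rewrite /shp /=.
- by apply: measurable_funB => //; apply: measurable_funB.
- exact: measurable_fst.
- exact: measurable_snd.
Qed.

Lemma shp_bound i (z : R * R) : oref z -> 0 < shp i z <= 1.
Proof.
case=> h1 h2 h3; elim/ord3_cases: i; rewrite /shp /=; apply/andP; split; lra.
Qed.

Lemma sqint_shp i : sqint (leb2 R) oref (shp i).
Proof.
apply: (@bounded_sqint _ _ _ _ _ measurable_oref _ 1).
- exact: leb2_oref_lty.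
- apply: (@measurable_funS _ _ _ _ setT) => //; exact: measurable_shp.
- by move=> z /(shp_bound i) /andP[h1 h2]; rewrite gtr0_norm.
Qed.

Definition kappa i : R := int2 oref (shp i).

Lemma integrable_shp i : (leb2 R).-integrable oref (EFin \o shp i).
Proof.
apply: measurable_bounded_integrable.
- exact: measurable_oref.
- exact: leb2_oref_lty.
- apply: (@measurable_funS _ _ _ _ setT) => //; exact: measurable_shp.
exists 1; split; first exact: num_real.
move=> B hB z /(shp_bound i) /andP[h1 h2]; rewrite /= gtr0_norm //.
exact: le_trans h2 (ltW hB).
Qed.

(** A crude bound in place of the value 1/6: all three shape functions exceed 1/4 on a square of
    side 1/8 inside the triangle. *)
Lemma kappa_gt0 i : (2 ^+ 8)^-1 <= kappa i.
Proof.
pose I : set mR := `]4^-1, 3 / 8[%classic.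
have mI : measurable (I `*` I : set mR2) by apply: measurableX; exact: measurable_itv.
have Iz z : (I `*` I) z -> [/\ 4^-1 < z.1, z.1 < 3 / 8, 4^-1 < z.2 & z.2 < 3 / 8].
  by case; rewrite /I /= !in_itv /= => /andP[? ?] /andP[? ?].
have sub : (I `*` I) `<=` oref.
  by move=> z /Iz[h1 h2 h3 h4]; split; lra.
have leI : leb I = (8^-1)%:E.
  by rewrite lebesgue_measure_itv /= lte_fin ifT -?EFinB; [congr EFin; field|lra].
have mo : measurable (oref : set mR2) := measurable_oref.
have iI := integrableS mo mI sub (integrable_shp i).
have mIE : leb2 R (I `*` I) = (8^-1 * 8^-1)%:E.
  by rewrite leb2_setX; [rewrite leI -EFinM|exact: measurable_itv|exact: measurable_itv].
have -> : (2 ^+ 8)^-1 = fine (\int[leb2 R]_(z in I `*` I) (4^-1)%:E)%E :> R.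
  by rewrite integral_cst // mIE -EFinM /=; field.
rewrite /kappa /int2 /Rintegral.
have fI : (\int[leb2 R]_(z in I `*` I) (4^-1)%:E)%E \is a fin_num.
  by rewrite integral_cst // mIE -EFinM.
apply: fine_le => //; first exact: integrable_fin_num (integrable_shp i).
apply: (@le_trans _ _ (\int[leb2 R]_(z in I `*` I) (shp i z)%:E)%E).
  apply: ge0_le_integral => //.
  - exact: measurable_int iI.
  - move=> z /Iz[h1 h2 h3 h4]; rewrite lee_fin.
    by elim/ord3_cases: i {iI}; rewrite /shp /=; lra.
apply: ge0_subset_integral => //; first exact: measurable_int (integrable_shp i).
by move=> z /(shp_bound i) /andP[/ltW h _]; rewrite lee_fin.
Qed.

Section Basis.
Variables (rho : 'I_(nv M) -> R * R -> R) (c : 'I_(nv M) -> R).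
Variables (mu : 'I_(nv M) -> R * R -> R).
Hypothesis hrho : nodal_basis Omega rho.
Hypothesis smu : forall n, sqint (leb2 R) Omega (mu n).
Hypothesis hc : forall m n, int2 Omega (fun x => rho m x * mu n x) = c n * (m == n)%:R.
Hypothesis hmu1 : forall k x, otri k x -> \sum_n mu n x = 1.

Lemma Vh_rho n : Vh Omega M (rho n).
Proof. by case: (hrho n). Qed.

Lemma sqint_rho n : sqint (leb2 R) Omega (rho n).
Proof. exact: (sqint_Vh hO hT (Vh_rho n)). Qed.

Lemma rho_refmap n k z : oref z -> rho n (refmap k z) = \sum_i shp i z * (n == tri k i)%:R.
Proof.
move=> oz; rewrite (rho_elt hT hrho n (otri_sub_elt (jac0 hT k) (refmap_otri k oz))).
by apply: eq_bigr => i _; rewrite (lam_refmap hT).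
Qed.

Lemma int2_lin3 (a : 'I_3 -> R) :
  int2 oref (fun z => \sum_i shp i z * a i) = \sum_i a i * kappa i.
Proof.
have mo : measurable (oref : set mR2) := measurable_oref.
have iZ i : (leb2 R).-integrable oref (EFin \o (fun z => a i * shp i z)) :=
  integrableZl mo (a i) (integrable_shp i).
rewrite sum_ord3 /kappa /int2.
rewrite -(RintegralZl _ mo (integrable_shp 0)) -(RintegralZl _ mo (integrable_shp 1)).
rewrite -(RintegralZl _ mo (integrable_shp 2%:R)).
rewrite -!RintegralD //; last exact: (integrableD mo (iZ 0) (iZ 1)).
by apply: eq_Rintegral => z _; rewrite sum_ord3 !(mulrC (shp _ _)).
Qed.

Lemma biorthogonal_constant n :
  c n = \sum_(k < nt M) `|jacobian k| * \sum_i (n == tri k i)%:R * kappa i.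
Proof.
have mO := measurable_Omega hO hT.
have smus : sqint (leb2 R) Omega (fun x => \sum_m mu m x) by exact: (sqint_sum mO).
have -> : c n = ip (rho n) (fun x => \sum_m mu m x).
  rewrite pair_intC (pair_int_suml mO) //; last exact: sqint_rho.
  rewrite (bigD1 n) //= big1 ?addr0 => [|m mn].
    by rewrite pair_intC /pair_int -/(int2 _ _) hc eqxx mulr1.
  by rewrite pair_intC /pair_int -/(int2 _ _) hc eq_sym (negbTE mn) mulr0.
rewrite /pair_int -/(int2 _ _) (int2_Omega hO hT (sqint_mul mO (sqint_rho n) smus)).
apply: eq_bigr => k _; congr (_ * _); rewrite -int2_lin3.
apply: eq_Rintegral => z /set_mem oz /=.
by rewrite (hmu1 (refmap_otri k oz)) mulr1 rho_refmap.
Qed.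

(** The reverse of [shape_bound]: inserting the elementwise formula for [c] regroups the sum by
    elements, with the same weights [|jacobian k|]. *)
Lemma nodal_norm_bound d :
  (2 ^+ 8)^-1 * nodal_norm_sq d <= \sum_n c n * d n ^+ 2.
Proof.
under [leRHS]eq_bigr do rewrite biorthogonal_constant mulr_suml.
rewrite exchange_big /= mulr_sumr; apply: ler_sum => k _.
under eq_bigr do rewrite -mulrA mulr_suml.
rewrite -mulr_sumr mulrCA ler_wpM2l // exchange_big /= mulr_sumr.
apply: ler_sum => i _; rewrite (bigD1 (tri k i)) //= eqxx mul1r big1 ?addr0.
  by rewrite ler_wpM2r ?sqr_ge0 // kappa_gt0.
by move=> n /negbTE ->; rewrite !mul0r.
Qed.

(** Every vertex belongs to some triangle, which contributes a positive term to the elementwise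
    formula, while all other terms are nonnegative. *)
Lemma biorthogonal_gt0 n : 0 < c n.
Proof.
case: (hT) => _ _ [hv _] _ _; have [k /imsetP[i _ nE]] := hv n.
have k0 j : 0 < kappa j.
  by apply: lt_le_trans (kappa_gt0 j); rewrite invr_gt0 exprn_gt0.
have t0 l : 0 <= `|jacobian l| * \sum_j (n == tri l j)%:R * kappa j.
  by rewrite mulr_ge0 // sumr_ge0 // => j _; rewrite mulr_ge0 // ltW.
rewrite biorthogonal_constant (bigD1 k) //= ltr_pwDl ?sumr_ge0 //.
rewrite mulr_gt0 ?normr_gt0 ?(jac0 hT) // (bigD1 i) //= nE eqxx mul1r ltr_pwDl //.
by rewrite sumr_ge0 // => j _; rewrite mulr_ge0 // ltW.
Qed.

End Basis.
End Scaling.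

Lemma aform_arith (R : realFieldType) (r alpha c a a' b b' h h' n n' m m' : R) :
  r * (a + c * a') + (1 - r) * (b + c * b') + alpha * (h + c * h') - (n + c * n') - (m + c * m') =
  r * a + (1 - r) * b + alpha * h - n - m + c * (r * a' + (1 - r) * b' + alpha * h' - n' - m').
Proof. by rewrite !mulrDr !mulrN !opprD !(mulrCA c); ring. Qed.

(** * The bilinear forms *)

Section Forms.
Context {R : realType} (Omega : set (R * R)) (M : mesh R).
Hypothesis hO : polygonal_domain Omega.
Hypothesis hT : triangulation Omega M.
Local Notation leb := (@lebesgue_measure R).
Local Notation mR := (measurableTypeR R).
Local Notation ip := (pair_int (leb2 R) Omega).
Local Notation I01 := (`[0, 1]%classic : set mR).
Local Notation sq := (sqint (leb2 R) Omega).
Local Notation mO := (measurable_Omega hO hT).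
Implicit Types (k l : 'I_(nt M)) (i j : 'I_3) (x y : R * R) (u v w : R * R -> R).
Implicit Types (s t : R * R -> R * R) (c : R).

Definition ipv s t : R := ip (fst \o s) (fst \o t) + ip (snd \o s) (snd \o t).

Definition sqv s : Prop := sq (fst \o s) /\ sq (snd \o s).

Lemma int2_dot s t : sqv s -> sqv t -> int2 Omega (fun x => dot (s x) (t x)) = ipv s t.
Proof.
move=> [s1 s2] [t1 t2]; rewrite /ipv /pair_int -RintegralD //; [exact: mO| |].
- exact: (sqint_mul mO s1 t1).
- exact: (sqint_mul mO s2 t2).
Qed.

Lemma ipvC s t : ipv s t = ipv t s.
Proof. by congr (_ + _); exact: pair_intC. Qed.

Lemma ipv_lin s s' t c : sqv s -> sqv s' -> sqv t ->
  ipv (fun x => s x + c *: s' x) t = ipv s t + c * ipv s' t.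
Proof.
move=> [s1 s2] [s1' s2'] [t1 t2]; rewrite /ipv.
rewrite (pair_intDl mO s1 (sqintZ mO c s1') t1) (pair_intDl mO s2 (sqintZ mO c s2') t2).
by rewrite (pair_intZl mO c s1' t1) (pair_intZl mO c s2' t2); ring.
Qed.

Lemma ipv_ge0 s : 0 <= ipv s s.
Proof. by rewrite addr_ge0 // pair_int_sqr_ge0. Qed.

Lemma ipv_young (e : R) s t : 0 < e -> sqv s -> sqv t ->
  2 * `|ipv s t| <= e^-1 * ipv s s + e * ipv t t.
Proof.
move=> e0 [s1 s2] [t1 t2]; have y1 := pair_int_young_norm mO e0 s1 t1.
have y2 := pair_int_young_norm mO e0 s2 t2.
have := ler_normD (ip (fst \o s) (fst \o t)) (ip (snd \o s) (snd \o t)).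
by rewrite /ipv; lra.
Qed.

Lemma sqv_lin s s' c : sqv s -> sqv s' -> sqv (fun x => s x + c *: s' x).
Proof.
move=> [s1 s2] [s1' s2']; split.
  exact: (sqintD mO s1 (sqintZ mO c s1')).
exact: (sqintD mO s2 (sqintZ mO c s2')).
Qed.

Lemma L2vnorm_sq s : sqv s -> L2vnorm Omega s ^+ 2 = ipv s s.
Proof.
by move=> hs; rewrite /L2vnorm (int2_dot hs hs) sqr_sqrtr // ipv_ge0.
Qed.

Lemma L2norm_sq v : L2norm Omega v ^+ 2 = ip v v.
Proof.
rewrite /L2norm sqr_sqrtr; first by rewrite pair_int_sqr.
by apply: Rintegral_ge0 => x _; exact: sqr_ge0.
Qed.

Lemma sqv_Lh s : Lh Omega M s -> sqv s.
Proof. by move=> [h1 h2]; split; exact: (sqint_Vh hO hT). Qed.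

Lemma sqv_grad v : Vh Omega M v -> sqv (grad M v).
Proof.
by move=> hv; split; [exact: (sqint_grad hO hT (p := fst))|exact: (sqint_grad hO hT (p := snd))].
Qed.

Lemma Lh_lin s s' c : Lh Omega M s -> Lh Omega M s' -> Lh Omega M (fun x => s x + c *: s' x).
Proof. by move=> [h1 h2] [h1' h2']; split; apply: VhD => //; exact: VhZ. Qed.

(** The regularity on the boundary that the edge forms use, common to finite element functions and
    to the datum [gD]. *)
Definition tr v : Prop := forall k i, bedge Omega k i -> sqint leb I01 (v \o epar k i).

Definition trv s : Prop := tr (fst \o s) /\ tr (snd \o s).

Lemma m01 : measurable I01. Proof. exact: measurable_itv. Qed.

Lemma tr_Vh v : Vh Omega M v -> tr v.
Proof. by move=> hv k i _; exact: (sqint_epar hT). Qed.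

Lemma trv_Lh s : Lh Omega M s -> trv s.
Proof. by move=> [h1 h2]; split; exact: tr_Vh. Qed.

Definition sn s k i (p : R) : R := dot (s (epar k i p)) (enormal k i).

Lemma sqint_sn s k i : trv s -> bedge Omega k i -> sqint leb I01 (sn s k i).
Proof.
move=> [h1 h2] bi.
have := sqintD m01 (sqintZ m01 (enormal k i).1 (h1 k i bi)) (sqintZ m01 (enormal k i).2 (h2 k i bi)).
apply: (eq_sqint m01) => x _; rewrite /sn /dot /=; congr (_ + _); exact: mulrC.
Qed.

Definition spair k i (f g : R -> R) : R := pair_int leb I01 f g.

Lemma spairC k i f g : spair k i f g = spair k i g f.
Proof. exact: pair_intC. Qed.

Lemma bint_normalE s v : bint_normal Omega M s v =
  \sum_(k < nt M) \sum_(i < 3 | bedge Omega k i)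
    elen k i * spair k i (sn s k i) (v \o epar k i).
Proof. by []. Qed.

Lemma normal_normE s : normal_norm_mhalf_sq Omega M s =
  \sum_(k < nt M) \sum_(i < 3 | bedge Omega k i)
    elen k i * (elen k i * spair k i (sn s k i) (sn s k i)).
Proof.
apply: eq_bigr => k _; apply: eq_bigr => i _; congr (_ * (_ * _)).
Qed.

Lemma bint_normal_lin1 s s' v c : trv s -> trv s' -> tr v ->
  bint_normal Omega M (fun x => s x + c *: s' x) v =
  bint_normal Omega M s v + c * bint_normal Omega M s' v.
Proof.
move=> hs hs' hv; rewrite !bint_normalE mulr_sumr -big_split; apply: eq_bigr => k _ /=.
rewrite mulr_sumr -big_split; apply: eq_bigr => i bi /=.
have h1 := sqint_sn hs bi; have h2 := sqint_sn hs' bi; have h3 := hv k i bi.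
rewrite mulrCA -mulrDr -(pair_intZl m01 c h2 h3) -(pair_intDl m01 h1 (sqintZ m01 c h2) h3).
congr (_ * _); apply: eq_pair_int => // x _.
by rewrite /sn /dot /= /GRing.scale /=; ring.
Qed.

Lemma bint_normal_lin2 s v v' c : trv s -> tr v -> tr v' ->
  bint_normal Omega M s (fun x => v x + c * v' x) =
  bint_normal Omega M s v + c * bint_normal Omega M s v'.
Proof.
move=> hs hv hv'; rewrite !bint_normalE mulr_sumr -big_split; apply: eq_bigr => k _ /=.
rewrite mulr_sumr -big_split; apply: eq_bigr => i bi /=.
have h1 := sqint_sn hs bi; have h2 := hv k i bi; have h3 := hv' k i bi.
rewrite mulrCA -mulrDr !(@spairC k i (sn s k i)) /spair.
by rewrite -(pair_intZl m01 c h3 h1) -(pair_intDl m01 h2 (sqintZ m01 c h3) h1).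
Qed.

Lemma ip_halfC u v : ip_half Omega M u v = ip_half Omega M v u.
Proof.
by rewrite !(ip_halfE hT); apply: eq_bigr => k _; apply: eq_bigr => i _; exact: pair_intC.
Qed.

Lemma ip_half_lin u u' v c : tr u -> tr u' -> tr v ->
  ip_half Omega M (fun x => u x + c * u' x) v =
  ip_half Omega M u v + c * ip_half Omega M u' v.
Proof.
move=> hu hu' hv; rewrite !(ip_halfE hT) mulr_sumr -big_split; apply: eq_bigr => k _ /=.
rewrite mulr_sumr -big_split; apply: eq_bigr => i bi /=.
have h1 := hu k i bi; have h2 := hu' k i bi; have h3 := hv k i bi.
by rewrite /epair -(pair_intZl m01 c h2 h3) -(pair_intDl m01 h1 (sqintZ m01 c h2) h3).
Qed.

Lemma ip_half_ge0 v : 0 <= ip_half Omega M v v.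
Proof.
rewrite (ip_halfE hT); apply: sumr_ge0 => k _; apply: sumr_ge0 => i _.
exact: pair_int_sqr_ge0.
Qed.

Lemma ip_half_young (e : R) u v : 0 < e -> tr u -> tr v ->
  2 * `|ip_half Omega M u v| <= e^-1 * ip_half Omega M u u + e * ip_half Omega M v v.
Proof.
move=> e0 hu hv; rewrite !(ip_halfE hT) !mulr_sumr -big_split /=.
apply: le_trans (ler_wpM2l _ (ler_norm_sum _ _ _)) _ => //; rewrite mulr_sumr.
apply: ler_sum => k _; rewrite !mulr_sumr -big_split /=.
apply: le_trans (ler_wpM2l _ (ler_norm_sum _ _ _)) _ => //; rewrite mulr_sumr.
apply: ler_sum => i bi; exact: (pair_int_young_norm m01 e0 (hu k i bi) (hv k i bi)).
Qed.

Lemma bint_normal_young (e : R) s v : 0 < e -> trv s -> tr v ->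
  2 * `|bint_normal Omega M s v| <=
    e^-1 * normal_norm_mhalf_sq Omega M s + e * ip_half Omega M v v.
Proof.
move=> e0 hs hv; rewrite bint_normalE normal_normE (ip_halfE hT) !mulr_sumr -big_split /=.
apply: le_trans (ler_wpM2l _ (ler_norm_sum _ _ _)) _ => //; rewrite mulr_sumr.
apply: ler_sum => k _; rewrite !mulr_sumr -big_split /=.
apply: le_trans (ler_wpM2l _ (ler_norm_sum _ _ _)) _ => //; rewrite mulr_sumr.
apply: ler_sum => i bi; have h0 := elen_gt0 hT k i.
(* Scaling Young's parameter by the edge length produces the weight [h_e] on the normal trace and
   [1 / h_e] on [v], as in the two mesh-dependent norms. *)
have ee : 0 < e / elen k i by rewrite divr_gt0.
have y := pair_int_young_norm m01 ee (sqint_sn hs bi) (hv k i bi).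
have := ler_wpM2l (ltW h0) y; rewrite normrM (gtr0_norm h0) mulrCA => {}y.
apply: le_trans y _; rewrite /epair /spair le_eqVlt; apply/orP; left; apply/eqP; field.
by rewrite !gt_eqF.
Qed.

(** Lets nodal expansions, valid only on [closure Omega], be substituted into the form. *)
Lemma eq_aform r alpha u u' s s' v v' t t' :
  Vh Omega M u -> Vh Omega M u' -> Vh Omega M v -> Vh Omega M v' ->
  (forall x, closure Omega x -> u x = u' x) -> (forall x, closure Omega x -> s x = s' x) ->
  (forall x, closure Omega x -> v x = v' x) -> (forall x, closure Omega x -> t x = t' x) ->
  aform Omega M r alpha u s v t = aform Omega M r alpha u' s' v' t'.
Proof.
move=> hu hu' hv hv' uE sE vE tE; rewrite /aform (grad_ext hT hu hu' uE) (grad_ext hT hv hv' vE).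
have eO x : x \in Omega -> closure Omega x by move=> /set_mem/subset_closure.
have eE k i (p : mR) : p \in I01 -> closure Omega (epar k i p).
  move=> /set_mem; rewrite /= in_itv /= => p01.
  exact: (elt_sub_closure hT (epar_elt hT k i p01)).
have -> : int2 Omega (fun x => dot (s x) (t x)) = int2 Omega (fun x => dot (s' x) (t' x)).
  by apply: eq_Rintegral => x /eO xO; rewrite sE ?tE.
have -> : ip_half Omega M u v = ip_half Omega M u' v'.
  rewrite !(ip_halfE hT); apply: eq_bigr => k _; apply: eq_bigr => i _.
  by apply: eq_pair_int => p /(eE k i) pO /=; rewrite ?uE ?vE.
have -> : bint_normal Omega M s v = bint_normal Omega M s' v'.
  rewrite !bint_normalE; apply: eq_bigr => k _; apply: eq_bigr => i _; congr (_ * _).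
  by apply: eq_pair_int => p /(eE k i) pO; rewrite /sn /= ?sE ?vE.
have -> // : bint_normal Omega M t u = bint_normal Omega M t' u'.
rewrite !bint_normalE; apply: eq_bigr => k _; apply: eq_bigr => i _; congr (_ * _).
by apply: eq_pair_int => p /(eE k i) pO; rewrite /sn /= ?tE ?uE.
Qed.

Lemma aform_lin r alpha u u' s s' v t c :
  Vh Omega M u -> Vh Omega M u' -> Vh Omega M v ->
  Lh Omega M s -> Lh Omega M s' -> Lh Omega M t ->
  aform Omega M r alpha (fun x => u x + c * u' x) (fun x => s x + c *: s' x) v t =
  aform Omega M r alpha u s v t + c * aform Omega M r alpha u' s' v t.
Proof.
move=> hu hu' hv hs hs' ht; rewrite /aform.
have -> : grad M (fun x => u x + c * u' x) = fun x => grad M u x + c *: grad M u' x.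
  by apply/funext => x; exact: (grad_lin hT).
have gl := sqv_lin c (sqv_grad hu) (sqv_grad hu').
have sl := sqv_lin c (sqv_Lh hs) (sqv_Lh hs').
rewrite !int2_dot //; try exact: sqv_Lh; try exact: sqv_grad.
rewrite !ipv_lin //; try exact: sqv_Lh; try exact: sqv_grad.
rewrite ip_half_lin; try exact: tr_Vh.
rewrite bint_normal_lin1; try exact: trv_Lh; try exact: tr_Vh.
rewrite bint_normal_lin2; try exact: trv_Lh; try exact: tr_Vh.
exact: aform_arith.
Qed.

Lemma aformC r alpha u s v t : aform Omega M r alpha u s v t = aform Omega M r alpha v t u s.
Proof.
have dC (f g : R * R -> R * R) : int2 Omega (fun x => dot (f x) (g x)) =
    int2 Omega (fun x => dot (g x) (f x)).
  by apply: eq_Rintegral => x _; rewrite /dot (mulrC (f x).1) (mulrC (f x).2).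
by rewrite /aform (ip_halfC u v) (dC s) (dC (grad M u)) addrAC.
Qed.

Lemma bformE u s psi : Vh Omega M u -> Lh Omega M s -> sqv psi ->
  bform Omega M u s psi = ipv s psi - ipv (grad M u) psi.
Proof.
move=> hu hs hp; rewrite /bform -mulN1r -ipv_lin //; [|exact: sqv_Lh|exact: sqv_grad].
rewrite -int2_dot //; last exact: (sqv_lin (-1) (sqv_Lh hs) (sqv_grad hu)).
by apply: eq_Rintegral => x _; rewrite scaleN1r.
Qed.

Lemma ip_half0r w : ip_half Omega M w (fun=> 0) = 0.
Proof.
rewrite (ip_halfE hT) big1 // => k _; rewrite big1 // => i _.
by rewrite /epair pair_intC; exact: (pair_int0l leb m01).
Qed.

Lemma bint_normal0r s : bint_normal Omega M s (fun=> 0) = 0.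
Proof.
rewrite bint_normalE big1 // => k _; rewrite big1 // => i _.
by rewrite spairC /spair (pair_int0l leb m01) mulr0.
Qed.

End Forms.

Section RefOpen.
Context {R : realType}.
Local Notation mR2 := (measurableTypeR R * measurableTypeR R)%type.

Lemma oref_open : open (@oref R).
Proof.
have -> : @oref R = [set z : R * R | 0 < z.1] `&` [set z | 0 < z.2] `&` [set z | z.1 + z.2 < 1].
  by apply/seteqP; split => z; [case=> ? ? ?|case=> -[? ?] ?].
have c1 : continuous (fun z : R * R => z.1) by move=> z; exact: cvg_fst.
have c2 : continuous (fun z : R * R => z.2) by move=> z; exact: cvg_snd.
apply: openI; first apply: openI.
- by apply: (open_comp (f := fun z : R * R => z.1) (D := [set y | 0 < y])) => //; exact: open_gt.
- by apply: (open_comp (f := fun z : R * R => z.2) (D := [set y | 0 < y])) => //; exact: open_gt.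
apply: (open_comp (f := fun z : R * R => z.1 + z.2) (D := [set y | y < 1])); last exact: open_lt.
by move=> z _; apply: cvgD; [exact: c1|exact: c2].
Qed.

Lemma oref_interior : @oref R `<=` interior (@ref_triangle R).
Proof.
move=> z oz; have : interior oref z by rewrite ((interior_id oref).1 oref_open).
by apply: filterS => y [h1 h2 h3]; split; lra.
Qed.

Lemma measurable_ref_triangle : measurable (@ref_triangle R : set mR2).
Proof.
have -> : @ref_triangle R = [set z : mR2 | 0 <= 1 * z.1 + 0 * z.2 + 0] `&`
   [set z | 0 <= 0 * z.1 + 1 * z.2 + 0] `&` [set z | 0 <= (-1) * z.1 + (-1) * z.2 + 1].
  apply/seteqP; split => z /=.
    by move=> [h1 h2 h3]; split; [split|]; lra.
  by move=> [[h1 h2] h3]; split; lra.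
have h (a b c : R) : measurable [set z : mR2 | 0 <= a * z.1 + b * z.2 + c] :=
  measurable_le0 (measurable_linear2 a b c).
by apply: measurableI; [apply: measurableI|]; exact: h.
Qed.

Lemma sqint_L2_ref (w : R * R -> R) : L2 (@ref_triangle R) w -> sqint (leb2 R) oref w.
Proof.
move=> /(sqintP _ measurable_ref_triangle)[mw iw].
have sub : @oref R `<=` @ref_triangle R by move=> z /oref_interior/interior_subset.
split; first exact: (measurable_funS measurable_ref_triangle sub mw).
exact: (integrableS measurable_ref_triangle measurable_oref sub iw).
Qed.

End RefOpen.

(** * Absorption arguments on real numbers *)

Section Arithmetic.
Context {R : realFieldType}.
Implicit Types (U G H S F N b p h kE T alpha : R).

Lemma coercivity_arith (d r alpha eps CIi S G H N b : R) :
  0 <= S -> 0 <= G -> 0 <= H -> N <= CIi * S -> 0 < eps ->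
  d <= r - CIi / eps -> d <= 1 - r -> d <= alpha - eps ->
  2 * `|b| <= eps^-1 * N + eps * H ->
  d * (S + G + H) <= r * S + (1 - r) * G + alpha * H - b - b.
Proof.
move=> S0 G0 H0 NS e0 d1 d2 d3 hb.
have e1 : eps^-1 * N <= CIi / eps * S.
  by rewrite (mulrC CIi) -mulrA ler_wpM2l // invr_ge0 ltW.
have h1 := ler_wpM2r S0 d1; have h2 := ler_wpM2r G0 d2; have h3 := ler_wpM2r H0 d3.
have := ler_norm b; rewrite !mulrBl in h1 h2 h3; lra.
Qed.

(** [U], [G], [H], [S] are the squared norms in the energy, [F] and [Hg] those of the data, [N] that
    of the normal trace; [p], [b], [h] are the terms of the linear form. With the parameters [m^-1],
    [m], [m^-1], where [m = kE * T], the terms in the unknowns add up to at most half of the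
    energy. *)
Lemma energy_arith (kE CIi alpha U G H S F Hg N p b h : R) :
  0 < kE -> 0 <= CIi -> 0 <= alpha ->
  0 <= U -> 0 <= G -> 0 <= H -> 0 <= S -> 0 <= F -> 0 <= Hg ->
  N <= CIi * S ->
  (forall e, 0 < e -> 2 * `|p| <= e^-1 * F + e * U) ->
  (forall e, 0 < e -> 2 * `|b| <= e^-1 * N + e * Hg) ->
  (forall e, 0 < e -> 2 * `|h| <= e^-1 * Hg + e * H) ->
  U + G + H + S <= kE * (p - b + alpha * h) ->
  U + G + H + S <= kE * (kE * (1 + CIi + alpha)) * (1 + alpha) * (F + Hg).
Proof.
move=> k0 C0 a0 U0 G0 H0 S0 F0 Hg0 NS hp hb hh hE.
set T := 1 + CIi + alpha; have T0 : 0 < T by rewrite /T; lra.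
set m := kE * T; have m0 : 0 < m by rewrite mulr_gt0.
have mi : 0 < m^-1 by rewrite invr_gt0.
have := hp _ mi; have := hb _ m0; have := hh _ mi; rewrite !invrK => h1 h2 h3.
have b1 : kE * p <= kE * `|p| by rewrite ler_wpM2l ?ler_norm // ltW.
have b2 : kE * (- b) <= kE * `|b|.
  by rewrite ler_wpM2l ?(ltW k0) // -normrN ler_norm.
have b3 : kE * (alpha * h) <= kE * (alpha * `|h|).
  by rewrite ler_wpM2l ?(ltW k0) // ler_wpM2l // ler_norm.
have c1 := ler_wpM2l (ltW k0) h3; have c2 := ler_wpM2l (ltW k0) h2.
have c3 := ler_wpM2l (ltW k0) (ler_wpM2l a0 h1).
have kmi : kE * m^-1 * T = 1 by rewrite /m; field; rewrite !gt_eqF.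
have NS' := ler_wpM2l (ltW (mulr_gt0 k0 mi)) NS.
have kmi0 : 0 < kE * m^-1 by rewrite mulr_gt0.
have key : kE * m^-1 * (U + CIi * S + alpha * H) <= U + G + H + S.
  rewrite -[leRHS]mul1r -kmi -[leRHS]mulrA ler_pM2l // /T.
  have : 0 <= (CIi + alpha) * U + (1 + CIi + alpha) * G + (1 + CIi) * H + (1 + alpha) * S.
    by rewrite !addr_ge0 // mulr_ge0 // !addr_ge0.
  lra.
have last_le : kE * m * (F + (1 + alpha) * Hg) <= kE * m * ((1 + alpha) * (F + Hg)).
  apply: ler_wpM2l; first by rewrite mulr_ge0 // ltW.
  by have := mulr_ge0 a0 F0; lra.
clearbody m T; move: (m^-1) h1 h2 h3 b1 b2 b3 c1 c2 c3 key NS' mi kmi kmi0 => w h1 h2 h3 b1 b2 b3 c1 c2 c3 key NS' _ _ _.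
lra.
Qed.

End Arithmetic.

(** [Sp] is the weighted sum of squared coefficients of the multiplier and [T] the squared norm of
    the test field. All three products use the parameter [m], chosen so that the terms in [T] cost
    at most half of [Sp]. *)
Lemma multiplier_arith (R : realFieldType) (r CIi A Sp T N S H Hg b1 b2 q : R) :
  0 < r -> r <= 1 -> 0 <= CIi -> 0 < A -> 0 <= S ->
  T <= A * Sp -> N <= CIi * T ->
  (forall e, 0 < e -> 2 * `|b1| <= e^-1 * N + e * Hg) ->
  (forall e, 0 < e -> 2 * `|b2| <= e^-1 * N + e * H) ->
  (forall e, 0 < e -> 2 * `|q| <= e^-1 * T + e * S) ->
  Sp = - b1 - r * q + b2 ->
  Sp <= (2 * CIi + r) * A * (Hg + H + S).
Proof.
move=> r0 r1 C0 A0 S0 TA NT h1 h2 h3 E.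
have t0 : 0 < 2 * CIi + r by lra.
set m := (2 * CIi + r) * A; have m0 : 0 < m by rewrite mulr_gt0.
have mi : 0 < m^-1 by rewrite invr_gt0.
have mA : m^-1 * (2 * CIi + r) * A = 1 by rewrite -mulrA mulVf // gt_eqF.
have := h1 _ m0; have := h2 _ m0; have := h3 _ m0 => {}h3 {}h2 {}h1.
have q1 := ler_wpM2l (ltW r0) h3.
have n1 : - b1 <= `|b1| by rewrite -normrN ler_norm.
have n2 := ler_norm b2.
have n3 : r * (- q) <= r * `|q|.
  by rewrite ler_wpM2l ?(ltW r0) // -normrN ler_norm.
have mN := ler_wpM2l (ltW mi) NT.
have mT : m^-1 * (2 * CIi + r) * T <= Sp.
  have -> : Sp = m^-1 * (2 * CIi + r) * (A * Sp) by rewrite mulrA mA mul1r.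
  by apply: ler_wpM2l; rewrite // mulr_ge0 // ltW.
have mS : r * (m * S) <= m * S by rewrite ler_piMl // mulr_ge0 // ltW.
clearbody m; move: (m^-1) h1 h2 h3 q1 mN mT {mi mA} => w h1 h2 h3 q1 mN mT; lra.
Qed.

(** * Stability *)

Section Stability.
Context {R : realType} (Omega : set (R * R)) (M : mesh R).
Hypothesis hO : polygonal_domain Omega.
Hypothesis hT : triangulation Omega M.
Local Notation ip := (pair_int (leb2 R) Omega).
Local Notation sq := (sqint (leb2 R) Omega).
Local Notation mO := (measurable_Omega hO hT).
Implicit Types (k l : 'I_(nt M)) (i j : 'I_3) (x y : R * R) (u v w : R * R -> R).
Implicit Types (s t : R * R -> R * R) (d : 'I_(nv M) -> R).

Section Energy.
Variables (r alpha eps CI K : R).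
Hypothesis hCI0 : 0 < CI.
Hypothesis hCI : inverse_estimate Omega M CI.
Hypothesis he0 : 0 < eps.
Hypothesis hr0 : 0 < r.
Hypothesis hr1 : r < 1.
Hypothesis hre : CI^-1 < r * eps.
Hypothesis hea : eps < alpha.
Hypothesis hK : forall x, closure Omega x -> `|x.1| <= K /\ `|x.2| <= K.

(** The least of the margins left in the three coefficients after absorption; they are positive by
    [CI^-1 < r * eps], [r < 1] and [eps < alpha] respectively. *)
Definition coercivity_constant : R :=
  Num.min (r - CI^-1 / eps) (Num.min (1 - r) (alpha - eps)).

Lemma coercivity_constant_gt0 : 0 < coercivity_constant.
Proof. by rewrite /coercivity_constant !lt_min !subr_gt0 hr1 hea ltr_pdivrMr // hre. Qed.

Definition energy u s : R :=
  ip u u + ipv Omega (grad M u) (grad M u) + ip_half Omega M u u + ipv Omega s s.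

(** The numerator is the cost of adding the L2 norm of [u] by Friedrichs' inequality. *)
Definition energy_constant : R := (1 + 8 * K ^+ 2) / coercivity_constant.

Lemma energy_constant_gt0 : 0 < energy_constant.
Proof.
by apply: divr_gt0; [have := sqr_ge0 K; lra|exact: coercivity_constant_gt0].
Qed.

Lemma normal_norm_bound s : Lh Omega M s ->
  normal_norm_mhalf_sq Omega M s <= CI^-1 * ipv Omega s s.
Proof.
move=> hs; have := hCI hs; rewrite (L2vnorm_sq hO hT (sqv_Lh hO hT hs)) => h.
by rewrite -(ler_pM2l hCI0) mulrA divff ?mul1r ?gt_eqF.
Qed.

Lemma energy_bound u s : Vh Omega M u -> Lh Omega M s ->
  energy u s <= energy_constant * aform Omega M r alpha u s u s.
Proof.
move=> hu hs; set S := ipv Omega s s; set G := ipv Omega (grad M u) (grad M u).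
set H := ip_half Omega M u u.
have S0 : 0 <= S := ipv_ge0 _ _; have G0 : 0 <= G := ipv_ge0 _ _.
have H0 : 0 <= H := ip_half_ge0 hT _.
have c : coercivity_constant * (S + G + H) <= aform Omega M r alpha u s u s.
  rewrite /aform (int2_dot hO hT (sqv_Lh hO hT hs) (sqv_Lh hO hT hs)).
  rewrite (int2_dot hO hT (sqv_grad hO hT hu) (sqv_grad hO hT hu)).
  apply: (coercivity_arith (eps := eps) (CIi := CI^-1) (N := normal_norm_mhalf_sq Omega M s)) => //.
  - exact: normal_norm_bound.
  - by rewrite ge_min lexx.
  - by rewrite ge_min ge_min lexx orbT.
  - by rewrite ge_min ge_min lexx !orbT.
  - by apply: (bint_normal_young hT) => //; [exact: trv_Lh|exact: tr_Vh].
have f := friedrichs hO hT hu hK.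
have g1 : ip (fun x => (grad M u x).1) (fun x => (grad M u x).1) <= G.
  by rewrite /G /ipv lerDl pair_int_sqr_ge0.
have K2 : 0 <= K ^+ 2 := sqr_ge0 K.
have e1 : energy u s <= (1 + 8 * K ^+ 2) * (S + G + H).
  have k1 := ler_wpM2l K2 g1.
  have k2 := mulr_ge0 K2 S0; have k3 := mulr_ge0 K2 G0.
  rewrite /energy -/S -/G -/H; move: (K ^+ 2) (ip u u) (ip _ _) K2 f g1 k1 k2 k3.
  rewrite -/H; clearbody S G H; move=> *; lra.
apply: le_trans e1 _; rewrite /energy_constant -mulrA.
apply: ler_wpM2l; first by lra.
by rewrite mulrC ler_pdivlMr ?coercivity_constant_gt0 // mulrC.
Qed.

Section Multipliers.
Variables (muref : 'I_3 -> R * R -> R) (rho mu : 'I_(nv M) -> R * R -> R) (c : 'I_(nv M) -> R).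
Hypothesis hrho : nodal_basis Omega rho.
Hypothesis smu : forall n, sq (mu n).
Hypothesis hc : forall m n, int2 Omega (fun x => rho m x * mu n x) = c n * (m == n)%:R.
Hypothesis hmu1 : forall k x, otri k x -> \sum_n mu n x = 1.
Hypothesis hmus : forall k i x, oref x -> mu (tri k i) (refmap k x) = muref i x.
Hypothesis hmu0 : forall k n x, n \notin vset k -> otri k x -> mu n x = 0.
Hypothesis smuref : forall i, sqint (leb2 R) oref (muref i).

Definition lift d : R * R -> R := fun x => \sum_n d n * rho n x.

(** Product of the constants of [shape_bound] and [nodal_norm_bound], with [1] added for strict
    positivity. *)
Definition shape_constant (w : 'I_3 -> R * R -> R) : R :=
  3 * (\sum_i pair_int (leb2 R) oref (w i) (w i)) * 2 ^+ 8 + 1.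

Lemma shape_constant_gt0 (w : 'I_3 -> R * R -> R) : 0 < shape_constant w.
Proof.
rewrite ltr_wpDl // !mulr_ge0 ?exprn_ge0 // sumr_ge0 // => i _.
exact: pair_int_sqr_ge0.
Qed.

Lemma biorth_gt0 n : 0 < c n.
Proof. exact: (biorthogonal_gt0 hO hT hrho smu hc hmu1). Qed.

Lemma shape_constant_bound (W : 'I_(nv M) -> R * R -> R) (w : 'I_3 -> R * R -> R) d :
  (forall n, sq (W n)) ->
  (forall k i z, oref z -> W (tri k i) (refmap k z) = w i z) ->
  (forall k n x, n \notin vset k -> otri k x -> W n x = 0) ->
  (forall i, sqint (leb2 R) oref (w i)) ->
  ip (fun x => \sum_n d n * W n x) (fun x => \sum_n d n * W n x) <=
    shape_constant w * \sum_n c n * d n ^+ 2.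
Proof.
move=> sW Ww W0 sw; pose Kw := \sum_i pair_int (leb2 R) oref (w i) (w i).
have wK i : pair_int (leb2 R) oref (w i) (w i) <= Kw.
  rewrite /Kw (bigD1 i) //= lerDl sumr_ge0 // => j _; exact: pair_int_sqr_ge0.
have K0 : 0 <= Kw by apply: sumr_ge0 => i _; exact: pair_int_sqr_ge0.
apply: (le_trans (shape_bound hO hT d sW Ww W0 sw wK)).
have nb := nodal_norm_bound hO hT hrho smu hc hmu1 d.
have S0 : 0 <= \sum_n c n * d n ^+ 2.
  by apply: sumr_ge0 => n _; rewrite mulr_ge0 ?sqr_ge0 // ltW // biorth_gt0.
rewrite ler_pdivrMl ?exprn_gt0 // in nb.
have := ler_wpM2l K0 nb; rewrite /shape_constant -/Kw.
by move: S0; move: (nodal_norm_sq d) (\sum_n c n * _) (2 ^+ 8) => N X Q *; lra.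
Qed.

Lemma lift_bound d : ip (lift d) (lift d) <= shape_constant (@shp R) * \sum_n c n * d n ^+ 2.
Proof.
apply: shape_constant_bound.
- by move=> n; exact: (sqint_rho hO hT hrho).
- move=> k i z oz; rewrite (rho_refmap hT hrho) // (bigD1 i) //= eqxx mulr1 big1 ?addr0 // => j ji.
  by rewrite (inj_eq (tri_inj (jac0 hT k))) eq_sym (negbTE ji) mulr0.
- move=> k n x nk ox; rewrite (rho_elt hT hrho n (otri_sub_elt (jac0 hT k) ox)) big1 // => i _.
  case: eqP => [E|_]; last by rewrite mulr0.
  by case/negP: nk; rewrite E; exact: imset_f.
- exact: sqint_shp.
Qed.

Lemma Vh_lift d : Vh Omega M (lift d).
Proof. by apply: Vh_sum => n; apply: VhZ; exact: (Vh_rho hrho). Qed.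

Lemma sq_lift d : sq (lift d).
Proof. exact: (sqint_Vh hO hT (Vh_lift d)). Qed.

Lemma ip_rho_mu m n : ip (rho m) (mu n) = c n * (m == n)%:R.
Proof. exact: hc. Qed.

Lemma ip_lift_mu d n : ip (lift d) (mu n) = c n * d n.
Proof.
rewrite (pair_int_suml mO) => [|m _|]; last exact: smu; last first.
  by apply: (sqintZ mO); exact: (sqint_rho hO hT hrho).
rewrite (bigD1 n) //= big1 ?addr0 => [|m mn];
  rewrite (pair_intZl mO) ?ip_rho_mu //; try exact: (sqint_rho hO hT hrho).
  by rewrite eqxx mulr1 mulrC.
by rewrite (negbTE mn) !mulr0.
Qed.

Lemma sq_Qh q : Qh Omega mu q -> sq q.
Proof.
move=> [e qE]; apply: (eq_sqint mO (v := fun x => \sum_n e n * mu n x)).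
  by move=> x /set_mem Ox; rewrite qE.
by apply: (sqint_sum mO) => n _; apply: (sqintZ mO).
Qed.

Lemma sqv_Mh phi : Mh Omega mu phi -> sqv Omega phi.
Proof. by move=> [h1 h2]; split; exact: sq_Qh. Qed.

Lemma ip_Qh v (q : R * R -> R) (e : 'I_(nv M) -> R) : sq v ->
  (forall x, Omega x -> q x = \sum_n e n * mu n x) ->
  ip v q = \sum_n e n * ip v (mu n).
Proof.
move=> sv qE; rewrite pair_intC.
transitivity (ip (fun x => \sum_n e n * mu n x) v).
  by apply: eq_pair_int => // x /set_mem Ox; rewrite qE.
rewrite (pair_int_suml mO) // => [|n _]; last by apply: (sqintZ mO).
by apply: eq_bigr => n _; rewrite (pair_intZl mO) // pair_intC.
Qed.

Lemma Qh_bound (q : R * R -> R) (e : 'I_(nv M) -> R) :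
  (forall x, Omega x -> q x = \sum_n e n * mu n x) ->
  ip q q <= shape_constant muref * \sum_n c n * e n ^+ 2.
Proof.
move=> qE; rewrite (_ : ip q q = ip (fun x => \sum_n e n * mu n x) (fun x => \sum_n e n * mu n x)).
  exact: shape_constant_bound.
by apply: eq_pair_int => x /set_mem Ox; rewrite qE.
Qed.

Lemma ip_lift_Qh (q : R * R -> R) (e : 'I_(nv M) -> R) :
  (forall x, Omega x -> q x = \sum_n e n * mu n x) ->
  ip (lift e) q = \sum_n c n * e n ^+ 2.
Proof.
move=> qE; rewrite (ip_Qh (sq_lift e) qE); apply: eq_bigr => n _.
by rewrite ip_lift_mu expr2; ring.
Qed.

(** The constant delivered by [energy_arith]. Neither it nor the next one depends on the mesh or on
    [c]. *)
Definition stability_constant1 : R :=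
  energy_constant * (energy_constant * (1 + CI^-1 + alpha)) * (1 + alpha).

Definition stability_constant2 : R :=
  shape_constant muref *
  ((2 * CI^-1 + r) * shape_constant (@shp R) * (1 + stability_constant1)).

Lemma stability_constant1_gt0 : 0 < stability_constant1.
Proof.
have a0 : 0 < alpha := lt_trans he0 hea; have C0 : 0 < CI^-1 by rewrite invr_gt0.
have e0 := energy_constant_gt0.
have p1 : 0 < 1 + CI^-1 + alpha by apply: addr_gt0 => //; exact: addr_gt0.
have p2 : 0 < 1 + alpha by exact: addr_gt0.
by apply: mulr_gt0 => //; apply: mulr_gt0 => //; exact: mulr_gt0.
Qed.

Lemma stability_constant2_gt0 : 0 < stability_constant2.
Proof.
have C0 : 0 < CI^-1 by rewrite invr_gt0.
have p1 : 0 < 2 * CI^-1 + r by apply: addr_gt0 => //; exact: mulr_gt0.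
have p2 : 0 < 1 + stability_constant1 by rewrite addr_gt0 // stability_constant1_gt0.
apply: mulr_gt0; first exact: shape_constant_gt0.
by apply: mulr_gt0 => //; apply: mulr_gt0 => //; exact: shape_constant_gt0.
Qed.

Lemma lformE f gD v t : lform Omega M alpha f gD v t =
  ip f v - bint_normal Omega M t gD + alpha * ip_half Omega M gD v.
Proof. by []. Qed.

Lemma stability f gD u s phi : sq f -> tr Omega M gD ->
  solution Omega mu r alpha f gD u s phi ->
  energy u s <= stability_constant1 * (ip f f + ip_half Omega M gD gD) /\
  ipv Omega phi phi <= stability_constant2 * (ip f f + ip_half Omega M gD gD).
Proof.
move=> sf tg [hu hs hphi eq1 eq2].
have alpha0 : 0 <= alpha by apply: ltW; exact: lt_trans hea.
have CI0 : 0 <= CI^-1 by rewrite invr_ge0 ltW.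
have F0 : 0 <= ip f f := pair_int_sqr_ge0 _ _ _.
have G0 : 0 <= ip_half Omega M gD gD := ip_half_ge0 hT _.
(* Test with the solution itself: the second equation at [psi = phi] removes the multiplier. *)
have E1 : energy u s <= stability_constant1 * (ip f f + ip_half Omega M gD gD).
  apply: (energy_arith (N := normal_norm_mhalf_sq Omega M s) (p := ip f u)
    (b := bint_normal Omega M s gD) (h := ip_half Omega M gD u)) => //.
  - exact: energy_constant_gt0.
  - exact: pair_int_sqr_ge0.
  - exact: ipv_ge0.
  - exact: ip_half_ge0.
  - exact: ipv_ge0.
  - exact: normal_norm_bound.
  - by move=> e e0; apply: (pair_int_young_norm mO) => //; exact: (sqint_Vh hO hT).
  - by move=> e e0; apply: (bint_normal_young hT) => //; exact: trv_Lh.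
  - by move=> e e0; apply: (ip_half_young hT) => //; exact: tr_Vh.
  rewrite -lformE -(eq1 _ _ hu hs) (eq2 _ hphi) addr0.
  exact: energy_bound.
split => //.
have [[d1 q1] [d2 q2]] := hphi.
pose tau x : R * R := (lift d1 x, lift d2 x).
have ht : Lh Omega M tau by split; exact: Vh_lift.
pose Sp := \sum_n c n * d1 n ^+ 2 + \sum_n c n * d2 n ^+ 2.
have st := sqv_Lh hO hT ht; have sp := sqv_Mh hphi.
have V0 := Vh0 Omega M.
have bE : bform Omega M (fun=> 0) tau phi = Sp.
  rewrite (bformE hO hT V0 ht sp) /Sp -(ip_lift_Qh q1) -(ip_lift_Qh q2).
  have -> : ipv Omega (grad M (fun=> 0)) phi = 0.
    rewrite /ipv (_ : grad M (fun=> 0) = fun=> 0); last by apply/funext => x; exact: (grad0 hT).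
    have z1 : ip (fst \o (fun=> 0 : R * R)) (fst \o phi) = 0 := pair_int0l (leb2 R) mO _.
    have z2 : ip (snd \o (fun=> 0 : R * R)) (snd \o phi) = 0 := pair_int0l (leb2 R) mO _.
    by rewrite z1 z2 addr0.
  by rewrite subr0.
have tA : ipv Omega tau tau <= shape_constant (@shp R) * Sp.
  by rewrite /Sp mulrDr; apply: lerD; exact: lift_bound.
have pB : ipv Omega phi phi <= shape_constant muref * Sp.
  by rewrite /Sp mulrDr; apply: lerD; exact: Qh_bound.
(* The test pair is [(0, tau)], so every term with a factor [v] or its gradient drops out of the
   first equation. *)
have SE : Sp = - bint_normal Omega M tau gD - r * ipv Omega tau s + bint_normal Omega M tau u.
  have := eq1 _ _ V0 ht; rewrite bE lformE /aform.
  rewrite (int2_dot hO hT (sqv_Lh hO hT hs) st) (ipvC _ s).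
  have -> : int2 Omega (fun x => dot (grad M u x) (grad M (fun=> 0) x)) = 0.
    rewrite /int2 (@eq_Rintegral _ _ _ _ _ (fun=> 0)) ?Rintegral_cst ?mul0r //; first exact: mO.
    by move=> x _; rewrite (grad0 hT) /dot /= !mulr0 addr0.
  rewrite !(ip_half0r hT) bint_normal0r pair_intC (pair_int0l (leb2 R) mO).
  by move: (ipv _ _ _) (bint_normal _ _ tau u) (bint_normal _ _ tau gD) => *; lra.
have Sle : Sp <= (2 * CI^-1 + r) * shape_constant (@shp R) *
    (ip_half Omega M gD gD + ip_half Omega M u u + ipv Omega s s).
  apply: (multiplier_arith (N := normal_norm_mhalf_sq Omega M tau)
    (T := ipv Omega tau tau) _ _ _ _ _ _ _ _ _ _ SE) => //.
  - exact: ltW.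
  - exact: shape_constant_gt0.
  - exact: ipv_ge0.
  - exact: normal_norm_bound.
  - by move=> e e0; apply: (bint_normal_young hT) => //; exact: trv_Lh.
  - by move=> e e0; apply: (bint_normal_young hT) => //; [exact: trv_Lh|exact: tr_Vh].
  - by move=> e e0; exact: (ipv_young hO hT e0 st (sqv_Lh hO hT hs)).
have m0 : 0 < (2 * CI^-1 + r) * shape_constant (@shp R).
  apply: mulr_gt0; last exact: shape_constant_gt0.
  by apply: ltr_wpDl => //; exact: mulr_ge0.
have Ele : ip_half Omega M gD gD + ip_half Omega M u u + ipv Omega s s <=
    (1 + stability_constant1) * (ip f f + ip_half Omega M gD gD).
  have := pair_int_sqr_ge0 (leb2 R) Omega u; have := ipv_ge0 Omega (grad M u).
  move: E1; rewrite /energy; move: (stability_constant1) F0 G0.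
  move: (ip u u) (ip f f) (ip_half _ _ u u) (ip_half _ _ gD gD) (ipv _ s s) (ipv _ _ _).
  by move=> *; lra.
apply: le_trans pB _; rewrite /stability_constant2 -[leRHS]mulrA.
apply: ler_wpM2l; first exact/ltW/shape_constant_gt0.
apply: le_trans Sle _; rewrite -[leRHS]mulrA.
by apply: ler_wpM2l; first exact: ltW.
Qed.

End Multipliers.
End Energy.
End Stability.

(** A square system with trivial kernel is solvable. The transpose appears because vectors are rows
    acting from the left. *)
Lemma solve_injective (F : fieldType) n (A : 'I_n -> 'I_n -> F) (b : 'I_n -> F) :
  (forall d : 'I_n -> F, (forall i, \sum_j A i j * d j = 0) -> forall j, d j = 0) ->
  exists d : 'I_n -> F, forall i, \sum_j A i j * d j = b i.
Proof.
move=> inj; pose N : 'M[F]_n := \matrix_(j, i) A i j.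
have fN : row_free N.
  apply: inj_row_free => v vN; apply/rowP => j; rewrite mxE.
  apply: (inj (fun j => v 0 j)) => i.
  have E := congr1 (fun m : 'rV_n => m 0 i) vN; rewrite !mxE in E.
  by apply: etrans E; apply: eq_bigr => l _; rewrite mxE mulrC.
have uN : N \in unitmx by rewrite -row_free_unit.
pose w : 'rV[F]_n := \row_i b i; exists (fun j => (w *m invmx N) 0 j) => i.
have E := congr1 (fun m : 'rV_n => m 0 i) (mulmxKV uN w); rewrite mxE [RHS]mxE in E.
by apply: etrans E; apply: eq_bigr => l _; rewrite mulrC; congr (_ * _); rewrite mxE.
Qed.

Lemma lform_arith (R : comRingType) (c al a a' b b' h h' : R) :
  a + c * a' - (b + c * b') + al * (h + c * h') = a - b + al * h + c * (a' - b' + al * h').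
Proof. by ring. Qed.

Lemma comb_arith (R : comRingType) (a c x x' y y' : R) :
  x + a * x' + c * (y + a * y') = x + c * y + a * (x' + c * y').
Proof. by ring. Qed.

(** * Existence and uniqueness *)

Section Existence.
Context {R : realType} (Omega : set (R * R)) (M : mesh R).
Hypothesis hO : polygonal_domain Omega.
Hypothesis hT : triangulation Omega M.
Local Notation sq := (sqint (leb2 R) Omega).
Local Notation mO := (measurable_Omega hO hT).
Implicit Types (k l : 'I_(nt M)) (i j : 'I_3) (x y : R * R) (u v w : R * R -> R).
Implicit Types (s t : R * R -> R * R) (d : 'I_(nv M) -> R).

(** Linearity relative to the predicates [Vh] and [Lh], together with dependence on the values on
    [closure Omega] only; the second half is what makes expansions in a basis usable. *)
Definition linear_form (L : (R * R -> R) -> (R * R -> R * R) -> R) : Prop :=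
  (forall v v' t t' (c : R), Vh Omega M v -> Vh Omega M v' ->
    Lh Omega M t -> Lh Omega M t' ->
    L (fun x => v x + c * v' x) (fun x => t x + c *: t' x) = L v t + c * L v' t') /\
  (forall v v' t t', Vh Omega M v -> Vh Omega M v' -> Lh Omega M t -> Lh Omega M t' ->
    (forall x, closure Omega x -> v x = v' x) ->
    (forall x, closure Omega x -> t x = t' x) -> L v t = L v' t').

Lemma Lh0 : Lh Omega M (fun=> 0).
Proof. by split; exact: Vh0. Qed.

Lemma linear_form0 L : linear_form L -> L (fun=> 0) (fun=> 0) = 0.
Proof.
move=> [lin ext]; have V0 := Vh0 Omega M; have L0 := Lh0.
have := lin _ _ _ _ 1 V0 V0 L0 L0.
rewrite (ext _ (fun=> 0) _ (fun=> 0)) //; first by move=> h; lra.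
- by apply: VhD => //; exact: VhZ.
- exact: Lh_lin.
- by move=> x _; rewrite mulr0 addr0.
- by move=> x _; rewrite scaler0 addr0.
Qed.

Lemma Lh_sum (I : Type) (r : seq I) (d : I -> R) (T : I -> R * R -> R * R) :
  (forall n, Lh Omega M (T n)) -> Lh Omega M (fun x => \sum_(n <- r) d n *: T n x).
Proof.
move=> hT'; split.
  have -> : (fun x => (\sum_(n <- r) d n *: T n x).1) = fun x => \sum_(n <- r) d n * (T n x).1.
    by apply/funext => x; rewrite sum_fst.
  by apply: Vh_sum => n; apply: VhZ; case: (hT' n).
have -> : (fun x => (\sum_(n <- r) d n *: T n x).2) = fun x => \sum_(n <- r) d n * (T n x).2.
  by apply/funext => x; rewrite sum_snd.
by apply: Vh_sum => n; apply: VhZ; case: (hT' n).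
Qed.

Lemma linear_form_sum L (I : Type) (r : seq I) (d : I -> R)
    (V : I -> R * R -> R) (T : I -> R * R -> R * R) : linear_form L ->
  (forall n, Vh Omega M (V n)) -> (forall n, Lh Omega M (T n)) ->
  L (fun x => \sum_(n <- r) d n * V n x) (fun x => \sum_(n <- r) d n *: T n x) =
  \sum_(n <- r) d n * L (V n) (T n).
Proof.
move=> hL hV hT'; elim: r => [|n r IH].
  rewrite big_nil -[RHS](linear_form0 hL).
  by congr (L _ _); apply/funext => x; rewrite big_nil.
rewrite big_cons -IH addrC -hL.1 //; last 2 first.
- by apply: Vh_sum => m; exact: VhZ.
- exact: Lh_sum.
by congr (L _ _); apply/funext => x; rewrite big_cons addrC.
Qed.

Lemma linear_form_aform (r alpha : R) u s : Vh Omega M u -> Lh Omega M s ->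
  linear_form (aform Omega M r alpha u s).
Proof.
move=> hu hs; split=> [v v' t t' c hv hv' ht ht'|v v' t t' hv hv' ht ht' vE tE].
  by rewrite (aformC hT) (aform_lin hO hT) // !(aformC hT _ _ u).
by apply: (eq_aform hT).
Qed.

Lemma linear_form_bform psi : sqv Omega psi ->
  linear_form (fun v t => bform Omega M v t psi).
Proof.
move=> hp; split=> [v v' t t' c hv hv' ht ht'|v v' t t' hv hv' ht ht' vE tE].
  have hvv : Vh Omega M (fun x => v x + c * v' x) by apply: VhD => //; exact: VhZ.
  rewrite !(bformE hO hT) //; last exact: Lh_lin.
  have -> : grad M (fun x => v x + c * v' x) = fun x => grad M v x + c *: grad M v' x.
    by apply/funext => x; exact: (grad_lin hT).
  rewrite !(ipv_lin hO hT) //; try exact: (sqv_Lh hO hT); try exact: (sqv_grad hO hT).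
  by rewrite mulrBr opprD addrACA.
rewrite /bform (grad_ext hT hv hv' vE); apply: eq_Rintegral => x /set_mem Ox.
by rewrite tE //; exact: subset_closure.
Qed.

Lemma linear_form_lform (alpha : R) f gD : sq f -> tr Omega M gD ->
  linear_form (lform Omega M alpha f gD).
Proof.
move=> sf tg; split=> [v v' t t' c hv hv' ht ht'|v v' t t' hv hv' ht ht' vE tE].
  have sv := sqint_Vh hO hT hv; have sv' := sqint_Vh hO hT hv'.
  rewrite !lformE bint_normal_lin1 //; try exact: (trv_Lh hT).
  rewrite !(ip_halfC hT gD) (ip_half_lin hT) //; try exact: (tr_Vh hT).
  rewrite !(pair_intC _ _ f) (pair_intDl mO sv (sqintZ mO c sv') sf) (pair_intZl mO c sv' sf).
  exact: lform_arith.
have eE k i (p : R) : 0 <= p <= 1 -> closure Omega (epar k i p).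
  by move=> p01; exact: (elt_sub_closure hT (epar_elt hT k i p01)).
rewrite !lformE; congr (_ - _ + _ * _).
- by apply: eq_pair_int => // x /set_mem Ox; apply: vE; exact: subset_closure.
- rewrite !bint_normalE; apply: eq_bigr => k _; apply: eq_bigr => i _; congr (_ * _).
  apply: eq_pair_int => // p /set_mem; rewrite /= in_itv /= => p01.
  by rewrite /sn tE //; exact: eE.
- rewrite !(ip_halfE hT); apply: eq_bigr => k _; apply: eq_bigr => i _.
  apply: eq_pair_int => // p /set_mem; rewrite /= in_itv /= => p01.
  by rewrite /= vE //; exact: eE.
Qed.

Lemma linear_form_comb L1 L2 (c : R) : linear_form L1 -> linear_form L2 ->
  linear_form (fun v t => L1 v t + c * L2 v t).
Proof.
move=> [l1 e1] [l2 e2]; split=> [v v' t t' a hv hv' ht ht'|v v' t t' hv hv' ht ht' vE tE].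
  by rewrite l1 // l2 //; exact: comb_arith.
by rewrite (e1 v v' t t') // (e2 v v' t t').
Qed.

Section Basis.
Variables (rho : 'I_(nv M) -> R * R -> R) (S : 'I_(nv M) -> R * R -> R * R).
Hypothesis hrho : nodal_basis Omega rho.
Hypothesis hS : forall n, Lh Omega M (S n).

(** The three families span the product space for any choice of [S]: subtracting from [t] the
    combination of the [S n] with the nodal values of [v] leaves a field that expands
    coordinatewise. For [S := proj_grad] the first family lies in the kernel of [b], and the other
    two determine the multiplier. *)
Lemma linear_form_eq0 L : linear_form L ->
  (forall n, L (rho n) (S n) = 0) ->
  (forall n, L (fun=> 0) (fun x => (rho n x, 0)) = 0) ->
  (forall n, L (fun=> 0) (fun x => (0, rho n x)) = 0) ->
  forall v t, Vh Omega M v -> Lh Omega M t -> L v t = 0.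
Proof.
move=> hL h1 h2 h3 v t hv ht.
have V0 := Vh0 Omega M; have hr n := Vh_rho hrho n.
pose d (n : 'I_(nv M)) := v (vtx n); pose Sd x := \sum_n d n *: S n x.
have hSd : Lh Omega M Sd by exact: Lh_sum.
pose t' x := t x + (-1) *: Sd x.
have ht' : Lh Omega M t' by exact: Lh_lin.
pose e1 (n : 'I_(nv M)) := (t' (vtx n)).1; pose e2 (n : 'I_(nv M)) := (t' (vtx n)).2.
pose A n x : R * R := (rho n x, 0); pose B n x : R * R := (0, rho n x).
have hA n : Lh Omega M (A n) by split; [exact: hr|exact: V0].
have hB n : Lh Omega M (B n) by split; [exact: V0|exact: hr].
have s1 := linear_form_sum (index_enum _) d hL hr hS.
have s2 := linear_form_sum (index_enum _) e1 hL (fun=> V0) hA.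
have s3 := linear_form_sum (index_enum _) e2 hL (fun=> V0) hB.
have z0 (e : 'I_(nv M) -> R) x : \sum_n e n * (fun=> 0 : R) x = 0.
  by rewrite big1 // => n _; rewrite mulr0.
have L2 : L (fun=> 0) (fun x => \sum_n e1 n *: A n x) = 0.
  transitivity (\sum_n e1 n * L (fun=> 0) (A n)); last first.
    by rewrite big1 // => n _; rewrite h2 mulr0.
  by rewrite -s2; congr (L _ _); apply/funext => x; rewrite z0.
have L3 : L (fun=> 0) (fun x => \sum_n e2 n *: B n x) = 0.
  transitivity (\sum_n e2 n * L (fun=> 0) (B n)); last first.
    by rewrite big1 // => n _; rewrite h3 mulr0.
  by rewrite -s3; congr (L _ _); apply/funext => x; rewrite z0.
have L1 : L (fun x => \sum_n d n * rho n x) Sd = 0.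
  by rewrite s1 big1 // => n _; rewrite h1 mulr0.
have hAA : Lh Omega M (fun x => \sum_n e1 n *: A n x) by exact: Lh_sum.
have hBB : Lh Omega M (fun x => \sum_n e2 n *: B n x) by exact: Lh_sum.
have L4 := hL.1 _ _ _ _ 1 V0 V0 hAA hBB.
have hrd : Vh Omega M (fun x => \sum_n d n * rho n x) by apply: Vh_sum => n; exact: VhZ.
have V00 : Vh Omega M (fun x => 0 + 1 * 0) by apply: VhD => //; exact: VhZ.
have L5 := hL.1 _ _ _ _ 1 hrd V00 hSd (Lh_lin 1 hAA hBB).
rewrite L4 L2 L3 L1 in L5.
transitivity (0 + 1 * (0 + 1 * 0) : R); last by rewrite !(mulr0, addr0).
rewrite -L5; apply: hL.2 => //.
- by apply: VhD => //; exact: VhZ.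
- by apply: Lh_lin => //; exact: Lh_lin.
- by move=> x Ox; rewrite mulr0 addr0 mulr0 addr0 (Vh_expand hT hrho hv).
move=> x Ox; rewrite !scale1r.
have -> : t x = Sd x + t' x by rewrite /t' scaleN1r addrC subrK.
congr (_ + _); apply: pairE.
  rewrite [LHS](Vh_expand hT hrho ht'.1 Ox).
  transitivity ((\sum_n e1 n *: A n x).1 + (\sum_n e2 n *: B n x).1) => //.
  rewrite !sum_fst [X in _ = _ + X]big1 ?addr0 // => n _; exact: mulr0.
rewrite [LHS](Vh_expand hT hrho ht'.2 Ox).
transitivity ((\sum_n e1 n *: A n x).2 + (\sum_n e2 n *: B n x).2) => //.
by rewrite !sum_snd [X in _ = X + _]big1 ?add0r // => n _; exact: mulr0.
Qed.

End Basis.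
End Existence.

(** * The reduced system on the kernel of the constraint, and uniqueness *)

Section WellPosed.
Context {R : realType} (Omega : set (R * R)) (M : mesh R).
Hypothesis hO : polygonal_domain Omega.
Hypothesis hT : triangulation Omega M.
Local Notation ip := (pair_int (leb2 R) Omega).
Local Notation sq := (sqint (leb2 R) Omega).
Local Notation mO := (measurable_Omega hO hT).
Implicit Types (k l : 'I_(nt M)) (i j : 'I_3) (x y : R * R) (u v w : R * R -> R).
Implicit Types (s t : R * R -> R * R) (d : 'I_(nv M) -> R).
Variables (r alpha eps CI K : R).
Hypothesis hCI0 : 0 < CI.
Hypothesis hCI : inverse_estimate Omega M CI.
Hypothesis he0 : 0 < eps.
Hypothesis hr0 : 0 < r.
Hypothesis hr1 : r < 1.
Hypothesis hre : CI^-1 < r * eps.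
Hypothesis hea : eps < alpha.
Hypothesis hK : forall x, closure Omega x -> `|x.1| <= K /\ `|x.2| <= K.
Variables (muref : 'I_3 -> R * R -> R) (rho mu : 'I_(nv M) -> R * R -> R) (c : 'I_(nv M) -> R).
Hypothesis hrho : nodal_basis Omega rho.
Hypothesis smu : forall n, sq (mu n).
Hypothesis hc : forall m n, int2 Omega (fun x => rho m x * mu n x) = c n * (m == n)%:R.
Hypothesis hmu1 : forall k x, otri k x -> \sum_n mu n x = 1.
Hypothesis hmus : forall k i x, oref x -> mu (tri k i) (refmap k x) = muref i x.
Hypothesis hmu0 : forall k n x, n \notin vset k -> otri k x -> mu n x = 0.
Hypothesis smuref : forall i, sqint (leb2 R) oref (muref i).

Lemma c_neq0 n : c n != 0.
Proof. by rewrite gt_eqF // (biorth_gt0 hO hT hrho smu hc hmu1). Qed.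

(* The quasi-projection of the gradient of a basis function, so that the pairs
   [(rho n, proj_grad n)] span the kernel of the form [b]. *)
Definition proj_grad (n : 'I_(nv M)) (x : R * R) : R * R :=
  (lift rho (fun m => ip (fun y => (grad M (rho n) y).1) (mu m) / c m) x,
   lift rho (fun m => ip (fun y => (grad M (rho n) y).2) (mu m) / c m) x).

Lemma Lh_proj_grad n : Lh Omega M (proj_grad n).
Proof. by split; exact: (Vh_lift hrho). Qed.

Lemma bform_proj_grad n psi : Mh Omega mu psi -> bform Omega M (rho n) (proj_grad n) psi = 0.
Proof.
move=> hp; have sp := sqv_Mh hO hT smu hp; have hr := Vh_rho hrho n.
rewrite (bformE hO hT hr (Lh_proj_grad n) sp); apply/eqP; rewrite subr_eq0; apply/eqP.
case: hp => -[e1 q1] [e2 q2].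
have [g1 g2] := sqv_grad hO hT hr; have [p1 p2] := sqv_Lh hO hT (Lh_proj_grad n).
rewrite /ipv (ip_Qh hO hT smu p1 q1) (ip_Qh hO hT smu p2 q2).
rewrite (ip_Qh hO hT smu g1 q1) (ip_Qh hO hT smu g2 q2).
by congr (_ + _); apply: eq_bigr => m _; congr (_ * _);
  rewrite (ip_lift_mu hO hT hrho smu hc) mulrC mulfVK // c_neq0.
Qed.

Lemma zero_energy v s : Vh Omega M v -> Lh Omega M s ->
  energy Omega M v s <= 0 -> ip v v = 0 /\ ipv Omega s s = 0.
Proof.
rewrite /energy => _ _.
have h1 := pair_int_sqr_ge0 (leb2 R) Omega v; have h2 := ipv_ge0 Omega (grad M v).
have h3 := ip_half_ge0 hT v; have h4 := ipv_ge0 Omega s.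
by move: (ip v v) (ipv _ _ _) (ip_half _ _ _ _) (ipv _ s s) h1 h2 h3 h4 => *; split; lra.
Qed.

(** Pairing with [mu n] isolates [c n * d n]. Zero norm thus kills all coefficients, which yields
    vanishing at every point and not merely almost everywhere. *)
Lemma lift_eq0 d : ip (lift rho d) (lift rho d) = 0 -> forall n, d n = 0.
Proof.
move=> h0 n; have := pair_int_eq0 mO (sq_lift hO hT hrho d) (smu n) h0.
rewrite (ip_lift_mu hO hT hrho smu hc) => /eqP.
by rewrite mulf_eq0 (negbTE (c_neq0 n)) => /eqP.
Qed.

Lemma Vh_eq0 v : Vh Omega M v -> ip v v = 0 -> forall x, closure Omega x -> v x = 0.
Proof.
move=> hv v0 x Ox; rewrite (Vh_expand hT hrho hv Ox) big1 // => n _.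
rewrite (lift_eq0 (d := fun n => v (vtx n))) ?mul0r // -[RHS]v0.
by apply: eq_pair_int => y /set_mem/subset_closure Oy; rewrite [RHS](Vh_expand hT hrho hv Oy).
Qed.

Lemma Qh_eq0 q : Qh Omega mu q -> ip q q = 0 -> forall x, Omega x -> q x = 0.
Proof.
move=> hq q0 x Ox; have sq_q := sq_Qh hO hT smu hq; case: hq => e qE.
rewrite qE // big1 // => n _.
have := pair_int_eq0 mO sq_q (sqint_rho hO hT hrho n) q0.
rewrite pair_intC (ip_Qh hO hT smu (sqint_rho hO hT hrho n) qE).
rewrite (bigD1 n) //= big1 ?addr0 => [|m mn]; rewrite (ip_rho_mu hc).
  by rewrite eqxx mulr1 => /eqP; rewrite mulf_eq0 (negbTE (c_neq0 n)) orbF => /eqP ->; rewrite mul0r.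
by rewrite eq_sym (negbTE mn) !mulr0.
Qed.

Lemma ipv_eq0 s : ipv Omega s s = 0 -> ip (fst \o s) (fst \o s) = 0 /\ ip (snd \o s) (snd \o s) = 0.
Proof.
rewrite /ipv; have h1 := pair_int_sqr_ge0 (leb2 R) Omega (fst \o s).
have h2 := pair_int_sqr_ge0 (leb2 R) Omega (snd \o s).
by move: (ip _ _) (ip (snd \o s) _) h1 h2 => a b *; split; lra.
Qed.

Lemma existence f gD : sq f -> tr Omega M gD ->
  exists u s phi, solution Omega mu r alpha f gD u s phi.
Proof.
move=> sf tg; have V0 := Vh0 Omega M; have hr n := Vh_rho hrho n.
pose a u s v t := aform Omega M r alpha u s v t.
pose ell v t := lform Omega M alpha f gD v t.
pose su d x := \sum_n d n *: proj_grad n x.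
have hsu d : Lh Omega M (su d) by apply: Lh_sum; exact: Lh_proj_grad.
have hu d : Vh Omega M (lift rho d) := Vh_lift hrho d.
have lina u s : Vh Omega M u -> Lh Omega M s -> linear_form Omega M (a u s).
  by move=> h1 h2; exact: (linear_form_aform hO hT).
have aS d v t : Vh Omega M v -> Lh Omega M t ->
    a v t (lift rho d) (su d) = \sum_n d n * a v t (rho n) (proj_grad n).
  by move=> hv ht; exact: (linear_form_sum _ _ (lina _ _ hv ht) hr Lh_proj_grad).
have aE d v t : Vh Omega M v -> Lh Omega M t ->
    a (lift rho d) (su d) v t = \sum_n a v t (rho n) (proj_grad n) * d n.
  move=> hv ht; rewrite {1}/a (aformC hT) -/(a _ _ _ _) aS //.
  by apply: eq_bigr => n _; rewrite mulrC.
(* Galerkin system on the kernel of [b]. A homogeneous solution has zero value under [a], hence zero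
   energy by coercivity, hence zero coefficients. *)
have [d dE] : exists d, forall n,
    \sum_m a (rho n) (proj_grad n) (rho m) (proj_grad m) * d m = ell (rho n) (proj_grad n).
  apply: solve_injective => d h.
  apply: lift_eq0.
  have z : a (lift rho d) (su d) (lift rho d) (su d) = 0.
    rewrite (aS _ _ _ (hu d) (hsu d)).
    by rewrite big1 // => n _; rewrite aE ?h ?mulr0 //; exact: Lh_proj_grad.
  have := energy_bound hO hT hCI0 hCI he0 hr1 hre hea hK (hu d) (hsu d).
  by rewrite -/(a _ _ _ _) z mulr0 => /(zero_energy (hu d) (hsu d)) [].
pose u := lift rho d; pose s := su d.
(* Biorthogonality makes [b] diagonal on these test fields, so each coefficient is the residual of
   the first equation divided by [c n]. *)
pose e1 n := (ell (fun=> 0) (fun x => (rho n x, 0)) - a u s (fun=> 0) (fun x => (rho n x, 0))) / c n.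
pose e2 n := (ell (fun=> 0) (fun x => (0, rho n x)) - a u s (fun=> 0) (fun x => (0, rho n x))) / c n.
pose phi x : R * R := (\sum_n e1 n * mu n x, \sum_n e2 n * mu n x).
have hphi : Mh Omega mu phi by split; [exists e1|exists e2].
have sp := sqv_Mh hO hT smu hphi.
exists u, s, phi; split => //; [exact: hu|exact: hsu| |].
- move=> v t hv ht; apply/eqP; rewrite -subr_eq0 -mulN1r; apply/eqP.
  have L1 := linear_form_comb 1 (lina u s (hu d) (hsu d)) (linear_form_bform hO hT sp).
  have L2 := linear_form_comb (-1) L1 (linear_form_lform hO hT alpha sf tg).
  (* The residual is a linear form. It vanishes on the kernel family by the choice of [d], and on
     the other two by the choice of [e1] and [e2]. *)
  have : (fun v t => a u s v t + 1 * bform Omega M v t phi + -1 * ell v t) v t = 0.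
    have sr n := sqint_rho hO hT hrho n.
    have z1 w : ip (fun=> 0) w = 0 := pair_int0l (leb2 R) mO w.
    have z2 psi : ipv Omega (grad M (fun=> 0)) psi = 0.
      rewrite /ipv (_ : grad M (fun=> 0) = fun=> 0); last by apply/funext => x; exact: (grad0 hT).
      by rewrite -[RHS]addr0; congr (_ + _); exact: z1.
    apply: (linear_form_eq0 hT hrho Lh_proj_grad L2 _ _ _ hv ht) => n /=.
    + rewrite bform_proj_grad // mulr0 addr0 mulN1r.
      have -> := aE d _ _ (hr n) (Lh_proj_grad n).
      by rewrite dE subrr.
    + have hA : Lh Omega M (fun x => (rho n x, 0)) by split; [exact: hr|exact: V0].
      rewrite (bformE hO hT V0 hA sp) z2 subr0 mul1r.
      have -> : ipv Omega (fun x => (rho n x, 0)) phi = ip (rho n) (fst \o phi).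
        by rewrite -[RHS]addr0; congr (_ + _); exact: z1.
      rewrite (@ip_Qh _ _ _ hO hT _ smu _ _ e1 (sr n)) // (bigD1 n) //= big1 ?addr0 => [|m mn].
        by rewrite (ip_rho_mu hc) eqxx mulr1 /e1 mulfVK ?c_neq0 // mulN1r (addrC (a u s _ _)) subrK subrr.
      by rewrite (ip_rho_mu hc) eq_sym (negbTE mn) !mulr0.
    + have hA : Lh Omega M (fun x => (0, rho n x)) by split; [exact: V0|exact: hr].
      rewrite (bformE hO hT V0 hA sp) z2 subr0 mul1r.
      have -> : ipv Omega (fun x => (0, rho n x)) phi = ip (rho n) (snd \o phi).
        by rewrite -[RHS]add0r; congr (_ + _); exact: z1.
      rewrite (@ip_Qh _ _ _ hO hT _ smu _ _ e2 (sr n)) // (bigD1 n) //= big1 ?addr0 => [|m mn].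
        by rewrite (ip_rho_mu hc) eqxx mulr1 /e2 mulfVK ?c_neq0 // mulN1r (addrC (a u s _ _)) subrK subrr.
      by rewrite (ip_rho_mu hc) eq_sym (negbTE mn) !mulr0.
  by rewrite /= mul1r.
move=> psi hpsi; have spsi := sqv_Mh hO hT smu hpsi.
rewrite (linear_form_sum _ _ (linear_form_bform hO hT spsi) hr Lh_proj_grad).
by rewrite big1 // => n _; rewrite bform_proj_grad // mulr0.
Qed.

Lemma solution_sub f gD u u' s s' phi phi' : sq f -> tr Omega M gD ->
  solution Omega mu r alpha f gD u s phi -> solution Omega mu r alpha f gD u' s' phi' ->
  solution Omega mu r alpha (fun=> 0) (fun=> 0) (fun x => u x + (-1) * u' x)
    (fun x => s x + (-1) *: s' x) (fun x => phi x + (-1) *: phi' x).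
Proof.
move=> sf tg [hu hs hp e1 e2] [hu' hs' hp' e1' e2'].
have sp := sqv_Mh hO hT smu hp; have sp' := sqv_Mh hO hT smu hp'.
split.
- by apply: VhD => //; exact: VhZ.
- exact: Lh_lin.
- move: hp hp' => [[a1 q1] [a2 q2]] [[a1' q1'] [a2' q2']]; split.
    exists (fun n => a1 n - a1' n) => x Ox; rewrite /= q1 // q1' // /GRing.scale /= mulN1r.
    by rewrite -sumrB; apply: eq_bigr => n _; rewrite mulrBl.
  exists (fun n => a2 n - a2' n) => x Ox; rewrite /= q2 // q2' // /GRing.scale /= mulN1r.
  by rewrite -sumrB; apply: eq_bigr => n _; rewrite mulrBl.
- move=> v t hv ht; have := e1 _ _ hv ht; have := e1' _ _ hv ht.
  rewrite (aform_lin hO hT) // !(bformE hO hT hv ht) //; last exact: (sqv_lin hO hT).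
  rewrite !(ipvC _ _ (fun x => phi x + _)) !(ipv_lin hO hT) //; try exact: (sqv_Lh hO hT); try exact: (sqv_grad hO hT).
  rewrite !(ipvC _ _ t) !(ipvC _ _ (grad M v)).
  have -> : lform Omega M alpha (fun=> 0) (fun=> 0) v t = 0.
    rewrite lformE bint_normal0r (ip_halfC hT) (ip_half0r hT) mulr0 addr0 subr0.
    exact: (pair_int0l _ mO).
  move: (lform _ _ _ _ _ _ _) (aform _ _ _ _ u _ _ _) (aform _ _ _ _ u' _ _ _).
  move: (ipv _ t phi) (ipv _ t phi') (ipv _ (grad M v) phi) (ipv _ (grad M v) phi').
  by move=> *; lra.
- move=> psi hpsi; have spsi := sqv_Mh hO hT smu hpsi.
  have := (linear_form_bform hO hT spsi).1 _ _ _ _ (-1) hu hu' hs hs' => ->.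
  by rewrite e2 // e2' // mulr0 addr0.
Qed.

(** The difference solves the problem with zero data, so stability makes its norms vanish, and
    biorthogonality turns this into pointwise equality. *)
Lemma uniqueness f gD u u' s s' phi phi' : sq f -> tr Omega M gD ->
  solution Omega mu r alpha f gD u s phi -> solution Omega mu r alpha f gD u' s' phi' ->
  forall x, Omega x -> [/\ u x = u' x, s x = s' x & phi x = phi' x].
Proof.
move=> sf tg h h'; have hd := solution_sub sf tg h h'.
have s0 : sq (fun=> 0) := sqint0 _ mO.
have t0 : tr Omega M (fun=> 0) by apply: (tr_Vh hT); exact: Vh0.
have [E1 E2] := stability hO hT hCI0 hCI he0 hr0 hr1 hre hea hK hrho smu hc hmu1 hmus hmu0 smuref s0 t0 hd.
case: (hd) => hU hS [hP1 hP2] _ _.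
rewrite (pair_int0l _ mO) (ip_half0r hT) addr0 !mulr0 in E1 E2.
have [U0 S0] := zero_energy hU hS E1.
have [S1 S2] := ipv_eq0 S0.
have /ipv_eq0 [P1 P2] : ipv Omega (fun x => phi x + (-1) *: phi' x) (fun x => phi x + (-1) *: phi' x) = 0.
  by apply/eqP; rewrite eq_le E2 ipv_ge0.
move=> x Ox; have cx := subset_closure Ox.
have cancel (a b : R) : a + -1 * b = 0 -> a = b by move=> ?; lra.
split.
- exact/cancel/(Vh_eq0 hU U0 cx).
- by apply: pairE; apply: cancel; [exact: (Vh_eq0 hS.1 S1 cx)|exact: (Vh_eq0 hS.2 S2 cx)].
- by apply: pairE; apply: cancel; [exact: (Qh_eq0 hP1 P1 Ox)|exact: (Qh_eq0 hP2 P2 Ox)].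
Qed.

(** The factor 2 comes from [norm_1h] being a sum of two norms, squared here. *)
Lemma norm_VL_bound u s : Vh Omega M u -> Lh Omega M s ->
  norm_VL Omega M u s ^+ 2 <= 2 * energy Omega M u s.
Proof.
move=> hu hs.
rewrite /norm_VL sqr_sqrtr ?addr_ge0 ?sqr_ge0 // (L2vnorm_sq hO hT (sqv_Lh hO hT hs)).
have h1 : norm_H1 Omega M u ^+ 2 = ip u u + ipv Omega (grad M u) (grad M u).
  rewrite /norm_H1 sqr_sqrtr ?addr_ge0 ?sqr_ge0 // L2norm_sq.
  by rewrite (L2vnorm_sq hO hT (sqv_grad hO hT hu)).
have h2 : norm_half Omega M u ^+ 2 = ip_half Omega M u u.
  by rewrite /norm_half sqr_sqrtr // (ip_half_ge0 hT).
have h3 := ipv_ge0 Omega s.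
rewrite /norm_1h /energy -h1 -h2; have := sqr_ge0 (norm_H1 Omega M u - norm_half Omega M u).
by move: (norm_H1 _ _ _) (norm_half _ _ _) (ipv _ s s) h3 => a b q *; nra.
Qed.

Lemma tr_Hhalf g : Hhalf Omega M g -> tr Omega M g.
Proof.
move=> [h _] k i bi; have [m1 m2] := h k i bi.
by apply/sqintP => //; exact: measurable_itv.
Qed.

End WellPosed.

(** * From squared estimates to norms, and the theorem *)

Lemma le_sqrt_mul (R : rcfType) (a c X : R) : 0 <= a -> 0 <= c -> 0 <= X ->
  a ^+ 2 <= c * X ^+ 2 -> a <= Num.sqrt c * X.
Proof.
move=> a0 c0 X0 h; rewrite -[a]ger0_norm // -sqrtr_sqr -[X]ger0_norm // -sqrtr_sqr.
by rewrite -sqrtrM // ler_sqrt // mulr_ge0 // sqr_ge0.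
Qed.

Theorem theorem1 (R : realType) (Omega : set (R * R))
    (hOmega : polygonal_domain Omega)
    (Th : set (mesh R))
    (hTh : forall M, Th M -> triangulation Omega M)
    (hqu : quasi_uniform Th)
    (muref : 'I_3 -> R * R -> R)
    (hmuref : forall i, L2 (@ref_triangle R) (muref i))
    (CI : R) (hCI0 : 0 < CI)
    (hCI : forall M, Th M -> inverse_estimate Omega M CI)
    (r alpha : R) (hr : 0 < r < 1)
    (halpha : exists2 eps : R, 0 < eps & CI^-1 < r * eps < eps /\ eps < alpha) :
  exists2 C : R, 0 < C &
    forall M : mesh R, Th M ->
    forall rho mu : 'I_(nv M) -> R * R -> R,
    nodal_basis Omega rho -> biorthogonal_basis Omega muref rho mu ->
    forall f gD : R * R -> R, L2 Omega f -> Hhalf Omega M gD ->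
    [/\ exists (u : R * R -> R) (s phi : R * R -> R * R),
          solution Omega mu r alpha f gD u s phi,
        forall (u u' : R * R -> R) (s s' phi phi' : R * R -> R * R),
          solution Omega mu r alpha f gD u s phi ->
          solution Omega mu r alpha f gD u' s' phi' ->
          forall x, Omega x -> [/\ u x = u' x, s x = s' x & phi x = phi' x] &
        forall (u : R * R -> R) (s phi : R * R -> R * R),
          solution Omega mu r alpha f gD u s phi ->
          norm_VL Omega M u s + L2vnorm Omega phi <=
            C * (L2norm Omega f + norm_half Omega M gD)].
Proof.
(* The box is fixed from the domain before any mesh is introduced, so all constants built on [K] are
   uniform over [Th]. *)
have [K K0 hK] := closure_bounded hOmega.
case: halpha => eps eps0 [/andP[hre _] hea]; case/andP: hr => hr0 hr1.
pose C1 := stability_constant1 r alpha eps CI K.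
pose C2 := stability_constant2 r alpha eps CI K muref.
have C10 : 0 < C1 by exact: stability_constant1_gt0.
have C20 : 0 < C2 by exact: stability_constant2_gt0.
exists (Num.sqrt (2 * C1) + Num.sqrt C2).
  by rewrite ltr_pwDl ?sqrtr_ge0 // sqrtr_gt0 mulr_gt0.
move=> M hM rho mu hrho [[L2mu [c [_ hc]]] hmus hmu0 _ hmu1] f gD L2f hgD.
have hT := hTh M hM; have iCI := hCI M hM.
have mO := measurable_Omega hOmega hT.
have smu n : sqint (leb2 R) Omega (mu n) := (sqintP _ mO _).2 (L2mu n).
have sf : sqint (leb2 R) Omega f := (sqintP _ mO _).2 L2f.
have tg := tr_Hhalf hgD.
have smuref i := sqint_L2_ref (hmuref i).
have omu1 (k : 'I_(nt M)) (x : R * R) : otri k x -> \sum_n mu n x = 1.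
  by move=> ox; apply: (hmu1 k); rewrite interior_elt // (jac0 hT).
have omus (k : 'I_(nt M)) i (x : R * R) : oref x -> mu (tri k i) (refmap k x) = muref i x.
  by move=> ox; apply: hmus; exact: oref_interior.
have omu0 (k : 'I_(nt M)) n (x : R * R) : n \notin vset k -> otri k x -> mu n x = 0.
  by move=> nk ox; apply: (hmu0 k) => //; rewrite interior_elt // (jac0 hT).
split.
- exact: (existence hOmega hT hCI0 iCI eps0 hr1 hre hea hK hrho smu hc omu1 sf tg).
- move=> u u' s s' phi phi' h h'.
  exact: (uniqueness hOmega hT hCI0 iCI eps0 hr0 hr1 hre hea hK hrho smu hc omu1 omus omu0 smuref sf tg h h').
move=> u s phi hsol.
have [E1 E2] := stability hOmega hT hCI0 iCI eps0 hr0 hr1 hre hea hK hrho smu hc omu1 omus omu0 smuref sf tg hsol.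
case: hsol => hu hs hphi _ _.
set X := L2norm Omega f + norm_half Omega M gD.
have X0 : 0 <= X by rewrite addr_ge0 ?sqrtr_ge0.
(* The sum of the squares of two nonnegative numbers is at most the square of their sum. *)
have D : pair_int (leb2 R) Omega f f + ip_half Omega M gD gD <= X ^+ 2.
  rewrite -L2norm_sq -[ip_half _ _ _ _]sqr_sqrtr ?(ip_half_ge0 hT) // -/(norm_half Omega M gD) /X sqrrD.
  by rewrite addrAC lerDl mulrn_wge0 // mulr_ge0 ?sqrtr_ge0.
have vl0 : 0 <= norm_VL Omega M u s by exact: sqrtr_ge0.
have vphi0 : 0 <= L2vnorm Omega phi by exact: sqrtr_ge0.
have C120 : 0 <= 2 * C1 by exact: mulr_ge0 (ler0n _ 2) (ltW C10).
rewrite mulrDl; apply: lerD.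
- apply: (le_sqrt_mul vl0 C120 X0); apply: le_trans (norm_VL_bound hOmega hT hu hs) _.
  by rewrite -mulrA ler_pM2l ?ltr0n //; apply: (le_trans E1); rewrite ler_pM2l.
apply: (le_sqrt_mul vphi0 (ltW C20) X0).
rewrite (L2vnorm_sq hOmega hT (sqv_Mh hOmega hT smu hphi)).
by apply: (le_trans E2); rewrite ler_pM2l.
Qed.
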